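(* If $\Gamma$ is a finite (simply-laced, connected) Dynkin graph, then indecomposable representations of the zigzag algebra $A(\Gamma)$, considered up to isomorphism, are in a one-to-one correspondence with the roots of the root system associated to $\Gamma$.
   Context: Zigzag algebra $A(\Gamma)$ over $\mathbb C$: the double $D\Gamma$ of $\Gamma$ has the same vertices, with each edge replaced by two oppositely oriented edges. A path is written as the list $(a_1|\dots|a_k)$ of vertices it visits; the product is concatenation of paths (zero if not concatenable). If $\Gamma$ has more than two vertices, $A(\Gamma)$ is the path algebra of $D\Gamma$ modulo the two-sided ideal generated by (i) $(a|b|c)$ for $a,b$ connected, $b,c$ connected, $a\neq c$, and (ii) $(a|b|a)-(a|c|a)$ whenever $a$ is connected to both $b$ and $c$. If $\Gamma$ consists of two vertices joined by an edge, $A(\Gamma)$ is the path algebra of $D\Gamma$ modulo all paths of length greater than $2$. If $\Gamma$ is a single vertex, $A(\Gamma)=\mathbb C[X]/(X^2)$. Representations are finite-dimensional (ungraded) complex $A(\Gamma)$-modules. Finite Dynkin graphs are those of type $A_n$, $D_n$, $E_6,E_7,E_8$; roots means all roots, positive and negative. *)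

(* Defs.v *)
From HB Require Import structures.
From mathcomp Require Import all_boot all_order all_algebra finmap.
From mathcomp Require Import boolp reals complex monalg.

Set Implicit Arguments.
Unset Strict Implicit.
Unset Printing Implicit Defensive.

Import GRing.Theory.
Local Open Scope ring_scope.

Section TwoSidedIdeal.
Variables (F : comNzRingType) (A : algType F) (G : A -> Prop).

(* Closure under opposites and scalars comes from multiplication by (-1)
   and by c%:A. *)
Inductive two_sided_ideal : A -> Prop :=
| ideal_gen x : G x -> two_sided_ideal x
| ideal_zero : two_sided_ideal 0
| ideal_add x y :
    two_sided_ideal x -> two_sided_ideal y -> two_sided_ideal (x + y)
| ideal_mull a x : two_sided_ideal x -> two_sided_ideal (a * x)
| ideal_mulr a x : two_sided_ideal x -> two_sided_ideal (x * a).

Definition ideal_pred : {pred A} := fun x => `[< two_sided_ideal x >].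

Fact ideal_pred_zmod_closed : zmod_closed ideal_pred.
Proof.
split; first by apply/asboolP; exact: ideal_zero.
move=> x y /asboolP xI /asboolP yI; apply/asboolP.
by apply: ideal_add => //; rewrite -mulN1r; exact: ideal_mull.
Qed.

HB.instance Definition _ :=
  GRing.isZmodClosed.Build A ideal_pred ideal_pred_zmod_closed.

(* Quotient.quot only provides a ring structure over a commutative base, hence
   the construction below.  The argument of quot_alg ensures 1 != 0, which
   algType requires. *)
Definition quot_alg of ~ two_sided_ideal 1 :=
  (Quotient.quot (ideal_pred : zmodClosed A)).

Variable proper : ~ two_sided_ideal 1.
Local Notation Q := (quot_alg proper).
Local Notation Q0 := (Quotient.quot (ideal_pred : zmodClosed A)).

HB.instance Definition _ := GRing.Zmodule.on Q.

Definition quot_pi (x : A) : Q := \pi_Q0%qT x.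
Definition quot_repr (x : Q) : A := repr (x : Q0).

Lemma quot_piP (x y : A) : quot_pi x = quot_pi y <-> two_sided_ideal (x - y).
Proof.
split=> [/eqP|xyI]; first by rewrite -Quotient.idealrBE => /asboolP.
by apply/eqP; rewrite -Quotient.idealrBE; apply/asboolP.
Qed.

Lemma quot_reprK : cancel quot_repr quot_pi.
Proof. exact: reprK. Qed.

Lemma quot_piD : {morph quot_pi : x y / x + y}.
Proof. exact: (@Quotient.pi_add A ideal_pred). Qed.

Definition quot_one : Q := quot_pi 1.
Definition quot_mul (x y : Q) : Q := quot_pi (quot_repr x * quot_repr y).
Definition quot_scale (c : F) (x : Q) : Q := quot_pi (c *: quot_repr x).

Lemma quot_reprP x : two_sided_ideal (x - quot_repr (quot_pi x)).
Proof. by apply/quot_piP; rewrite quot_reprK. Qed.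

Lemma quot_piM x y : quot_mul (quot_pi x) (quot_pi y) = quot_pi (x * y).
Proof.
apply/esym/quot_piP; set x' := quot_repr _; set y' := quot_repr _.
rewrite (_ : _ - _ = x * (y - y') + (x - x') * y'); last first.
  by rewrite mulrBr mulrBl addrA subrK.
by apply: ideal_add; [apply: ideal_mull | apply: ideal_mulr];
  exact: quot_reprP.
Qed.

Lemma quot_piZ c x : quot_scale c (quot_pi x) = quot_pi (c *: x).
Proof.
apply/esym/quot_piP; rewrite -scalerBr -mulr_algl.
by apply: ideal_mull; exact: quot_reprP.
Qed.

Lemma quot_mulA : associative quot_mul.
Proof.
move=> x y z; rewrite -[x]quot_reprK -[y]quot_reprK -[z]quot_reprK.
by rewrite !quot_piM mulrA.
Qed.

Lemma quot_mul1 : left_id quot_one quot_mul.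
Proof. by move=> x; rewrite -[x]quot_reprK quot_piM mul1r. Qed.

Lemma quot_mulr1 : right_id quot_one quot_mul.
Proof. by move=> x; rewrite -[x]quot_reprK quot_piM mulr1. Qed.

Lemma quot_mulDl : left_distributive quot_mul +%R.
Proof.
move=> x y z; rewrite -[x]quot_reprK -[y]quot_reprK -[z]quot_reprK.
by rewrite -quot_piD !quot_piM mulrDl quot_piD.
Qed.

Lemma quot_mulDr : right_distributive quot_mul +%R.
Proof.
move=> x y z; rewrite -[x]quot_reprK -[y]quot_reprK -[z]quot_reprK.
by rewrite -quot_piD !quot_piM mulrDr quot_piD.
Qed.

Lemma quot_pi0 : quot_pi 0 = 0.
Proof. by apply: (addrI (quot_pi 0)); rewrite -quot_piD !addr0. Qed.

Lemma quot_one_neq0 : quot_one != 0.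
Proof. by apply/eqP; rewrite -quot_pi0 => /quot_piP; rewrite subr0. Qed.

HB.instance Definition _ := GRing.Zmodule_isNzRing.Build Q
  quot_mulA quot_mul1 quot_mulr1 quot_mulDl quot_mulDr quot_one_neq0.

Lemma quot_scaleA a b x :
  quot_scale a (quot_scale b x) = quot_scale (a * b) x.
Proof. by rewrite -[x]quot_reprK !quot_piZ scalerA. Qed.

Lemma quot_scale1 : left_id 1 quot_scale.
Proof. by move=> x; rewrite -[x]quot_reprK quot_piZ scale1r. Qed.

Lemma quot_scaleDr : right_distributive quot_scale +%R.
Proof.
move=> c x y; rewrite -[x]quot_reprK -[y]quot_reprK.
by rewrite -quot_piD !quot_piZ scalerDr quot_piD.
Qed.

Lemma quot_scaleDl x : {morph quot_scale^~ x : a b / a + b}.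
Proof. by move=> a b; rewrite -[x]quot_reprK !quot_piZ scalerDl quot_piD. Qed.

HB.instance Definition _ := GRing.Zmodule_isLmodule.Build F Q
  quot_scaleA quot_scale1 quot_scaleDr quot_scaleDl.

Lemma quot_scaleAl c (x y : Q) : c *: (x * y) = c *: x * y.
Proof.
rewrite -[x]quot_reprK -[y]quot_reprK.
rewrite -[LHS]/(quot_scale c (quot_mul _ _)).
rewrite -[RHS]/(quot_mul (quot_scale c _) _).
by rewrite !(quot_piM, quot_piZ) scalerAl.
Qed.

HB.instance Definition _ := GRing.Lmodule_isLalgebra.Build F Q quot_scaleAl.

Lemma quot_scaleAr c (x y : Q) : c *: (x * y) = x * (c *: y).
Proof.
rewrite -[x]quot_reprK -[y]quot_reprK.
rewrite -[LHS]/(quot_scale c (quot_mul _ _)).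
rewrite -[RHS]/(quot_mul _ (quot_scale c _)).
by rewrite !(quot_piM, quot_piZ) scalerAr.
Qed.

HB.instance Definition _ := GRing.Lalgebra_isAlgebra.Build F Q quot_scaleAr.

End TwoSidedIdeal.

Record sgraph := SGraph {
  vertex :> finType;
  adj : rel vertex;
  adj_sym : symmetric adj;
  adj_irr : irreflexive adj;
  vertex_gt0 : (0 < #|vertex|)%N
}.

(* Paths (a_1|...|a_k), k >= 1, in the double of Gamma: since Gamma is simple,
   an arrow of the double is an ordered pair of adjacent vertices. *)
Record dpath (Gamma : sgraph) := DPath {
  path_val : Gamma * seq Gamma;
  path_valP : path (@adj Gamma) path_val.1 path_val.2
}.

HB.instance Definition _ Gamma := [isSub for @path_val Gamma].
HB.instance Definition _ Gamma := [Countable of dpath Gamma by <:].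

Section Paths.
Variable Gamma : sgraph.
Implicit Types p q : dpath Gamma.

Definition path_src p := (path_val p).1.
Definition path_steps p := (path_val p).2.
Definition path_tgt p := last (path_src p) (path_steps p).
(* Number of arrows. *)
Definition path_length p := size (path_steps p).

Definition triv_path (a : Gamma) : dpath Gamma := @DPath Gamma (a, [::]) isT.

(* (a_1|...|a_k) * (a_k|...|a_l) = (a_1|...|a_l); None stands for the zero
   product.  By path_catP, insub never fails here. *)
Definition path_cat p q : option (dpath Gamma) :=
  if path_tgt p == path_src q then
    insub (path_src p, path_steps p ++ path_steps q)
  else None.

Lemma path_catP p q : path_tgt p = path_src q ->
  exists2 r, path_cat p q = Some r &
    path_val r = (path_src p, path_steps p ++ path_steps q).
Proof.
move=> pq; rewrite /path_cat pq eqxx; case: insubP => [r _ rE|]; first by exists r.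
by rewrite /= cat_path (path_valP p) -[last _ _]/(path_tgt p) pq (path_valP q).
Qed.

Variant path_cat_spec p q : option (dpath Gamma) -> Prop :=
| PathCatSome r of path_tgt p = path_src q &
    path_val r = (path_src p, path_steps p ++ path_steps q) :
    path_cat_spec p q (Some r)
| PathCatNone of path_tgt p <> path_src q : path_cat_spec p q None.

Lemma path_catE p q : path_cat_spec p q (path_cat p q).
Proof.
case: (eqVneq (path_tgt p) (path_src q)) => [pq|/eqP pq]; last first.
  by rewrite /path_cat; move/eqP/negbTE: (pq) => ->; constructor.
by case E: (path_cat p q) => [r|]; have [r' + r'E] := path_catP pq;
  rewrite E => // -[->]; constructor.
Qed.

Lemma path_catA p q r :
  obind (path_cat^~ r) (path_cat p q) = obind (path_cat p) (path_cat q r).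
Proof.
case: (path_catE p q) => [s pq sE|npq]; case: (path_catE q r) => [t qr tE|nqr] //=.
- have st : path_tgt s = path_src r.
    by rewrite /path_tgt /path_src /path_steps sE last_cat -/(path_tgt p) pq.
  have pt : path_tgt p = path_src t by rewrite pq /path_src tE.
  have [u -> uE] := path_catP st; have [v -> vE] := path_catP pt.
  congr Some; apply: val_inj; rewrite /= uE vE.
  by rewrite /path_src /path_steps sE tE /= catA.
- case: (path_catE s r) => // u sr; case: nqr; rewrite -sr.
  by rewrite /path_tgt /path_src /path_steps sE last_cat -/(path_tgt p) pq.
- by case: (path_catE p t) => // u pt; case: npq; rewrite pt /path_src tE.
Qed.

End Paths.

(* {malg F[dpath Gamma]} is the space of finitely supported functions on paths,
   and << p >> is the basis vector of p. *)
Definition path_algebra (F : comNzRingType) (Gamma : sgraph) :=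
  {malg F[dpath Gamma]}.

HB.instance Definition _ F Gamma := GRing.Lmodule.on (path_algebra F Gamma).

(* pathv and pa_mul are locked only to keep unification from unfolding them. *)
HB.lock Definition pathv (F : comNzRingType) (Gamma : sgraph)
  (p : dpath Gamma) : path_algebra F Gamma := << p >>.

Definition path_prod (F : comNzRingType) (Gamma : sgraph) (p q : dpath Gamma) :
  path_algebra F Gamma := oapp (@pathv F Gamma) 0 (path_cat p q).

HB.lock Definition pa_mul (F : comNzRingType) (Gamma : sgraph)
    (f g : path_algebra F Gamma) : path_algebra F Gamma :=
  \sum_(p <- msupp f) \sum_(q <- msupp g) (f@_p * g@_q) *: path_prod F p q.

Section PathAlgebra.
Variables (F : comNzRingType) (Gamma : sgraph).
Local Notation P := (path_algebra F Gamma).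
Local Notation pathv := (@pathv F Gamma).
Local Notation path_prod := (@path_prod F Gamma).
Local Notation pa_mul := (@pa_mul F Gamma).
Implicit Types (f g h : P) (p q : dpath Gamma) (a b : Gamma).

Definition pa_one : P := \sum_a pathv (triv_path a).

Definition linext (V : lmodType F) (h : dpath Gamma -> V) f : V :=
  \sum_(p <- msupp f) f@_p *: h p.

Lemma linextEw (V : lmodType F) (h : dpath Gamma -> V) (D : {fset dpath Gamma}) f :
  (msupp f `<=` D)%fset -> linext h f = \sum_(p <- D) f@_p *: h p.
Proof.
move=> le; rewrite [LHS](big_fset_incl _ le) //= => x _ /mcoeff_outdom ->.
by rewrite scale0r.
Qed.

Lemma linext_is_linear (V : lmodType F) (h : dpath Gamma -> V) : linear (linext h).
Proof.
move=> c f g; pose D := (msupp f `|` msupp g `|` msupp (c *: f + g))%fset.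
rewrite !(@linextEw _ _ D) ?fsubsetUr //; try by
  apply/fsubsetP => x; rewrite !inE => ->; rewrite ?orbT.
rewrite scaler_sumr -big_split; apply: eq_bigr => p _ /=.
by rewrite mcoeffD mcoeffZ scalerDl scalerA.
Qed.

HB.instance Definition _ (V : lmodType F) (h : dpath Gamma -> V) :=
  GRing.isLinear.Build F P V *:%R (linext h) (linext_is_linear h).

Lemma linext_pathv (V : lmodType F) (h : dpath Gamma -> V) p : linext h (pathv p) = h p.
Proof.
by rewrite pathv.unlock (linextEw _ (msuppU_le (k := p) (x := 1))) big_seq_fset1 mcoeffUU scale1r.
Qed.

Lemma pathv_ext (V : lmodType F) (u v : {linear P -> V}) :
  (forall p, u (pathv p) = v (pathv p)) -> u =1 v.
Proof.
move=> uv f; have -> : f = \sum_(p <- msupp f) f@_p *: pathv p.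
  rewrite [LHS]monalgE; apply: eq_bigr => p _; apply/malgP => k.
  by rewrite pathv.unlock mcoeffZ [LHS]mcoeffU [X in _ * X]mcoeffU mulrnAr mulr1.
by rewrite !linear_sum; apply: eq_bigr => p _; rewrite !linearZ /= uv.
Qed.

Lemma pa_mulE f g : pa_mul f g = linext (fun p => linext (path_prod p) g) f.
Proof.
rewrite pa_mul.unlock; apply: eq_bigr => p _; rewrite scaler_sumr; apply: eq_bigr => q _.
by rewrite scalerA.
Qed.

Lemma pa_mulEr f g : pa_mul f g = linext (fun q => linext (path_prod^~ q) f) g.
Proof.
rewrite pa_mul.unlock exchange_big; apply: eq_bigr => q _; rewrite scaler_sumr.
by apply: eq_bigr => p _; rewrite scalerA mulrC.
Qed.

Lemma pa_mull_is_linear g : linear (pa_mul^~ g).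
Proof. by move=> c x y; rewrite !pa_mulE linearP. Qed.

Lemma pa_mulr_is_linear f : linear (pa_mul f).
Proof. by move=> c x y; rewrite !pa_mulEr linearP. Qed.

HB.instance Definition _ f :=
  GRing.isLinear.Build F P P *:%R (pa_mul f) (pa_mulr_is_linear f).

Definition pa_mulr g f := pa_mul f g.

HB.instance Definition _ g :=
  GRing.isLinear.Build F P P *:%R (pa_mulr g) (pa_mull_is_linear g).

Lemma pa_mul_pathv p q : pa_mul (pathv p) (pathv q) = path_prod p q.
Proof. by rewrite pa_mulE !linext_pathv. Qed.

Lemma pa_mul0 f : pa_mul f 0 = 0.
Proof. exact: linear0. Qed.

Lemma pa_0mul f : pa_mul 0 f = 0.
Proof. exact: (linear0 (pa_mulr f)). Qed.

Lemma pa_mulA : associative pa_mul.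
Proof.
move=> f g h.
pose u1 : {linear P -> P} := pa_mulr (pa_mul g h).
pose v1 : {linear P -> P} := pa_mulr h \o pa_mulr g.
apply: (pathv_ext (u := u1) (v := v1)) => p; rewrite /u1 /v1 /= /pa_mulr.
pose u2 : {linear P -> P} := pa_mul (pathv p) \o pa_mulr h.
pose v2 : {linear P -> P} := pa_mulr h \o pa_mul (pathv p).
apply: (pathv_ext (u := u2) (v := v2)) => q; rewrite /u2 /v2 /= /pa_mulr.
pose u3 : {linear P -> P} := pa_mul (pathv p) \o pa_mul (pathv q).
pose v3 : {linear P -> P} := pa_mul (pa_mul (pathv p) (pathv q)).
apply: (pathv_ext (u := u3) (v := v3)) => r; rewrite /u3 /v3 /=.
rewrite [X in pa_mul _ X]pa_mul_pathv [X in _ = pa_mul X _]pa_mul_pathv.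
rewrite /(path_prod q r) /(path_prod p q).
have := path_catA p q r.
case: (path_cat p q) (path_cat q r) => [s|] [t|] /=; rewrite ?pa_mul0 ?pa_0mul.
- by rewrite !pa_mul_pathv /path_prod => ->.
- by rewrite pa_mul_pathv /path_prod => ->.
- by rewrite pa_mul_pathv /path_prod => <-.
- by [].
Qed.

Lemma path_prod_trivl a p :
  path_prod (triv_path a) p = if a == path_src p then pathv p else 0.
Proof.
rewrite /path_prod; case: path_catE => [r ap rE|/eqP/negbTE -> //].
rewrite -[a]/(path_tgt (triv_path a)) ap eqxx /=; congr pathv.
apply: val_inj; rewrite /= rE -[path_src _]/(path_tgt (triv_path a)) ap /=.
by rewrite /path_src /path_steps; case: (path_val p).
Qed.

Lemma path_prod_trivr a p :
  path_prod p (triv_path a) = if a == path_tgt p then pathv p else 0.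
Proof.
rewrite /path_prod eq_sym; case: path_catE => [r pa rE|/eqP/negbTE -> //].
rewrite pa eqxx /=; congr pathv; apply: val_inj; rewrite /= rE cats0.
by rewrite /path_src /path_steps; case: (path_val p).
Qed.

Lemma pa_mul1 : left_id pa_one pa_mul.
Proof.
move=> f; apply: (pathv_ext (u := pa_mul pa_one) (v := idfun)) => p /=.
rewrite -/(pa_mulr _ _) linear_sum /= (bigD1 (path_src p)) //= big1 => [|a ap].
  by rewrite /pa_mulr pa_mul_pathv path_prod_trivl eqxx addr0.
by rewrite /pa_mulr pa_mul_pathv path_prod_trivl (negbTE ap).
Qed.

Lemma pa_mulr1 : right_id pa_one pa_mul.
Proof.
move=> f; apply: (pathv_ext (u := pa_mulr pa_one) (v := idfun)) => p /=.
rewrite /pa_mulr linear_sum /= (bigD1 (path_tgt p)) //= big1 => [|a ap].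
  by rewrite pa_mul_pathv path_prod_trivr eqxx addr0.
by rewrite pa_mul_pathv path_prod_trivr (negbTE ap).
Qed.

Lemma pa_mulDl : left_distributive pa_mul +%R.
Proof. by move=> f g h; rewrite -!/(pa_mulr _ _) linearD. Qed.

Lemma pa_mulDr : right_distributive pa_mul +%R.
Proof. by move=> f g h; rewrite linearD. Qed.

Lemma triv_path_inj : injective (@triv_path Gamma).
Proof. by move=> a b []. Qed.

Lemma mcoeff_pathv p q : (pathv p)@_q = (p == q)%:R.
Proof. by rewrite pathv.unlock; exact: mcoeffU. Qed.

Lemma pa_one_triv a : pa_one@_(triv_path a) = 1.
Proof.
rewrite raddf_sum /= (bigD1 a) //= mcoeff_pathv eqxx big1 ?addr0 // => b ba.
by rewrite mcoeff_pathv (inj_eq triv_path_inj) (negbTE ba).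
Qed.

Definition base_vertex : Gamma := enum_val (Ordinal (vertex_gt0 Gamma)).

Lemma pa_one_neq0 : pa_one != 0.
Proof.
apply/eqP => /(congr1 (mcoeff (triv_path base_vertex))) /eqP.
by rewrite pa_one_triv mcoeff0 oner_eq0.
Qed.

HB.instance Definition _ := GRing.Zmodule_isNzRing.Build P
  pa_mulA pa_mul1 pa_mulr1 pa_mulDl pa_mulDr pa_one_neq0.

Lemma pa_scaleAl c f g : c *: (f * g) = c *: f * g.
Proof. exact: esym (linearZ_LR (pa_mulr g) c f). Qed.

HB.instance Definition _ := GRing.Lmodule_isLalgebra.Build F P pa_scaleAl.

Lemma pa_scaleAr c f g : c *: (f * g) = f * (c *: g).
Proof. exact: esym (linearZ_LR (pa_mul f) c g). Qed.

HB.instance Definition _ := GRing.Lalgebra_isAlgebra.Build F P pa_scaleAr.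

Lemma pathvM p q : pathv p * pathv q = path_prod p q.
Proof. exact: pa_mul_pathv. Qed.

Lemma mcoeff_path_prod_triv p q a :
  (path_prod p q)@_(triv_path a) = (p == triv_path a)%:R * (q == triv_path a)%:R.
Proof.
rewrite -natrM mulnb /path_prod; case: path_catE => [r pq rE|npq] /=.
  rewrite mcoeff_pathv -!val_eqE /= rE /=; congr (_%:R); congr nat_of_bool.
  move: pq; rewrite /path_tgt /path_src /path_steps.
  case: (path_val p) (path_val q) => b [|? ?] [c [|? ?]] //= pq.
  - by rewrite pq andbb.
  - by rewrite !xpair_eqE !andbF.
  - by rewrite !xpair_eqE !andbF.
  - by rewrite !xpair_eqE !andbF.
rewrite mcoeff0; case: eqP => //= pE; case: eqP => // qE.
by case: npq; rewrite pE qE.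
Qed.

Lemma mcoeff_is_linear q : linear (mcoeff q : P -> F^o).
Proof. by move=> c f g; rewrite mcoeffD mcoeffZ. Qed.

Lemma mcoeff_trivM a f g :
  (f * g)@_(triv_path a) = f@_(triv_path a) * g@_(triv_path a).
Proof.
pose t := triv_path a.
have linl (k : P) : linear ((fun f => (f * k)@_t) : P -> F^o).
  by move=> c x y; rewrite mulrDl -scalerAl mcoeff_is_linear.
have linl' (k : P) : linear ((fun f => f@_t * k@_t) : P -> F^o).
  by move=> c x y; rewrite mcoeffD mcoeffZ mulrDl -mulrA.
have linr (k : P) : linear ((fun f => (k * f)@_t) : P -> F^o).
  by move=> c x y; rewrite mulrDr -scalerAr mcoeff_is_linear.
have linr' (k : P) : linear ((fun f => k@_t * f@_t) : P -> F^o).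
  by move=> c x y; rewrite mcoeffD mcoeffZ mulrDr mulrCA.
pose L (u : P -> F^o) (ul : linear u) : {linear P -> F^o} :=
  HB.pack u (GRing.isLinear.Build F P F^o *:%R u ul).
apply: (pathv_ext (u := L _ (linl g)) (v := L _ (linl' g))) => p /=.
apply: (pathv_ext (u := L _ (linr (pathv p))) (v := L _ (linr' (pathv p)))) => q.
by rewrite /= pathvM mcoeff_path_prod_triv !mcoeff_pathv.
Qed.

Lemma ideal_coef0 (G : P -> Prop) a :
  (forall f, G f -> f@_(triv_path a) = 0) ->
  forall f, two_sided_ideal G f -> f@_(triv_path a) = 0.
Proof.
move=> G0 f; elim=> {f} [f /G0 //||f g _ f0 _ g0|f g _ g0|f g _ g0].
- exact: mcoeff0.
- by rewrite mcoeffD f0 g0 addr0.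
- by rewrite mcoeff_trivM g0 mulr0.
- by rewrite mcoeff_trivM g0 mul0r.
Qed.

Lemma ideal_proper (G : P -> Prop) :
  (forall f a, G f -> f@_(triv_path a) = 0) -> ~ two_sided_ideal G 1.
Proof.
move=> G0 /(ideal_coef0 (a := base_vertex) (fun f => G0 f _)) /eqP.
by rewrite (pa_one_triv base_vertex) oner_eq0.
Qed.

End PathAlgebra.

Section Zigzag.
Variables (F : comNzRingType) (Gamma : sgraph).
Local Notation P := (path_algebra F Gamma).

Definition path2 (a b c : Gamma) (ab : adj a b) (bc : adj b c) : dpath Gamma :=
  @DPath Gamma (a, [:: b; c]) (introT and3P (And3 ab bc isT)).

Lemma adj_symm (a b : Gamma) : adj a b -> adj b a.
Proof. by rewrite adj_sym. Qed.

(* (a|b|c) with a != c, and (a|b|a) - (a|c|a). *)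
Inductive zigzag_rel : P -> Prop :=
| zigzag_rel_straight a b c (ab : adj a b) (bc : adj b c) of a != c :
    zigzag_rel (pathv F (path2 ab bc))
| zigzag_rel_back a b c (ab : adj a b) (ac : adj a c) :
    zigzag_rel (pathv F (path2 ab (adj_symm ab))
                - pathv F (path2 ac (adj_symm ac))).

Inductive long_path_rel : P -> Prop :=
| long_path_relP p of (2 < path_length p)%N : long_path_rel (pathv F p).

Definition zigzag_ideal_rel : P -> Prop :=
  if #|Gamma| == 2%N then long_path_rel else zigzag_rel.

Fact zigzag_ideal_proper : ~ two_sided_ideal zigzag_ideal_rel 1.
Proof.
apply: ideal_proper => f a; rewrite /zigzag_ideal_rel; case: ifP => _ [].
- move=> p p2; rewrite mcoeff_pathv; case: eqP => // pE.
  by rewrite pE in p2.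
- by move=> b c d bc cd _; rewrite mcoeff_pathv; case: eqP.
- move=> b c d bc bd; rewrite mcoeffB !mcoeff_pathv.
  by do 2![case: eqP => //]; rewrite subrr.
Qed.

Definition zigzag_algebra : algType F :=
  if #|Gamma| == 1%N then ({poly %/ ('X^2 : {poly F})} : algType F)
  else (quot_alg zigzag_ideal_proper : algType F).

End Zigzag.

Section Representations.
Variables (F : comNzRingType) (A : algType F).
Implicit Types U V W : lmodType A.

(* Finite dimension over F, which acts on V through c |-> c%:A. *)
Definition fin_dim V : Prop :=
  exists s : seq V, forall v : V, exists c : 'I_(size s) -> F,
    v = \sum_i (c i)%:A *: s`_i.

Definition rep_iso U V : Prop := exists f : {linear U -> V}, bijective f.

Definition zero_rep V : Prop := forall v : V, v = 0.

Definition indecomposable V : Prop :=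
  ~ zero_rep V /\
  forall U W, rep_iso V (U * W)%type -> zero_rep U \/ zero_rep W.

End Representations.

Section Roots.
Variable Gamma : sgraph.

(* Coordinates with respect to the simple roots. *)
Definition root_lattice := {ffun Gamma -> int}.
Implicit Types x : root_lattice.

Definition simple_root (a : Gamma) : root_lattice := [ffun b => (b == a)%:Z].

(* The pairing of x with the simple coroot of a, for the Cartan matrix
   2 - (adjacency matrix). *)
Definition coroot_pairing x (a : Gamma) : int :=
  2 * x a - \sum_(b | adj a b) x b.

Definition reflection (a : Gamma) x : root_lattice :=
  x - simple_root a *~ coroot_pairing x a.

(* The orbit of the simple roots under the Weyl group. *)
Inductive is_root : root_lattice -> Prop :=
| is_root_simple a : is_root (simple_root a)
| is_root_reflection a x : is_root x -> is_root (reflection a x).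

End Roots.

Variant dynkin_type := DynA of nat | DynD of nat | DynE of nat.

Definition dynkin_rank (t : dynkin_type) : nat :=
  match t with DynA n | DynD n | DynE n => n end.

Definition dynkin_wf (t : dynkin_type) : bool :=
  match t with
  | DynA n => (1 <= n)%N
  | DynD n => (4 <= n)%N
  | DynE n => (6 <= n <= 8)%N
  end.

(* Vertices are numbered from 0.  For D_n and E_n the vertices 0, ..., n-2
   form a chain, and n-1 is attached to n-3, respectively to 2. *)
Definition dynkin_arrow (t : dynkin_type) (i j : nat) : bool :=
  match t with
  | DynA n => j == i.+1
  | DynD n => (j == i.+1) && (j < n.-1)%N || (i == (n - 3)%N) && (j == n.-1)
  | DynE n => (j == i.+1) && (j < n.-1)%N || (i == 2%N) && (j == n.-1)
  end.

Definition dynkin_adj (t : dynkin_type) : rel nat :=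
  fun i j => dynkin_arrow t i j || dynkin_arrow t j i.

Definition dynkin (Gamma : sgraph) : Prop :=
  exists2 t, dynkin_wf t &
  exists2 f : Gamma -> 'I_(dynkin_rank t),
    bijective f & forall a b, adj a b = dynkin_adj t (f a) (f b).

(* Main.v *)
Require Import Defs.
From HB Require Import structures.
From mathcomp Require Import all_boot all_order all_algebra reals complex.
From mathcomp Require Import boolp.
From mathcomp Require Import zify ring lra.

Set Implicit Arguments.
Unset Strict Implicit.
Unset Printing Implicit Defensive.

Import Order.TTheory GRing.Theory.
Local Open Scope ring_scope.

(** Let x_ab be the arrows of the zigzag algebra and z_a its loops, the classes
    of the paths (a|b|a). The correspondence comes from Gabriel's theorem for
    the bipartite double cover of the graph.

    On an indecomposable module some z_a is nonzero or all loops vanish. In the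
    first case the module is the projective-injective module at a
    ([mindec_proj_id], [proj_uniq]), and there is one such module for each
    vertex ([proj_exists]). In the second case the square of the radical acts
    by zero, and the module is given by its top X, its radical Y and the maps
    X_a -> Y_b along the edges a - b ([total_decomp]); these form a
    representation of the double cover with its source-sink orientation, in
    which the maps into each Y_b are jointly surjective. Indecomposability and
    isomorphism are the same for the module and for (X, Y), since an endomorphism
    of the module is one of (X, Y) up to a part of square zero
    ([mindec_total_bindec], [bindec_total_mindec], [biso_total], [total_biso]).

    Gabriel's theorem is proved with the functor that reflects at all sinks at
    once: (X, Y) goes to (K, X), where K_b is the kernel of the map to Y_b from
    the sum of the X_a over the neighbours a of b. It stays inside one and the
    same category and is inverted by cokernels, unless the maps into some Y_b
    fail to be jointly surjective; an indecomposable representation with this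
    defect is the simple one at the sink b ([bindec_surj]). On dimension vectors
    the reflection is (x, y) |-> (A x - y, x), where A is the adjacency matrix.
    A Dynkin graph carries a positive weight w with A w < 2 w
    ([dynkin_graph_weight]). This inequality makes the Tits form positive
    definite ([tits_gt0]) and makes iterated reflections end ([pair_ind]).
    Hence an indecomposable representation has a dimension vector on which the
    Tits form is 1, is determined by that vector, and exists for each
    nonnegative vector of this kind ([bindec_tits], [bindec_uniq],
    [bindec_exists]).

    The roots of the graph are the vectors on which its Tits form is 1
    ([is_root_form], [form_is_root]), and each of them is nonnegative or
    nonpositive. As the graph is bipartite, its double cover is two copies of
    it: a positive root is a dimension vector on the first copy, and the
    opposite of a negative root one on the second copy. In this way the roots
    correspond to the indecomposable representations of the double cover. The
    simple ones at the n sinks are not the top and radical of a module; their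
    roots, which are one of the two signs of each simple root, correspond to the
    n projective modules ([root_module]).

    The three cases in the definition of the zigzag algebra are treated
    together through one list of relations on idempotents, arrows and loops,
    which is shown to present the algebra ([zigzag_algebra_presentation]). *)

(** * Direct sums and short exact sequences in coordinates *)

Section LinearAlgebra.
Variables (F : fieldType) (I : finType) (P : pred I).

(** The coordinates of the direct sum are the pairs (summand, index), so that
    inclusions and projections are 0-1 matrices. *)
Lemma biproduct_exists (d : I -> nat) :
  exists N (i : forall k, 'M[F]_(d k, N)) (p : forall k, 'M[F]_(N, d k)),
  [/\ N = (\sum_(k | P k) d k)%N,
      forall k, P k -> i k *m p k = 1%:M,
      forall k l, k != l -> i k *m p l = 0 &
      \sum_(k | P k) p k *m i k = 1%:M].
Proof.
pose T := {k : I & 'I_(d k)}; pose A := [pred t : T | P (tag t)].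
pose t_ k (r : 'I_(d k)) : T := Tagged (fun k => 'I_(d k)) r.
pose i k : 'M[F]_(d k, #|A|) := \matrix_(r, j) (enum_val j == t_ k r)%:R.
exists #|A|, i, (fun k => (i k)^T).
have mulE k l r s : (i k *m (i l)^T) r s = (P k && (t_ k r == t_ l s))%:R.
  rewrite !mxE; under eq_bigr => j _ do rewrite !mxE -natrM mulnb.
  rewrite -(big_enum_val (A := A) (fun t => ((t == t_ k r) && (t == t_ l s))%:R)) /=.
  rewrite big_mkcond (bigD1 (t_ k r)) //= big1 => [|t /negbTE ->]; last by case: ifP.
  by rewrite eqxx addr0 inE /=; case: ifP.
split.
- rewrite -sum1_card (eq_bigr (fun k => \sum_(r < d k) 1)%N) => [|k _]; last first.
    by rewrite sum1_card card_ord.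
  by rewrite sig_big_dep /=; apply: eq_bigl => -[k r]; rewrite !inE /= andbT.
- move=> k Pk; apply/matrixP => r s; rewrite mulE Pk !mxE /=; congr (_%:R).
  by congr nat_of_bool; rewrite eq_Tagged.
- move=> k l kl; apply/matrixP => r s; rewrite mulE !mxE.
  case: eqP => [/(congr1 tag) /= E|]; last by rewrite andbF.
  by rewrite E eqxx in kl.
- apply/matrixP => j j'; rewrite summxE mxE.
  under eq_bigr => k _ do rewrite mxE; under eq_bigr => k _ do under eq_bigr => r _ do
    rewrite !mxE -natrM mulnb.
  rewrite (sig_big_dep _ _ (fun k r => ((enum_val j == t_ k r) && (enum_val j' == t_ k r))%:R)).
  rewrite (bigD1 (enum_val j)) /=; last by rewrite andbT; have := enum_valP j.
  rewrite big1 => [|[k r] /andP[_ /negbTE]]; last by rewrite /t_ /= eq_sym => ->.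
  rewrite /t_ taggedK eqxx /= addr0; congr (_%:R); congr nat_of_bool.
  by rewrite eq_sym (inj_eq enum_val_inj).
Qed.

(** Exactness of 0 -> F^k -> (+)_(P a) F^(x a) -> F^y -> 0 for maps given by
    their components; [se_ker] and [se_coker] are the universal properties of
    the kernel and of the cokernel, on families of matrices of any height
    (or width), which is the form in which exactness is used. *)
Record short_exact (x : I -> nat) k y (psi : forall a, 'M[F]_(k, x a))
    (phi : forall a, 'M[F]_(x a, y)) : Prop := ShortExact {
  se_comp : \sum_(a | P a) psi a *m phi a = 0;
  se_inj m (u : 'M_(m, k)) : (forall a, P a -> u *m psi a = 0) -> u = 0;
  se_surj m (u : 'M_(y, m)) : (forall a, P a -> phi a *m u = 0) -> u = 0;
  se_ker m (v : forall a, 'M_(m, x a)) : \sum_(a | P a) v a *m phi a = 0 ->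
    exists u : 'M_(m, k), forall a, P a -> v a = u *m psi a;
  se_coker m (v : forall a, 'M_(x a, m)) : \sum_(a | P a) psi a *m v a = 0 ->
    exists u : 'M_(y, m), forall a, P a -> v a = phi a *m u;
  se_dim : (k + y)%N = (\sum_(a | P a) x a)%N
}.

(** Both universal properties hold for the rows of [kermx] of the stacked map:
    a family annihilated by the map is a combination of these rows, and a map
    that vanishes on them factors through the given one by [pinvmx]. *)
Lemma kernel_exists (x : I -> nat) y (phi : forall a, 'M[F]_(x a, y)) :
  (forall m (u : 'M_(y, m)), (forall a, P a -> phi a *m u = 0) -> u = 0) ->
  exists k (psi : forall a, 'M[F]_(k, x a)), short_exact psi phi.
Proof.
move=> surj; have [N [i [p [NE ip1 ip0 pi1]]]] := biproduct_exists x.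
pose Phi := \sum_(a | P a) p a *m phi a.
have iP a : P a -> i a *m Phi = phi a.
  move=> Pa; rewrite mulmx_sumr (bigD1 a) //= mulmxA ip1 // mul1mx big1 ?addr0 //.
  by move=> b /andP[_ ba]; rewrite mulmxA ip0 ?mul0mx // eq_sym.
have iPhi m (v : forall a, 'M_(m, x a)) b :
    P b -> (\sum_(a | P a) v a *m i a) *m p b = v b.
  move=> Pb; rewrite mulmx_suml (bigD1 b) //= -mulmxA ip1 // mulmx1 big1 ?addr0 //.
  by move=> a /andP[_ ab]; rewrite -mulmxA ip0 // mulmx0.
exists (\rank (kermx Phi)), (fun a => row_base (kermx Phi) *m p a); split=> //.
- under eq_bigr => a _ do rewrite -mulmxA.
  by rewrite -mulmx_sumr; apply/sub_kermxP; rewrite eq_row_base.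
- move=> m u u0; apply: (row_free_inj (row_base_free (kermx Phi))).
  rewrite mul0mx -[LHS]mulmx1 -pi1 mulmx_sumr big1 // => a Pa.
  by rewrite mulmxA -(mulmxA u) u0 // mul0mx.
- move=> m v v0; pose V := \sum_(a | P a) v a *m i a.
  have /submxP[u uE] : (V <= row_base (kermx Phi))%MS.
    rewrite eq_row_base; apply/sub_kermxP; rewrite mulmx_suml -[RHS]v0.
    by apply: eq_bigr => a Pa; rewrite -mulmxA iP.
  by exists u => a Pa; rewrite mulmxA -uE iPhi.
- move=> m v v0; pose V := \sum_(a | P a) p a *m v a.
  exists (pinvmx Phi *m V) => a Pa.
  have iV : i a *m V = v a.
    rewrite mulmx_sumr (bigD1 a) //= mulmxA ip1 // mul1mx big1 ?addr0 //.
    by move=> b /andP[_ ba]; rewrite mulmxA ip0 ?mul0mx // eq_sym.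
  suff VE : V = Phi *m (pinvmx Phi *m V) by rewrite -iP // -mulmxA -VE.
  apply/eqP; rewrite -subr_eq0 mulmxA -{1}[V]mul1mx -mulmxBl.
  have /submxP[D ->] : (1%:M - Phi *m pinvmx Phi <= row_base (kermx Phi))%MS.
    rewrite eq_row_base; apply/sub_kermxP.
    by rewrite mulmxBl mul1mx mulmxKpV ?subrr.
  rewrite -mulmxA; apply/eqP; rewrite -[RHS](mulmx0 _ D); congr (D *m _).
  by rewrite -[RHS]v0 mulmx_sumr; apply: eq_bigr => b _; rewrite mulmxA.
- rewrite -NE mxrank_ker; suff rk : \rank Phi = y.
    by rewrite -{2}rk subnK // rank_leq_row.
  have : cokermx Phi = 0.
    by apply: surj => a Pa; rewrite -iP // -mulmxA mulmx_coker mulmx0.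
  move=> /(congr1 (@mxrank _ _ _)); rewrite mxrank_coker mxrank0 => /eqP.
  by rewrite subn_eq0 => le; apply/eqP; rewrite eqn_leq le rank_leq_col.
Qed.

End LinearAlgebra.

Lemma short_exact_tr (F : fieldType) (I : finType) (P : pred I) (x : I -> nat) k y
    (psi : forall a, 'M[F]_(k, x a)) (phi : forall a, 'M[F]_(x a, y)) :
  short_exact P psi phi ->
  short_exact P (fun a => (phi a)^T) (fun a => (psi a)^T).
Proof.
case=> comp inj surj ker coker dimE; split.
- apply: trmx_inj; rewrite trmx0 linear_sum -[RHS]comp; apply: eq_bigr => a _ /=.
  by rewrite trmx_mul !trmxK.
- move=> m u u0; apply: trmx_inj; rewrite trmx0; apply: surj => a Pa.
  by rewrite -[phi a]trmxK -trmx_mul u0 // trmx0.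
- move=> m u u0; apply: trmx_inj; rewrite trmx0; apply: inj => a Pa.
  by rewrite -[psi a]trmxK -trmx_mul u0 // trmx0.
- move=> m v v0; have [|u uE] := coker m (fun a => (v a)^T).
    apply: trmx_inj; rewrite trmx0 linear_sum -[RHS]v0; apply: eq_bigr => a _ /=.
    by rewrite trmx_mul !trmxK.
  by exists u^T => a Pa; rewrite -trmx_mul -uE // trmxK.
- move=> m v v0; have [|u uE] := ker m (fun a => (v a)^T).
    apply: trmx_inj; rewrite trmx0 linear_sum -[RHS]v0; apply: eq_bigr => a _ /=.
    by rewrite trmx_mul !trmxK.
  by exists u^T => a Pa; rewrite -trmx_mul -uE // trmxK.
- by rewrite addnC.
Qed.

Lemma cokernel_exists (F : fieldType) (I : finType) (P : pred I) (x : I -> nat) k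
    (psi : forall a, 'M[F]_(k, x a)) :
  (forall m (u : 'M_(m, k)), (forall a, P a -> u *m psi a = 0) -> u = 0) ->
  exists y (phi : forall a, 'M[F]_(x a, y)), short_exact P psi phi.
Proof.
move=> inj; have [|y [phi /short_exact_tr exact]] :=
  kernel_exists (P := P) (phi := fun a => (psi a)^T).
  move=> m u u0; apply: trmx_inj; rewrite trmx0; apply: inj => a Pa.
  by rewrite -[psi a]trmxK -trmx_mul u0 // trmx0.
exists y, (fun a => (phi a)^T); case: exact => comp inj' surj ker coker dimE; split=> //.
- by rewrite -[RHS]comp; apply: eq_bigr => a _; rewrite trmxK.
- by move=> m v v0; have [|u uE] := ker m v;
    [rewrite -[RHS]v0 | exists u => a Pa; rewrite uE // trmxK].
- move=> m v v0; have [|u uE] := coker m v; last by exists u.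
  by rewrite -[RHS]v0; apply: eq_bigr => a _; rewrite trmxK.
Qed.

(** * The Tits form of the bipartite double cover *)

Section TitsForm.
Import Num.Theory.
Variable Gamma : sgraph.
Implicit Types (x y : Gamma -> int) (a b : Gamma).

Definition nbr_sum x b : int := \sum_(a | adj b a) x a.

(** The quadratic form sum x_a^2 + sum y_b^2 - sum_(a - b) x_a y_b, on
    dimension vectors with sources [x] and sinks [y]; it is grouped by sinks
    because reflections at sinks act on the second sum term by term. *)
Definition tits x y : int := \sum_a x a ^+ 2 + \sum_b y b * (y b - nbr_sum x b).

Lemma nbr_sum_pairing x y : \sum_b y b * nbr_sum x b = \sum_a x a * nbr_sum y a.
Proof.
under eq_bigr => b _ do rewrite mulr_sumr.
under [RHS]eq_bigr => b _ do rewrite mulr_sumr.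
rewrite (exchange_big_dep xpredT) //=; apply: eq_bigr => a _.
by apply: eq_big => [b|b _]; [rewrite adj_sym | rewrite mulrC].
Qed.

Lemma titsC x y : tits x y = tits y x.
Proof.
rewrite /tits; under [X in _ + X]eq_bigr => b _ do rewrite mulrBr.
under [X in _ = _ + X]eq_bigr => b _ do rewrite mulrBr.
by rewrite !sumrB nbr_sum_pairing !addrA; congr (_ - _); rewrite addrC.
Qed.

Lemma eq_tits x x' y y' : x =1 x' -> y =1 y' -> tits x y = tits x' y'.
Proof. by move=> /funext -> /funext ->. Qed.

(** The term y (y - s) does not change under y |-> s - y. *)
Lemma tits_reflect x y y' :
  (forall b, y' b = y b \/ y' b = nbr_sum x b - y b) -> tits x y' = tits x y.
Proof.
move=> yE; congr (_ + _); apply: eq_bigr => b _; case: (yE b) => -> //.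
by rewrite addrAC subrr add0r mulrN mulrC -mulrN opprB.
Qed.

Lemma tits0 : tits (fun=> 0) (fun=> 0) = 0.
Proof. by rewrite /tits !big1 // => a _; rewrite ?mul0r. Qed.

Lemma titsN x y : tits (fun a => - x a) (fun a => - y a) = tits x y.
Proof.
congr (_ + _); apply: eq_bigr => a _; first by rewrite sqrrN.
by rewrite /nbr_sum sumrN -opprD mulrNN.
Qed.

Variable w : Gamma -> int.
Hypotheses (w_gt0 : forall a, 0 < w a) (w_nbr : forall a, nbr_sum w a < 2 * w a).

(** The weight [w] is an eigenvector surrogate: bounding 2 x_a y_b by
    x_a^2 w_b / w_a + y_b^2 w_a / w_b and summing leaves the positive
    coefficient 2 - (sum of [w] over the neighbours of a) / w_a on each
    square. *)
Lemma tits_gt0 x y : (exists a, (x a != 0) || (y a != 0)) -> 0 < tits x y.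
Proof.
case=> c c0; pose W a : rat := (w a)%:~R; pose X a : rat := (x a)%:~R.
pose Y a : rat := (y a)%:~R.
have W0 a : 0 < W a by rewrite ltr0z.
pose D a := 2 - (nbr_sum w a)%:~R / W a.
have D0 a : 0 < D a.
  by rewrite subr_gt0 ltr_pdivrMr // -[2]/(2%:~R) -intrM ltr_int.
have amgm a b : 2 * (X a * Y b) <= X a ^+ 2 * (W b / W a) + Y b ^+ 2 * (W a / W b).
  rewrite -subr_ge0.
  have -> : X a ^+ 2 * (W b / W a) + Y b ^+ 2 * (W a / W b) - 2 * (X a * Y b)
     = (X a * W b - Y b * W a) ^+ 2 / (W a * W b).
    by have := W0 a; have := W0 b; move=> *; field; rewrite !gt_eqF.
  by apply: divr_ge0; [exact: sqr_ge0 | rewrite mulr_ge0 // ltW].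
have titsE : (tits x y)%:~R = \sum_a X a ^+ 2 + \sum_a Y a ^+ 2
    - \sum_a \sum_(b | adj a b) X a * Y b.
  rewrite /tits intrD -addrA !rmorph_sum /=; congr (_ + _).
    by apply: eq_bigr => a _; rewrite rmorphXn.
  have -> : \sum_a \sum_(b | adj a b) X a * Y b = \sum_a \sum_(b | adj a b) Y a * X b.
    rewrite (exchange_big_dep xpredT) //=; apply: eq_bigr => a _.
    by apply: eq_big => [b|b _]; [rewrite adj_sym | rewrite mulrC].
  rewrite -sumrB; apply: eq_bigr => a _.
  by rewrite rmorphM rmorphB /= mulrBr /nbr_sum raddf_sum /= mulr_sumr.
rewrite -(ltr_int rat) -[0%:~R]/(0 : rat) -(pmulr_rgt0 (x := 2)) //.
apply: (@lt_le_trans _ _ (\sum_a (X a ^+ 2 + Y a ^+ 2) * D a)).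
  rewrite (bigD1 c) //=; apply: ltr_pwDl.
    apply: mulr_gt0 => //; have [xc|xc] := eqVneq (x c) 0.
      rewrite xc eqxx /= in c0; apply: ltr_wpDl; first exact: sqr_ge0.
      by rewrite exprn_even_gt0 //= intr_eq0.
    apply: ltr_pwDl; last exact: sqr_ge0.
    by rewrite exprn_even_gt0 //= intr_eq0.
  apply: sumr_ge0 => a _; apply: mulr_ge0; last exact: ltW.
  by apply: addr_ge0; exact: sqr_ge0.
rewrite titsE -subr_ge0.
have -> : \sum_a (X a ^+ 2 + Y a ^+ 2) * D a = 2 * (\sum_a X a ^+ 2 + \sum_a Y a ^+ 2) -
    (\sum_a \sum_(b | adj a b) (X a ^+ 2 * (W b / W a) + Y b ^+ 2 * (W a / W b))).
  have -> : \sum_a \sum_(b | adj a b) (X a ^+ 2 * (W b / W a) + Y b ^+ 2 * (W a / W b))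
     = \sum_a \sum_(b | adj a b) (X a ^+ 2 + Y a ^+ 2) * (W b / W a).
    under eq_bigr => a _ do rewrite big_split.
    rewrite big_split /= [X in _ + X](exchange_big_dep xpredT) //= -big_split.
    apply: eq_bigr => a _ /=; under [X in _ + X]eq_bigl => b do rewrite adj_sym.
    by rewrite -big_split; apply: eq_bigr => b _; rewrite mulrDl.
  rewrite -big_split mulr_sumr -sumrB; apply: eq_bigr => a _ /=.
  rewrite -mulr_sumr /D mulrBr mulrC; congr (_ - _ * _).
  by rewrite /nbr_sum raddf_sum /= mulr_suml.
set S := \sum_a X a ^+ 2; set S' := \sum_a Y a ^+ 2.
set T := \sum_a \sum_(b | adj a b) X a * Y b; set T' := (X in _ - (_ - X)).
suff : 2 * T <= T' by lra.
rewrite mulr_sumr; apply: ler_sum => a _; rewrite mulr_sumr; apply: ler_sum => b _; exact: amgm.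
Qed.

(** Split x = x+ - x- and y = y+ - y-: the mixed terms only increase the form,
    so its values at (x+, y+) and (x-, y-), which are positive integers unless
    the vectors vanish, have sum at most 1. *)
Lemma tits_same_sign x y : tits x y = 1 ->
  (forall a, 0 <= x a /\ 0 <= y a) \/ (forall a, x a <= 0 /\ y a <= 0).
Proof.
move=> E1; have [p [n pnP]] : exists p n : int -> int, forall u,
    [/\ 0 <= p u, 0 <= n u, u = p u - n u & p u * n u = 0].
  exists (fun u => if 0 <= u then u else 0), (fun u => if 0 <= u then 0 else - u) => u.
  by case: (lerP 0 u) => h; split; lia.
have p0 u : 0 <= p u by case: (pnP u).
have n0 u : 0 <= n u by case: (pnP u).
have pn u : u = p u - n u by case: (pnP u).
have pn0 u : p u * n u = 0 by case: (pnP u).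
clear pnP.
pose P := tits (p \o x) (p \o y); pose N := tits (n \o x) (n \o y).
have le1 : P + N <= 1.
  rewrite -E1 /P /N /tits addrACA; apply: lerD; rewrite -big_split; apply: ler_sum => a _ /=.
    by have := pn (x a); have := pn0 (x a); move=> h1 {3}->; nia.
  have nbrE : nbr_sum x a = nbr_sum (p \o x) a - nbr_sum (n \o x) a.
    by rewrite /nbr_sum -sumrB; apply: eq_bigr => b _; exact: pn.
  have := pn0 (y a); have := pn (y a); rewrite nbrE.
  have : 0 <= nbr_sum (p \o x) a by apply: sumr_ge0 => b _; exact: p0.
  have : 0 <= nbr_sum (n \o x) a by apply: sumr_ge0 => b _; exact: n0.
  have := p0 (y a); have := n0 (y a).
  move: (y a) (nbr_sum (p \o x) a) (nbr_sum (n \o x) a) (p (y a)) (n (y a)).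
  move=> ya P' N' py ny h1 h2 h3 h4 -> h5.
  by have := mulr_ge0 h1 h4; have := mulr_ge0 h2 h3; nia.
have zP (f : int -> int) : (exists a, (f (x a) != 0) || (f (y a) != 0)) \/
   (forall a, f (x a) = 0 /\ f (y a) = 0).
  case: (pselect (exists a, (f (x a) != 0) || (f (y a) != 0))) => [|h]; first by left.
  right=> a; apply: contrapT => h'; apply: h; exists a.
  by case: eqVneq => //= xa; case: eqVneq => //= ya; case: h'.
case: (zP p) => [/tits_gt0 Pp|h]; last first.
  by right=> a; rewrite (pn (x a)) (pn (y a)) !(proj1 (h a), proj2 (h a)) !sub0r !oppr_le0.
case: (zP n) => [/tits_gt0 Np|h]; last first.
  by left=> a; rewrite (pn (x a)) (pn (y a)) !(proj1 (h a), proj2 (h a)) !subr0.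
have : 0 < P by exact: Pp.
have : 0 < N by exact: Np.
by move: le1; lia.
Qed.

Definition natz_vec (u : Gamma -> nat) : Gamma -> int := fun a => (u a)%:Z.

(** If some entry of A x - y is negative, the reflection at that single sink
    produces a vector with a negative entry and the same value of the form;
    by [tits_same_sign] the other entries vanish. *)
Lemma tits_step (x y : Gamma -> nat) : tits (natz_vec x) (natz_vec y) = 1 ->
  (exists b, x =1 (fun=> 0%N) /\ y =1 (fun a => (a == b) : nat)) \/
  (exists k : Gamma -> nat, forall b, (k b + y b = \sum_(a | adj a b) x a)%N).
Proof.
move=> E1; have nbrE b : nbr_sum (natz_vec x) b = (\sum_(a | adj a b) x a)%N%:Z.
  by rewrite (big_morph Posz PoszD (erefl _)); apply: eq_bigl => a; rewrite adj_sym.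
case: (pselect (exists b, \sum_(a | adj a b) x a < y b)%N) => [[b lt_b]|h]; last first.
  right; exists (fun b => \sum_(a | adj a b) x a - y b)%N => b; rewrite subnK //.
  by rewrite leqNgt; apply/negP => lt; apply: h; exists b.
left; exists b; pose y' c := if c == b then nbr_sum (natz_vec x) b - natz_vec y b else natz_vec y c.
have : tits (natz_vec x) y' = 1.
  rewrite -E1; apply: tits_reflect => c; rewrite /y'.
  by case: eqP => [->|]; [right | left].
have y'b : y' b < 0 by rewrite /y' eqxx nbrE /natz_vec; lia.
case/tits_same_sign => [/(_ b)[_]|neg]; first by move: y'b; lia.
have x0 : x =1 fun=> 0%N by move=> a; have := neg a; rewrite /natz_vec; lia.
have y0 c : c != b -> y c = 0%N.
  by move=> cb; have := neg c; rewrite /y' (negbTE cb) /natz_vec; lia.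
split=> // c; case: eqVneq => [->|/y0 //].
move: E1; rewrite /tits big1 ?add0r => [|a _]; last by rewrite /natz_vec x0.
rewrite (bigD1 b) //= big1 => [|a /y0]; last by rewrite /natz_vec => ->; rewrite mul0r.
rewrite nbrE big1 // /natz_vec; nia.
Qed.

(** Induction along the reflection (x, y) |-> (A x - y, x). It lowers
    <w, x> - <w, y>, by the inequality satisfied by the weight, and once this
    difference is negative it lowers <w, y> as well; so it cannot stay among
    nonnegative vectors forever. *)
Lemma pair_ind (P : (Gamma -> nat) -> (Gamma -> nat) -> Prop) :
  (forall x y : Gamma -> nat, (exists a, (0 < x a + y a)%N) ->
     (forall k : Gamma -> nat, (forall b, (k b + y b = \sum_(a | adj a b) x a)%N) -> P k x) ->
     P x y) ->
  forall x y : Gamma -> nat, (exists a, (0 < x a + y a)%N) -> P x y.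
Proof.
move=> IH; pose h (x : Gamma -> nat) : int := \sum_a w a * natz_vec x a.
have h0 (x : Gamma -> nat) : 0 <= h x by apply: sumr_ge0 => a _; rewrite mulr_ge0 // ltW.
have step (x y k : Gamma -> nat) : (exists a, (0 < x a + y a)%N) ->
    (forall b, (k b + y b = \sum_(a | adj a b) x a)%N) ->
    (exists a, (0 < k a + x a)%N) /\ h k - h x < h x - h y.
  move=> [a a0] kE; have [c c0] : exists c, (0 < x c)%N.
    apply: contrapT => hx; have x0 c : x c = 0%N.
      by apply/eqP; rewrite -leqn0 leqNgt; apply/negP => ?; apply: hx; exists c.
    by have := kE a; rewrite big1 // => ka; move: a0; rewrite x0; lia.
  split; first by exists c; lia.
  have -> : h k = \sum_a natz_vec x a * nbr_sum w a - h y.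
    apply/eqP; rewrite eq_sym subr_eq -nbr_sum_pairing -big_split; apply/eqP.
    apply: eq_bigr => b _ /=; rewrite -mulrDr /natz_vec -PoszD kE; congr (_ * _).
    by rewrite (big_morph Posz PoszD (erefl _)); apply: eq_bigl => ?; rewrite adj_sym.
  suff : \sum_a natz_vec x a * nbr_sum w a < h x + h x by lia.
  rewrite -big_split (bigD1 c) // [ltRHS](bigD1 c) //=.
  apply: ltr_leD; first by have := w_nbr c; rewrite /natz_vec; nia.
  by apply: ler_sum => b _; have := w_nbr b; rewrite /natz_vec; nia.
have neg n : forall x y : Gamma -> nat, h y < n%:Z -> h x - h y < 0 ->
    (exists a, (0 < x a + y a)%N) -> P x y.
  elim: n => [|n IHn] x y hy d0 nz; first by have := h0 y; lia.
  apply: IH => // k kE; have [nz' lt] := step _ _ _ nz kE.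
  by apply: IHn => //; lia.
have all n : forall x y : Gamma -> nat, h x - h y < n%:Z -> (exists a, (0 < x a + y a)%N) -> P x y.
  elim: n => [|n IHn] x y hy nz; first by apply: (neg `|h y|.+1%N) => //; have := h0 y; lia.
  apply: IH => // k kE; have [nz' lt] := step _ _ _ nz kE.
  by apply: IHn => //; lia.
by move=> x y; apply: (all `|h x - h y|.+1%N); lia.
Qed.

End TitsForm.

(** * Roots as vectors of length one *)

Section Roots.
Import Num.Theory.
Variables (Gamma : sgraph) (w : Gamma -> int) (eps : Gamma -> bool).
Hypotheses (w_gt0 : forall a, 0 < w a) (w_nbr : forall a, nbr_sum w a < 2 * w a).
Hypothesis eps_adj : forall a b : Gamma, adj a b -> eps a != eps b.
Implicit Types (z : root_lattice Gamma).

Definition color_part (c : bool) (z : Gamma -> int) : Gamma -> int :=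
  fun a => if eps a == c then z a else 0.

(** The Tits form of the graph. With one colour class as sources and the other
    one as sinks, a vector on the graph is a vector on one of the two
    components of the double cover. *)
Definition root_form (z : Gamma -> int) := tits (color_part true z) (color_part false z).

Lemma nbr_color_part c z b : eps b != c -> nbr_sum (color_part c z) b = nbr_sum z b.
Proof.
move=> bc; apply: eq_bigr => a /eps_adj ba; rewrite /color_part.
by move: bc ba; case: (eps a) (eps b) c => [] [] [].
Qed.

Lemma root_formN z : root_form (- z) = root_form z.
Proof.
rewrite /root_form -[RHS]titsN; apply: eq_tits => a; rewrite /color_part ffunE;
  by case: ifP; rewrite ?oppr0.
Qed.

(** For either choice of the sources, the sum of the squares on the source
    class and of z (z - s) on the sink class is the form; adding the two
    choices gives the sum on the left. *)
Lemma root_formE z : \sum_a z a * coroot_pairing z a = 2 * root_form z.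
Proof.
have E c : tits (color_part c z) (color_part (~~ c) z) =
    \sum_a (if eps a == c then z a ^+ 2 else z a * (z a - nbr_sum z a)).
  rewrite /tits -big_split; apply: eq_bigr => a _ /=.
  have [ac|ac] := eqVneq (eps a) c; last first.
    rewrite nbr_color_part // /color_part (negbTE ac) expr0n add0r.
    by rewrite (_ : (eps a == ~~ c) = true) //; case: (eps a) c ac => [] [].
  by rewrite /color_part ac eqxx; case: (c); rewrite /= mul0r addr0.
have -> : 2 * root_form z = root_form z + tits (color_part false z) (color_part true z).
  by rewrite [X in _ + X]titsC -/(root_form z); lia.
rewrite /root_form (E true) (E false) -big_split; apply: eq_bigr => a _ /=.
by rewrite /coroot_pairing -/(nbr_sum z a); case: (eps a) => /=; lia.
Qed.

Lemma simple_root_form a : root_form (simple_root a) = 1.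
Proof.
have : 2 * root_form (simple_root a) = 2; last by lia.
rewrite -root_formE (bigD1 a) //= big1 => [|b /negbTE ba]; last by rewrite ffunE ba mul0r.
rewrite ffunE eqxx mul1r addr0 /coroot_pairing ffunE eqxx big1 => [|b ab]; first by [].
by rewrite ffunE; case: eqP => // ba; move: ab; rewrite ba adj_irr.
Qed.

Lemma reflectionE a z b :
  reflection a z b = if b == a then nbr_sum z a - z a else z b.
Proof.
rewrite /reflection !ffunE ffunMzE ffunE mulrzz.
by case: eqVneq => [->|_]; rewrite /coroot_pairing -/(nbr_sum z a) ?mul0r ?subr0 // mul1r; ring.
Qed.

Lemma root_form_reflection a z : root_form (reflection a z) = root_form z.
Proof.
have E c : eps a = ~~ c -> tits (color_part c (reflection a z)) (color_part (~~ c) (reflection a z))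
    = tits (color_part c z) (color_part (~~ c) z).
  move=> ac; rewrite (_ : color_part c (reflection a z) = color_part c z); last first.
    apply/funext => b; rewrite /color_part; case: eqP => // bc; rewrite reflectionE.
    by case: eqP => // ba; move: ac; rewrite -ba bc; case: (c).
  apply: tits_reflect => b; rewrite /color_part; case: eqP => bc; last by left.
  rewrite reflectionE; case: eqP => [->|]; last by left.
  by right; rewrite nbr_color_part // ac; case: (c).
rewrite /root_form; case ac: (eps a); last by apply: (E true); rewrite ac.
by rewrite titsC [RHS]titsC; apply: (E false); rewrite ac.
Qed.

Lemma is_root_form z : is_root z -> root_form z = 1.
Proof.
by elim=> [a|a x _ IH]; [exact: simple_root_form | rewrite root_form_reflection].
Qed.

Lemma is_rootN z : is_root z -> is_root (- z).
Proof.
elim=> [a|a x _ IH].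
  have -> : - simple_root a = reflection a (simple_root a).
    apply/ffunP => b; rewrite reflectionE !ffunE /nbr_sum big1 ?sub0r.
      by rewrite eqxx; case: eqP.
    by move=> c ac; rewrite ffunE; case: eqP => // ca; move: ac; rewrite ca adj_irr.
  by apply: is_root_reflection; exact: is_root_simple.
have -> : - reflection a x = reflection a (- x).
  apply/ffunP => b; rewrite reflectionE [LHS]ffunE reflectionE.
  case: eqP => _; last by rewrite ffunE.
  rewrite /nbr_sum ffunE [in RHS](eq_bigr (fun c => - x c)) => [|c _]; last exact: ffunE.
  by rewrite sumrN; ring.
exact: is_root_reflection.
Qed.

Lemma reflectionK a : involutive (reflection (Gamma := Gamma) a).
Proof.
move=> z; apply/ffunP => b; rewrite !reflectionE eqxx; case: eqP => [->|] //.
suff -> : nbr_sum (reflection a z) a = nbr_sum z a by lia.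
apply: eq_bigr => c ac; rewrite reflectionE; case: eqP => // ca.
by move: ac; rewrite ca adj_irr.
Qed.

Lemma root_sign z : root_form z = 1 -> (forall a, 0 <= z a) \/ (forall a, z a <= 0).
Proof.
move=> /(tits_same_sign w_gt0 w_nbr)[] h; [left | right] => a;
  by have := h a; rewrite /color_part; case: (eps a) => /= -[].
Qed.

(** Descent on the height: as the sum of [z a * coroot_pairing z a] is 2, some
    term is positive, and the corresponding reflection lowers the height
    unless it makes the vector negative, in which case the vector is a simple
    root. *)
Lemma form_is_root z : root_form z = 1 -> is_root z.
Proof.
have pos n : forall z, (forall a, 0 <= z a) -> \sum_a z a < n%:Z -> root_form z = 1 -> is_root z.
  elim: n => [|n IHn] {}z z0 zn z1.
    have S0 : 0 <= \sum_a z a by apply: sumr_ge0 => a _; exact: z0.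
    by move: S0 zn; lia.
  have [a za pa] : exists2 a, 0 < z a & 0 < coroot_pairing z a.
    apply: contrapT => h; have : \sum_a z a * coroot_pairing z a <= 0.
      apply: sumr_le0 => a _; have [za|za] := ltrP 0 (z a).
        by have [pa|pa] := ltrP 0 (coroot_pairing z a); [case: h; exists a | rewrite mulr_ge0_le0 // ltW].
      by rewrite (_ : z a = 0) ?mul0r //; apply/eqP; rewrite eq_le za z0.
    by rewrite root_formE z1.
  have r1 : root_form (reflection a z) = 1 by rewrite root_form_reflection.
  have ra : reflection a z a = z a - coroot_pairing z a.
    by rewrite reflectionE eqxx /coroot_pairing -/(nbr_sum z a); lia.
  have rb b : b != a -> reflection a z b = z b by rewrite reflectionE => /negbTE ->.
  have [rp|rn] := root_sign r1.
    rewrite -[z](reflectionK a); apply: is_root_reflection; apply: IHn => //.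
    suff : \sum_b reflection a z b < \sum_b z b by lia.
    rewrite (bigD1 a) // [ltRHS](bigD1 a) //= ra; apply: ltr_leD; first by lia.
    by apply: ler_sum => b ba; rewrite rb.
  have zb b : b != a -> z b = 0 by move=> ba; have := z0 b; have := rn b; rewrite rb //; lia.
  suff -> : z = simple_root a by exact: is_root_simple.
  have : \sum_a z a * coroot_pairing z a = 2 by rewrite root_formE z1.
  rewrite (bigD1 a) //= big1 => [|b /zb ->]; last by rewrite mul0r.
  rewrite /coroot_pairing big1 => [|b ab]; last first.
    by apply: zb; apply: contraTneq ab => ->; rewrite adj_irr.
  move=> h; apply/ffunP => b; rewrite ffunE; have [->|/zb //] := eqVneq b a.
  by nia.
have {}pos z' : (forall a, 0 <= z' a) -> root_form z' = 1 -> is_root z'.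
  by move=> z0; pose s := \sum_a z' a; apply: (pos (absz s).+1) => //; lia.
move=> z1; have [zp|zn] := root_sign z1; first exact: pos.
rewrite -[z]opprK; apply/is_rootN/pos; last by rewrite root_formN.
by move=> a; rewrite ffunE oppr_ge0.
Qed.

End Roots.

(** * Bipartite representations and the reflection *)

Section BipartiteReps.
Variables (F : fieldType) (Gamma : sgraph).
Implicit Types (x y k : Gamma -> nat) (a b : Gamma).

(** Two families of vector spaces indexed by the vertices, with an arrow from
    the first space at [a] to the second space at [b] for each edge [a - b]:
    the representations of the bipartite double cover of the graph, with its
    source-sink orientation. *)
Record brep := BRep {
  dtop : Gamma -> nat;
  drad : Gamma -> nat;
  barr : forall a b, 'M[F]_(dtop a, drad b)
}.
Implicit Types U V W : brep.

Definition bhom V W (f : forall a, 'M[F]_(dtop V a, dtop W a))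
    (g : forall b, 'M[F]_(drad V b, drad W b)) : Prop :=
  forall a b, adj a b -> barr V a b *m g b = f a *m barr W a b.

Definition biso V W : Prop :=
  exists f g f' g', [/\ @bhom V W f g, @bhom W V f' g',
    forall a, f a *m f' a = 1%:M /\ f' a *m f a = 1%:M &
    forall b, g b *m g' b = 1%:M /\ g' b *m g b = 1%:M].

(** Indecomposability in terms of idempotent endomorphisms, a form which
    passes directly through bijections of endomorphism rings. *)
Definition bindec V : Prop :=
  (exists a, (0 < dtop V a + drad V a)%N) /\
  forall f g, @bhom V V f g ->
    (forall a, f a *m f a = f a) -> (forall b, g b *m g b = g b) ->
    (forall a, f a = 0) /\ (forall b, g b = 0) \/
    (forall a, f a = 1%:M) /\ (forall b, g b = 1%:M).

Definition bsurj V : Prop := forall b m (u : 'M_(drad V b, m)),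
  (forall a, adj a b -> barr V a b *m u = 0) -> u = 0.

Definition binj V : Prop := forall a m (u : 'M_(m, dtop V a)),
  (forall b, adj a b -> u *m barr V a b = 0) -> u = 0.

Lemma row_col_eq1 n (u : 'cV[F]_n) (v : 'rV_n) : u *m v = 1%:M -> v *m u = 1%:M -> n = 1%N.
Proof.
move=> /(congr1 (@mxrank _ _ _)); rewrite mxrank1 => uv vu.
apply/eqP; rewrite eqn_leq -{1}uv (leq_trans (mxrankM_maxl _ _) (rank_leq_col _)) /=.
have := mxrankM_maxl v u; rewrite vu mxrank1 => h; exact: leq_trans h (rank_leq_col _).
Qed.

Lemma mx1_eq0_dim n : (1%:M : 'M[F]_n) = 0 -> n = 0%N.
Proof. by move=> /(congr1 (@mxrank _ _ _)); rewrite mxrank1 mxrank0. Qed.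

Lemma nonzero_mx_pairing n m (u : 'M[F]_(n, m)) :
  u != 0 -> exists (c : 'cV_m) (r : 'rV_n), r *m (u *m c) = 1%:M.
Proof.
move=> /matrix0Pn[i [j uij]]; exists (delta_mx j 0), ((u i j)^-1 *: delta_mx 0 i).
apply/matrixP => s t; rewrite !ord1 -scalemxAl -colE -rowE !mxE.
by rewrite mulVf.
Qed.

(** A linear form on the second space at [b] that vanishes on the images of all
    arrows splits off a simple summand. *)
Lemma bindec_surj V : bindec V -> bsurj V \/
  exists b, dtop V =1 (fun=> 0%N) /\ drad V =1 (fun a => (a == b) : nat).
Proof.
case: V => x y phi [nz idem]; case: (pselect (bsurj (BRep phi))) => [|ns]; first by left.
right; have [b [m [u [u0 nu]]]] : exists b m (u : 'M_(y b, m)),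
    (forall a, adj a b -> phi a b *m u = 0) /\ u != 0.
  apply: contrapT => h; apply: ns => b m u u0; apply/eqP/negPn/negP => nu.
  by apply: h; exists b, m, u.
have [c [r rc]] := nonzero_mx_pairing nu; set u1 := u *m c in rc.
have {}u0 a : adj a b -> phi a b *m u1 = 0 by move=> ab; rewrite mulmxA u0 ?mul0mx.
clearbody u1.
pose g := @dfwith _ (fun d => 'M[F]_(y d)) (fun=> 0) b (u1 *m r).
have gP d : d != b -> g d = 0 by move=> db; rewrite /g dfwith_out // eq_sym.
have gb : g b = u1 *m r by rewrite /g dfwith_in.
have u1r : u1 *m r != 0.
  apply/eqP => ur0; have : r *m (u1 *m r) *m u1 = 0 by rewrite ur0 mulmx0 mul0mx.
  by rewrite !mulmxA rc mul1mx rc => /eqP; rewrite oner_eq0.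
have [] := idem (fun a => 0) g.
- move=> a d; rewrite mul0mx /=; have [-> ab|/gP -> _] := eqVneq d b; last by rewrite mulmx0.
  by rewrite gb mulmxA u0 // mul0mx.
- by move=> a; rewrite mulmx0.
- move=> d; have [->|/gP ->] := eqVneq d b; last by rewrite mulmx0.
  by rewrite gb mulmxA -(mulmxA u1) rc mulmx1.
- by case=> _ /(_ b) gb0; move: u1r; rewrite -gb gb0 eqxx.
case=> x1 g1; exists b; split=> [a|d /=]; first exact: mx1_eq0_dim (esym (x1 a)).
have [->|db] := eqVneq d b; last by apply: (@mx1_eq0_dim); rewrite -g1 gP.
by apply: (row_col_eq1 (u := u1) (v := r)) => //; rewrite -gb g1.
Qed.

(** The dual representation, over the same graph with sources and sinks
    exchanged. *)
Definition btr V : brep := @BRep (drad V) (dtop V) (fun b a => (barr V a b)^T).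

Lemma btr_bindec V : bindec V -> bindec (btr V).
Proof.
case: V => x y phi [[a a0] idem]; split; first by exists a; rewrite addnC.
move=> f g /= fg ff gg; have := idem (fun a => (g a)^T) (fun b => (f b)^T).
case.
- move=> c d cd /=; apply: trmx_inj; rewrite !trmx_mul !trmxK.
  by apply/esym/(fg d c); rewrite adj_sym.
- by move=> c; rewrite -trmx_mul gg.
- by move=> c; rewrite -trmx_mul ff.
- by case=> g0 f0; left; split=> c; apply: trmx_inj; rewrite trmx0.
- by case=> g0 f0; right; split=> c; apply: trmx_inj; rewrite trmx1.
Qed.

Lemma bindec_inj V : bindec V -> binj V \/
  exists a, drad V =1 (fun=> 0%N) /\ dtop V =1 (fun b => (b == a) : nat).
Proof.
move=> /btr_bindec /bindec_surj [surj|]; [left | by right].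
move=> a m u u0; apply: trmx_inj; rewrite trmx0; apply: surj => b ab /=.
by rewrite -trmx_mul u0 ?trmx0 // adj_sym.
Qed.

(** All sinks are reflected at once: [phi] gives a representation (X, Y) and
    [psi] a representation (K, X), where K_b is the kernel of
    (+)_(a - b) X_a -> Y_b and, symmetrically, Y_b is the cokernel of
    K_b -> (+)_(a - b) X_a. *)
Definition reflected (x y k : Gamma -> nat) (phi : forall a b, 'M[F]_(x a, y b))
    (psi : forall b a, 'M[F]_(k b, x a)) : Prop :=
  forall b, short_exact (fun a => adj a b) (psi b) (fun a => phi a b).

(** The common component X determines the rest of a homomorphism, on either
    side, by the universal properties of kernels and cokernels. Hence the
    reflection identifies homomorphisms, and with them idempotents and
    isomorphisms. *)

Section ReflectionHom.
Variables (x1 y1 k1 x2 y2 k2 : Gamma -> nat).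
Variables (phi1 : forall a b, 'M[F]_(x1 a, y1 b)) (psi1 : forall b a, 'M[F]_(k1 b, x1 a)).
Variables (phi2 : forall a b, 'M[F]_(x2 a, y2 b)) (psi2 : forall b a, 'M[F]_(k2 b, x2 a)).
Hypotheses (refl1 : reflected phi1 psi1) (refl2 : reflected phi2 psi2).
Let V1 := BRep phi1. Let V1' := BRep psi1. Let V2 := BRep phi2. Let V2' := BRep psi2.

Lemma reflected_hom f g : @bhom V1 V2 f g -> exists h, @bhom V1' V2' h f.
Proof.
move=> fg; have H b : exists h : 'M_(k1 b, k2 b),
    forall a, adj a b -> psi1 b a *m f a = h *m psi2 b a.
  apply: (se_ker (refl2 b) (v := fun a => psi1 b a *m f a)).
  under eq_bigr => a ab do rewrite -mulmxA -(fg a b ab) /= mulmxA.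
  by rewrite -mulmx_suml (se_comp (refl1 b)) mul0mx.
exists (fun b => sval (cid (H b))) => b a ba.
by case: (cid _) => h /= ->; rewrite // adj_sym.
Qed.

Lemma coreflected_hom h f : @bhom V1' V2' h f -> exists g, @bhom V1 V2 f g.
Proof.
move=> hf; have H b : exists g : 'M_(y1 b, y2 b),
    forall a, adj a b -> f a *m phi2 a b = phi1 a b *m g.
  apply: (se_coker (refl1 b) (v := fun a => f a *m phi2 a b)).
  under eq_bigr => a ab do rewrite mulmxA [_ *m f a](hf b a) 1?adj_sym //= -mulmxA.
  by rewrite -mulmx_sumr (se_comp (refl2 b)) mulmx0.
exists (fun b => sval (cid (H b))) => a b ab.
by case: (cid _) => h' /= ->.
Qed.

Lemma reflected_uniq f h h' : @bhom V1' V2' h f -> @bhom V1' V2' h' f -> forall b, h b = h' b.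
Proof.
move=> hf hf' b; apply/eqP; rewrite -subr_eq0; apply/eqP; apply: (se_inj (refl2 b)) => a ab.
by rewrite mulmxBl; apply/eqP; rewrite subr_eq0 -[_ *m _]hf -1?[_ *m psi2 b a]hf' 1?adj_sym.
Qed.

Lemma coreflected_uniq f g g' : @bhom V1 V2 f g -> @bhom V1 V2 f g' -> forall b, g b = g' b.
Proof.
move=> fg fg' b; apply/eqP; rewrite -subr_eq0; apply/eqP; apply: (se_surj (refl1 b)) => a ab.
by rewrite mulmxBr; apply/eqP; rewrite subr_eq0 [_ *m g b]fg // [_ *m g' b]fg'.
Qed.

End ReflectionHom.

Lemma bhom_comp U V W f1 g1 f2 g2 : @bhom U V f1 g1 -> @bhom V W f2 g2 ->
  @bhom U W (fun a => f1 a *m f2 a) (fun b => g1 b *m g2 b).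
Proof. by move=> h1 h2 a b ab; rewrite mulmxA h1 // -!mulmxA h2. Qed.

Lemma bhom_id V : @bhom V V (fun=> 1%:M) (fun=> 1%:M).
Proof. by move=> a b _; rewrite mulmx1 mul1mx. Qed.

Lemma bhom_0 V W : @bhom V W (fun=> 0) (fun=> 0).
Proof. by move=> a b _; rewrite mulmx0 mul0mx. Qed.

Lemma eq_bhom V W f f' g g' : (forall a, f a = f' a) -> (forall b, g b = g' b) ->
  @bhom V W f g -> @bhom V W f' g'.
Proof. by move=> ff gg h a b ab; rewrite -ff -gg h. Qed.

Section ReflectionIndec.
Variables (x y k : Gamma -> nat).
Variables (phi : forall a b, 'M[F]_(x a, y b)) (psi : forall b a, 'M[F]_(k b, x a)).
Hypothesis refl : reflected phi psi.

Lemma bindec_reflected : bindec (BRep phi) -> bindec (BRep psi).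
Proof.
move=> [[c c0] idem]; split.
  apply: contrapT => h; have z a : (k a + x a = 0)%N.
    by apply/eqP; rewrite -leqn0 leqNgt; apply/negP => ?; apply: h; exists a.
  have := se_dim (refl c); rewrite big1 => [|a _]; last by have := z a; lia.
  by have := z c; move: c0 => /=; lia.
move=> h f hf hh ff; have [g fg] := coreflected_hom refl refl hf.
have gg b : g b *m g b = g b.
  by move: b; apply: (coreflected_uniq refl (f := f)) => //; apply: eq_bhom (bhom_comp fg fg).
case: (idem f g fg ff gg) => -[f01 _]; [left | right]; split=> //.
  apply: (reflected_uniq refl hf); apply: eq_bhom (@bhom_0 _ _) => // a.
  by rewrite f01.
apply: (reflected_uniq refl hf); apply: eq_bhom (@bhom_id _) => // a.
by rewrite f01.
Qed.

Lemma bindec_coreflected : bindec (BRep psi) -> bindec (BRep phi).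
Proof.
move=> [[c c0] idem]; split.
  apply: contrapT => h; have z a : (x a + y a = 0)%N.
    by apply/eqP; rewrite -leqn0 leqNgt; apply/negP => ?; apply: h; exists a.
  have := se_dim (refl c); rewrite big1 => [|a _]; last by have := z a; lia.
  by have := z c; move: c0 => /=; lia.
move=> f g fg ff gg; have [h hf] := reflected_hom refl refl fg.
have hh b : h b *m h b = h b.
  by move: b; apply: (reflected_uniq refl (f := f)) => //; apply: eq_bhom (bhom_comp hf hf).
case: (idem h f hf hh ff) => -[_ f01]; [left | right]; split=> //.
  apply: (coreflected_uniq refl fg); apply: eq_bhom (@bhom_0 _ _) => // a.
  by rewrite f01.
apply: (coreflected_uniq refl fg); apply: eq_bhom (@bhom_id _) => // a.
by rewrite f01.
Qed.

End ReflectionIndec.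

Lemma biso_coreflected (x1 y1 k1 x2 y2 k2 : Gamma -> nat)
  (phi1 : forall a b, 'M[F]_(x1 a, y1 b)) (psi1 : forall b a, 'M[F]_(k1 b, x1 a))
  (phi2 : forall a b, 'M[F]_(x2 a, y2 b)) (psi2 : forall b a, 'M[F]_(k2 b, x2 a)) :
  reflected phi1 psi1 -> reflected phi2 psi2 ->
  biso (BRep psi1) (BRep psi2) -> biso (BRep phi1) (BRep phi2).
Proof.
move=> refl1 refl2 [h [f [h' [f' [hf hf' _ ff']]]]].
have [g fg] := coreflected_hom refl1 refl2 hf.
have [g' fg'] := coreflected_hom refl2 refl1 hf'.
exists f, g, f', g'; split=> // b; split.
  apply: (coreflected_uniq refl1 (g := fun b => g b *m g' b)
    (g' := fun=> 1%:M) (f := fun=> 1%:M)); last exact: (@bhom_id (BRep phi1)).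
  by apply: eq_bhom (bhom_comp fg fg') => // a; case: (ff' a).
apply: (coreflected_uniq refl2 (g := fun b => g' b *m g b)
  (g' := fun=> 1%:M) (f := fun=> 1%:M)); last exact: (@bhom_id (BRep phi2)).
by apply: eq_bhom (bhom_comp fg' fg) => // a; case: (ff' a).
Qed.

Lemma bsurj_reflected V : bsurj V ->
  exists k (psi : forall b a, 'M[F]_(k b, dtop V a)), reflected (barr V) psi.
Proof.
case: V => x y phi surj.
have H b : {k : nat & {psi : forall a, 'M[F]_(k, x a) |
    short_exact (fun a => adj a b) psi (fun a => phi a b)}}.
  have [k /cid[psi]] := cid (kernel_exists (surj b)).
  by exists k, psi.
exists (fun b => tag (H b)), (fun b => sval (tagged (H b))) => b.
by case: (H b) => k [].
Qed.

Lemma binj_coreflected V : binj V ->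
  exists y (phi : forall a b, 'M[F]_(drad V a, y b)), reflected phi (barr V).
Proof.
case: V => k x psi inj.
have H b : {y : nat & {phi : forall a, 'M[F]_(x a, y) |
    short_exact (fun a => adj a b) (psi b) phi}}.
  have injb m (u : 'M_(m, k b)) : (forall a, adj a b -> u *m psi b a = 0) -> u = 0.
    by move=> u0; apply: inj => a ba; apply: u0; rewrite adj_sym.
  have [y /cid[phi]] := cid (cokernel_exists injb).
  by exists y, phi.
exists (fun b => tag (H b)), (fun a b => sval (tagged (H b)) a) => b.
by case: (H b) => k' [].
Qed.

End BipartiteReps.

(** * Gabriel's theorem for bipartite representations *)

Section Gabriel.
Variables (F : fieldType) (Gamma : sgraph) (w : Gamma -> int).
Hypotheses (w_gt0 : forall a, (0 < w a)%R) (w_nbr : forall a, (nbr_sum w a < 2 * w a)%R).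
Implicit Types (x y k : Gamma -> nat) (a b : Gamma) (V W : brep F Gamma).

Lemma mx_row0_eq m n (A B : 'M[F]_(m, n)) : m = 0%N -> A = B.
Proof. by move=> m0; apply/matrixP => i; have := ltn_ord i; rewrite {2}m0. Qed.

Lemma idempotent_le1 n (A : 'M[F]_n) : (n <= 1)%N -> A *m A = A -> A = 0 \/ A = 1%:M.
Proof.
case: n A => [|[|//]] A _ AA; first by left; exact: mx_row0_eq.
move: AA; rewrite [A]mx11_scalar -scalar_mxM; move: (A 0 0) => s /matrixP/(_ 0 0).
rewrite !mxE eqxx !mulr1n => /eqP; rewrite -subr_eq0 -{3}[s]mulr1 -mulrBr mulf_eq0 subr_eq0.
by case/orP => /eqP ->; [left; rewrite raddf0 | right].
Qed.

Definition bsimple b : brep F Gamma :=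
  @BRep F Gamma (fun=> 0%N) (fun a => (a == b) : nat) (fun _ _ => 0).

Lemma bsimple_indec b : bindec (bsimple b).
Proof.
split=> [|f g _ _ gg]; first by exists b; rewrite /= eqxx.
have f01 a (c : 'M_0) : f a = c by exact: mx_row0_eq.
have g01 c (h : 'M_(c == b)) : c != b -> g c = h.
  by move=> /negbTE cb; apply: mx_row0_eq; rewrite /= cb.
have : g b = 0 \/ g b = 1%:M by apply: idempotent_le1 (gg b); rewrite /= eqxx.
by case=> gb'; [left | right]; split=> c //; have [->|/g01] := eqVneq c b.
Qed.

Lemma bsimple_iso V W : dtop V =1 (fun=> 0%N) -> dtop V =1 dtop W -> drad V =1 drad W ->
  biso V W.
Proof.
move=> V0 tVW rVW; have W0 a : dtop W a = 0%N by rewrite -tVW.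
exists (fun=> 0), (fun b => pid_mx (drad V b)), (fun=> 0), (fun b => pid_mx (drad V b)).
split.
- by move=> a b _; apply: mx_row0_eq.
- by move=> a b _; apply: mx_row0_eq.
- by move=> a; split; apply: mx_row0_eq.
- by move=> b; rewrite !mul_pid_mx minnn -rVW minnn pid_mx_1.
Qed.

Lemma bindec_nz V : bindec V -> exists a, (0 < dtop V a + drad V a)%N.
Proof. by case. Qed.

Lemma tits_reflected x y k : (forall b, (k b + y b = \sum_(a | adj a b) x a)%N) ->
  tits (natz_vec k) (natz_vec x) = tits (natz_vec x) (natz_vec y).
Proof.
move=> kE; rewrite titsC; apply: tits_reflect => b; right.
apply/eqP; rewrite eq_sym subr_eq /natz_vec -PoszD kE (big_morph Posz PoszD (erefl _)).
by apply/eqP/eq_bigl => a; rewrite adj_sym.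
Qed.

(** The reflection preserves the form and, on representations other than the
    simple ones at sinks, indecomposability; so it ends at such a simple
    representation, where the form is 1. *)
Lemma bindec_tits V : bindec V -> tits (natz_vec (dtop V)) (natz_vec (drad V)) = 1.
Proof.
pose P x y := forall phi, bindec (@BRep F _ x y phi) -> tits (natz_vec x) (natz_vec y) = 1.
suff: forall x y, (exists a, (0 < x a + y a)%N) -> P x y.
  by case: V => x y phi h iV; apply: (h _ _ (bindec_nz iV)) iV.
apply: (pair_ind w_gt0 w_nbr) => x y nz IH phi iV.
have [surj|[b [/= x0 y0]]] := bindec_surj iV; last first.
  rewrite /tits big1 ?add0r => [|a _]; last by rewrite /natz_vec x0.
  rewrite (bigD1 b) //= big1 => [|a /negbTE ab]; last by rewrite /natz_vec y0 ab mul0r.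
  by rewrite /nbr_sum big1 /natz_vec ?y0 ?eqxx // => a _; rewrite x0.
have [k [psi refl]] := bsurj_reflected surj; have kE b := se_dim (refl b).
by rewrite -(tits_reflected kE); apply: (IH k kE psi); exact: bindec_reflected refl iV.
Qed.

Lemma bindec_uniq V W : bindec V -> bindec W ->
  dtop V =1 dtop W -> drad V =1 drad W -> biso V W.
Proof.
pose P x y := forall phi1 phi2, bindec (@BRep F _ x y phi1) -> bindec (@BRep F _ x y phi2) ->
  biso (BRep phi1) (BRep phi2).
suff: forall x y, (exists a, (0 < x a + y a)%N) -> P x y.
  case: V W => x y phi1 [x2 y2 phi2] /= h iV iW /funext xE /funext yE.
  by case: _ / xE phi2 iW => phi2; case: _ / yE phi2 => phi2 iW; apply: (h _ _ (bindec_nz iV)).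
apply: (pair_ind w_gt0 w_nbr) => x y nz IH phi1 phi2 i1 i2.
have [s1|[b [/= x0 y0]]] := bindec_surj i1; last exact: bsimple_iso.
have [s2|[b [/= x0 y0]]] := bindec_surj i2; last exact: bsimple_iso.
have [k [psi1 refl1]] := bsurj_reflected s1; have [k2 [psi2 refl2]] := bsurj_reflected s2.
have kE : k2 = k.
  apply/funext => b; apply/eqP; rewrite -(eqn_add2r (y b)); apply/eqP.
  exact: etrans (se_dim (refl2 b)) (esym (se_dim (refl1 b))).
case: _ / (esym kE) psi2 refl2 => psi2 refl2.
apply: (biso_coreflected refl1 refl2); apply: IH => [b||].
- exact: se_dim (refl1 b).
- exact: bindec_reflected refl1 i1.
- exact: bindec_reflected refl2 i2.
Qed.

(** The reflection is run backwards from a simple representation. A cokernel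
    with the expected dimensions is available since an indecomposable
    representation whose maps out of a source have a common kernel is the
    simple one at that source, and its dimensions do not come from a
    nonnegative vector. *)
Lemma bindec_exists x y : tits (natz_vec x) (natz_vec y) = 1 ->
  exists phi, bindec (@BRep F Gamma x y phi).
Proof.
pose P x y := tits (natz_vec x) (natz_vec y) = 1 -> exists phi, bindec (@BRep F Gamma x y phi).
have nz : tits (natz_vec x) (natz_vec y) = 1 -> exists a, (0 < x a + y a)%N.
  move=> E1; apply: contrapT => h; have xy0 a : (x a + y a = 0)%N.
    by apply/eqP; rewrite -leqn0 leqNgt; apply/negP => ?; apply: h; exists a.
  move: E1; rewrite (@eq_tits _ _ (fun=> 0) _ (fun=> 0)) ?tits0 // => a;
    by have := xy0 a; rewrite /natz_vec; lia.
suff: forall x y, (exists a, (0 < x a + y a)%N) -> P x y by move=> h E1; apply: h (nz E1) E1.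
apply: (pair_ind w_gt0 w_nbr) => {nz}x {}y nz IH E1.
have [[b [/funext xE /funext yE]]|[k kE]] := tits_step w_gt0 w_nbr E1.
  by rewrite xE yE; exists (barr (bsimple b)); exact: bsimple_indec.
have [psi ipsi] := IH k kE (etrans (tits_reflected kE) E1).
have [inj|[a [/= x0 k1]]] := bindec_inj ipsi; last first.
  by have := kE a; rewrite big1 // k1 eqxx.
have [y' [phi refl]] := binj_coreflected inj.
have yE : y' = y.
  apply/funext => b; apply/eqP; rewrite -(eqn_add2l (k b)); apply/eqP.
  exact: etrans (se_dim (refl b)) (esym (kE b)).
case: _ / yE phi refl => phi refl.
by exists phi; exact: bindec_coreflected refl ipsi.
Qed.

End Gabriel.

(** * Finite dimensional modules as matrix representations *)

Section MatrixReps.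
Variables (F : fieldType) (A : algType F).

Record mrep := MRep {
  mdim : nat;
  mact : A -> 'M[F]_mdim;
  mact_linear : linear mact;
  mact1 : mact 1 = 1%:M;
  mactM : forall u v, mact (u * v) = mact u *m mact v
}.
Implicit Types r s : mrep.

(** Matrices act on columns in [mrep_mod], so these are the homomorphisms from
    the module of [s] to the module of [r]; for isomorphisms and idempotent
    endomorphisms the direction is immaterial. *)
Definition mhom r s (f : 'M[F]_(mdim r, mdim s)) : Prop :=
  forall u, mact r u *m f = f *m mact s u.

Definition miso r s : Prop := exists f g, [/\ @mhom r s f, @mhom s r g,
  f *m g = 1%:M & g *m f = 1%:M].

Definition mindec r : Prop := (0 < mdim r)%N /\
  forall f, @mhom r r f -> f *m f = f -> f = 0 \/ f = 1%:M.

Lemma mactD r u v : mact r (u + v) = mact r u + mact r v.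
Proof. by have := mact_linear r 1 u v; rewrite !scale1r. Qed.

Lemma mact0 r : mact r 0 = 0.
Proof. by apply: (addrI (mact r 0)); rewrite -mactD !addr0. Qed.

Lemma mactZ r c u : mact r (c *: u) = c *: mact r u.
Proof. by have := mact_linear r c u 0; rewrite mact0 !addr0. Qed.

Lemma mact_sum r (I : finType) (P : pred I) (G : I -> A) :
  mact r (\sum_(i | P i) G i) = \sum_(i | P i) mact r (G i).
Proof. exact: (big_morph _ (mactD r) (mact0 r)). Qed.

Lemma miso_sym r s : miso r s -> miso s r.
Proof. by case=> f [g [? ? ? ?]]; exists g, f. Qed.

Definition mrep_mod r := 'cV[F]_(mdim r).
HB.instance Definition _ (r : mrep) := GRing.Zmodule.on (mrep_mod r).

Section ModInstance.
Variable r : mrep.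
Definition mrep_scale (u : A) (v : mrep_mod r) : mrep_mod r := mact r u *m v.

Lemma mrep_scaleA u v x : mrep_scale u (mrep_scale v x) = mrep_scale (u * v) x.
Proof. by rewrite /mrep_scale mulmxA mactM. Qed.
Lemma mrep_scale1 : left_id 1 mrep_scale.
Proof. by move=> x; rewrite /mrep_scale mact1 mul1mx. Qed.
Lemma mrep_scaleDr : right_distributive mrep_scale +%R.
Proof. by move=> u x y; rewrite /mrep_scale mulmxDr. Qed.
Lemma mrep_scaleDl x : {morph mrep_scale^~ x : u v / u + v}.
Proof. by move=> u v; rewrite /mrep_scale mactD mulmxDl. Qed.

HB.instance Definition _ := GRing.Zmodule_isLmodule.Build A (mrep_mod r)
  mrep_scaleA mrep_scale1 mrep_scaleDr mrep_scaleDl.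

Lemma mrep_scaleE u (v : mrep_mod r) : u *: v = mact r u *m v.
Proof. by []. Qed.

Lemma mrep_scale_alg c (v : mrep_mod r) : c%:A *: v = c *: (v : 'cV_(mdim r)).
Proof. by rewrite mrep_scaleE mactZ mact1 -scalemxAl mul1mx. Qed.

End ModInstance.

Section ModIso.
Implicit Types U V W : lmodType A.

Lemma rep_isoP U V (f : U -> V) (g : V -> U) :
  linear f -> cancel f g -> cancel g f -> rep_iso U V.
Proof.
move=> fl fg gf.
by exists (HB.pack f (GRing.isLinear.Build A U V *:%R f fl) : {linear U -> V}); exists g.
Qed.

Lemma rep_isoE U V : rep_iso U V -> exists (f : U -> V) (g : V -> U),
  [/\ linear f, linear g, cancel f g & cancel g f].
Proof.
case=> f [g fg gf]; exists f, g; split=> //; first exact: linearP.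
by move=> c x y; apply: (can_inj fg); rewrite linearP !gf.
Qed.

Lemma rep_iso_trans U V W : rep_iso U V -> rep_iso V W -> rep_iso U W.
Proof.
case/rep_isoE=> f [g [fl gl fg gf]] /rep_isoE[f' [g' [fl' gl' fg' gf']]].
apply: (@rep_isoP U W (f' \o f) (g \o g')).
- by move=> c x y; rewrite /= fl fl'.
- by move=> x /=; rewrite fg' fg.
- by move=> x /=; rewrite gf gf'.
Qed.

Lemma indecomposable_iso U V : rep_iso U V -> indecomposable U -> indecomposable V.
Proof.
move=> UV [nz idem]; split=> [z|X Y VXY]; last by apply: idem; exact: rep_iso_trans VXY.
apply: nz => u; have [f [g [fl gl fg gf]]] := rep_isoE UV.
by rewrite -[u]fg (z (f u)) -(z (f 0)) fg.
Qed.

End ModIso.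

Lemma mulmx_col_inj m n (B C : 'M[F]_(m, n)) : (forall v : 'cV_n, B *m v = C *m v) -> B = C.
Proof.
move=> BC; apply/matrixP => i j.
by have /matrixP/(_ i 0) := BC (delta_mx j 0); rewrite -!colE !mxE.
Qed.

Lemma mrep_linear r s (f : mrep_mod r -> mrep_mod s) : linear f ->
  exists2 G, @mhom s r G & forall v, f v = G *m v.
Proof.
move=> fl; have fD u v : f (u + v) = f u + f v by have := fl 1 u v; rewrite !scale1r.
have f0 : f 0 = 0 by apply: (addrI (f 0)); rewrite -fD !addr0.
have fZ u v : f (u *: v) = u *: f v by have := fl u v 0; rewrite f0 !addr0.
pose d j : mrep_mod r := delta_mx j 0.
pose G : 'M_(mdim s, mdim r) := \matrix_(i, j) f (d j) i 0.
have fG v : f v = G *m v.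
  have vE : v = \sum_j (v j 0)%:A *: d j :> mrep_mod r.
    rewrite {1}[v]matrix_sum_delta; apply: eq_bigr => j _.
    by rewrite big_ord1 mrep_scale_alg.
  rewrite {1}vE (big_morph f fD f0); apply/matrixP => i k; rewrite !ord1 summxE !mxE.
  by apply: eq_bigr => j _; rewrite fZ mrep_scale_alg !mxE mulrC.
exists G => // u; apply: mulmx_col_inj => v.
by rewrite -!mulmxA -fG -[mact r u *m v]/(u *: (v : mrep_mod r)) -fG fZ.
Qed.

Lemma miso_rep_iso r s : miso r s <-> rep_iso (mrep_mod r) (mrep_mod s).
Proof.
split=> [[f [g [hf hg fg gf]]]|/rep_isoE[f [g [fl gl fg gf]]]].
  apply: (@rep_isoP (mrep_mod r) (mrep_mod s) (mulmx g) (mulmx f)).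
  - by move=> u x y; rewrite mulmxDr !mrep_scaleE !mulmxA hg.
  - by move=> x; rewrite mulmxA fg mul1mx.
  - by move=> x; rewrite mulmxA gf mul1mx.
have [G hG fE] := mrep_linear fl; have [G' hG' gE] := mrep_linear gl.
exists G', G; split=> //; apply: mulmx_col_inj => v; rewrite mul1mx -mulmxA.
  by rewrite -fE -gE fg.
by rewrite -gE -fE gf.
Qed.

Lemma fin_dim_mrep r : fin_dim (mrep_mod r).
Proof.
exists [seq (delta_mx j 0 : mrep_mod r) | j <- enum 'I_(mdim r)] => v.
rewrite size_map size_enum_ord; exists (fun j => v j 0).
rewrite {1}[v]matrix_sum_delta; apply: eq_bigr => j _.
rewrite big_ord1 mrep_scale_alg (nth_map j) ?size_enum_ord //.
by rewrite nth_ord_enum.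
Qed.

(** A spanning family of minimal size is a basis. *)
Lemma fin_dim_basis (V : lmodType A) : fin_dim V -> exists n (b : 'I_n -> V),
  (forall v, exists c : 'I_n -> F, v = \sum_i (c i)%:A *: b i) /\
  (forall c : 'I_n -> F, \sum_i (c i)%:A *: b i = 0 -> forall i, c i = 0).
Proof.
move=> [s sP]; pose Q n := `[< exists b : 'I_n -> V,
  forall v, exists c : 'I_n -> F, v = \sum_i (c i)%:A *: b i >].
have exQ : exists n, Q n.
  by exists (size s); apply/asboolP; exists (fun i => s`_i).
case: (ex_minnP exQ) => n /asboolP[b bP] min; exists n, b; split=> // c c0 j.
apply/eqP/negPn/negP => cj; case: n => [|n] in b bP min c c0 j cj *; first by case: j cj.
suff /min : Q n by rewrite ltnn.
apply/asboolP; exists (fun i => b (lift j i)) => v; have [d ->] := bP v.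
exists (fun i => d (lift j i) - d j / c j * c (lift j i)).
have bj : b j = - \sum_i ((c j)^-1 * c (lift j i))%:A *: b (lift j i).
  apply/eqP; rewrite -addr_eq0; apply/eqP.
  have := congr1 (fun v => ((c j)^-1)%:A *: v) c0; rewrite scaler0 => E; rewrite -[RHS]E {E}.
  rewrite (bigD1_ord j) //= scalerDr scalerA -scalerAl mul1r scalerA mulVf // scale1r.
  rewrite scale1r scaler_sumr; congr (_ + _); apply: eq_bigr => i _.
  by rewrite scalerA -scalerAl mul1r scalerA.
rewrite (bigD1_ord j) //= bj scalerN scaler_sumr addrC -sumrB; apply: eq_bigr => i _.
rewrite scalerA -scalerAl mul1r scalerA -scalerBl -scalerBl; congr (_ *: _).
by rewrite mulrA.
Qed.

Lemma fin_dim_rep_iso (V : lmodType A) : fin_dim V -> exists r, rep_iso V (mrep_mod r).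
Proof.
move=> /fin_dim_basis[n [b [span indep]]].
pose L (v : 'cV[F]_n) : V := \sum_i (v i 0)%:A *: b i.
have LD v v' : L (v + v') = L v + L v'.
  by rewrite -big_split; apply: eq_bigr => i _; rewrite mxE !scalerDl.
have L0 : L 0 = 0 by apply: (addrI (L 0)); rewrite -LD !addr0.
have LZ c v : L (c *: v) = c%:A *: L v.
  rewrite scaler_sumr; apply: eq_bigr => i _.
  by rewrite mxE scalerA -scalerAl mul1r scalerA.
have Linj v v' : L v = L v' -> v = v'.
  move=> E; apply/eqP; rewrite -subr_eq0; apply/eqP/matrixP => i j; rewrite ord1 [RHS]mxE.
  apply: (indep (fun i => (v - v') i 0)); rewrite -/(L _) LD E -LD subrr.
  exact: L0.
have /choice[co coK] v : exists c, L c = v.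
  have [c vE] := span v; exists (\col_i c i); rewrite vE.
  by apply: eq_bigr => i _; rewrite mxE.
pose m (u : A) : 'M[F]_n := \matrix_(i, j) co (u *: b j) i 0.
have central c (u : A) : c%:A * u = u * c%:A by rewrite mulr_algl mulr_algr.
have mP u v : L (m u *m v) = u *: L v.
  have -> : m u *m v = \sum_j v j 0 *: co (u *: b j).
    apply/matrixP => i k; rewrite ord1 summxE !mxE; apply: eq_bigr => j _.
    by rewrite !mxE mulrC.
  rewrite (big_morph L LD L0) scaler_sumr; apply: eq_bigr => j _.
  by rewrite LZ coK !scalerA central.
have ext B C : (forall v, L (B *m v) = L (C *m v)) -> B = C :> 'M[F]_n.
  by move=> h; apply: mulmx_col_inj => v; apply: Linj.
have m_lin : linear m.
  move=> c u v; apply: ext => x.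
  by rewrite mulmxDl LD -scalemxAl LZ !mP scalerA mulr_algl scalerDl.
have m1 : m 1 = 1%:M by apply: ext => x; rewrite mP scale1r mul1mx.
have mM u v : m (u * v) = m u *m m v.
  by apply: ext => x; rewrite -mulmxA !mP scalerA.
exists (MRep m_lin m1 mM); apply: (@rep_isoP V (mrep_mod (MRep m_lin m1 mM)) co L).
- by move=> u x y; apply: Linj; rewrite coK LD mrep_scaleE mP !coK.
- by move=> v; rewrite coK.
- by move=> v; apply: Linj; rewrite coK.
Qed.

Lemma idempotent_split n (e : 'M[F]_n) : e *m e = e ->
  exists k (C : 'M_(n, k)) (R : 'M_(k, n)), C *m R = e /\ R *m C = 1%:M.
Proof.
move=> ee; exists (\rank e), (col_base e), (row_base e); rewrite mulmx_base; split=> //.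
have CV : pinvmx (col_base e) *m col_base e = 1%:M by rewrite mulVpmx ?col_base_full.
have RV : row_base e *m pinvmx (row_base e) = 1%:M by rewrite mulmxVp ?row_base_free.
have : col_base e *m row_base e *m (col_base e *m row_base e) = col_base e *m row_base e.
  by rewrite mulmx_base.
move: (col_base e) (row_base e) (pinvmx (col_base e)) (pinvmx (row_base e)) CV RV.
move=> C R C' R' CV RV.
move/(congr1 (fun X => C' *m X *m R')).
by rewrite !mulmxA CV !mul1mx -!mulmxA RV mulmx1.
Qed.

(** The image of an idempotent endomorphism is again a representation. *)
Lemma mrep_image r (e : 'M_(mdim r)) : @mhom r r e -> e *m e = e ->
  exists s C R, [/\ @mhom r s C, @mhom s r R, C *m R = e & R *m C = 1%:M].
Proof.
move=> he ee; have [k [C [R [CR RC]]]] := idempotent_split ee.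
pose m u := R *m mact r u *m C.
have mC u : mact r u *m C = C *m m u.
  by rewrite /m !mulmxA CR -he -CR -!mulmxA RC mulmx1.
have mR u : m u *m R = R *m mact r u.
  by rewrite /m -!mulmxA CR he -CR !mulmxA RC mul1mx.
have m_lin : linear m.
  by move=> c u v; rewrite /m mactD mactZ mulmxDr mulmxDl -scalemxAr -scalemxAl.
have m1 : m 1 = 1%:M by rewrite /m mact1 mulmx1.
have mM u v : m (u * v) = m u *m m v by rewrite -[in RHS]/(R *m mact r v *m C) [RHS]mulmxA [X in X *m C]mulmxA mR /m mactM !mulmxA.
by exists (MRep m_lin m1 mM), C, R; split.
Qed.

(** Decompositions correspond to idempotents: the projection onto a summand in
    one direction, the images of [e] and [1 - e] in the other. *)
Lemma indecomposable_mindec r : indecomposable (mrep_mod r) <-> mindec r.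
Proof.
split=> [[nz idem]|[r0 idem]]; last first.
  split=> [z|U W /rep_isoE[f [g [fl gl fg gf]]]].
    have : (const_mx 1 : mrep_mod r) = 0 by exact: z.
    by move=> /matrixP/(_ (Ordinal r0) 0) /eqP; rewrite !mxE oner_eq0.
  have f0 : f 0 = 0.
    by have := fl 1 0 0; rewrite !scale1r addr0 -{1}[f 0]addr0 => /addrI.
  have [|P hP PE] := @mrep_linear r r (fun v => g ((f v).1, 0)).
    move=> u x y; rewrite fl /= -gl; congr g.
    by apply: injective_projections; rewrite //= scaler0 addr0.
  have PP : P *m P = P.
    by apply: mulmx_col_inj => v; rewrite -mulmxA -!PE gf.
  case: (idem P hP PP) => PE0; [left | right] => x.
    have := PE (g (x, 0)); rewrite PE0 mul0mx gf => /(congr1 f); rewrite gf.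
    by rewrite f0 => -[].
  have := PE (g (0, x)); rewrite PE0 mul1mx gf => /(congr1 f); rewrite !gf.
  by case.
split=> [|e he ee].
  rewrite lt0n; apply/eqP => r0; apply: nz => v.
  by apply/matrixP => i; have := ltn_ord i; rewrite {2}r0.
have hom1 : @mhom r r (1%:M - e) by move=> u; rewrite mulmxBl mulmxBr mulmx1 mul1mx he.
have ee1 : (1%:M - e) *m (1%:M - e) = 1%:M - e.
  by rewrite mulmxBl mul1mx mulmxBr mulmx1 ee subrr subr0.
have [s [C [R [hC hR CR RC]]]] := mrep_image he ee.
have [s' [C' [R' [hC' hR' CR' RC']]]] := mrep_image hom1 ee1.
have RC'0 : R *m C' = 0.
  rewrite -[R]mul1mx -RC -[C']mulmx1 -RC' !mulmxA -(mulmxA R C R) CR -(mulmxA _ C' R') CR'.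
  by rewrite -(mulmxA R) mulmxBr mulmx1 ee subrr mulmx0 mul0mx.
have R'C0 : R' *m C = 0.
  rewrite -[R']mul1mx -RC' -[C]mulmx1 -RC !mulmxA -(mulmxA R' C' R') CR' -(mulmxA _ C R) CR.
  by rewrite -(mulmxA R') mulmxBl mul1mx ee subrr mulmx0 mul0mx.
have zdim t : zero_rep (mrep_mod t) -> forall n (X : 'M[F]_(n, mdim t)), X = 0.
  move=> z n X; apply: mulmx_col_inj => v; rewrite mul0mx.
  by rewrite (_ : v = 0) ?mulmx0 //; exact: z.
case: (idem (mrep_mod s) (mrep_mod s')).
- apply: (@rep_isoP (mrep_mod r) (mrep_mod s * mrep_mod s')%type
    (fun v => (R *m v, R' *m v)) (fun v => C *m v.1 + C' *m v.2)).
  + move=> u x y; rewrite !mulmxDr mrep_scaleE !mulmxA -hR -hR' -!mulmxA.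
    by congr pair.
  + by move=> x; rewrite !mulmxA CR CR' -mulmxDl addrC subrK mul1mx.
  + move=> [x y]; rewrite !mulmxDr !mulmxA RC RC' RC'0 R'C0 !mul0mx !mul1mx.
    by rewrite addr0 add0r.
- by move=> /zdim C0; left; rewrite -CR (C0 _ C) mul0mx.
- by move=> /zdim C0; right; apply/eqP; rewrite -subr_eq0 -oppr_eq0 opprB -CR' (C0 _ C') mul0mx.
Qed.

End MatrixReps.

(** * The generators and relations of the zigzag algebra *)

Section PresentationDef.
Variables (F : fieldType) (Gamma : sgraph).
Implicit Types a b : Gamma.

(** The idempotents of the vertices, the arrows and the loops, that is, the
    classes of the paths (a|b|a). The loops are kept as generators so that a
    graph with one vertex fits the same relations, and the operations are
    explicit so that the relations apply to square matrices of any size. *)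
Record zigzag_family (B : nmodType) (mul : B -> B -> B) (one : B)
    (e : Gamma -> B) (x : Gamma -> Gamma -> B) (z : Gamma -> B) : Prop := ZigzagFamily {
  zz_sum : \sum_a e a = one;
  zz_ee a b : mul (e a) (e b) = if a == b then e a else 0;
  zz_ex a b : adj a b -> mul (e a) (x a b) = x a b;
  zz_xe a b : adj a b -> mul (x a b) (e b) = x a b;
  zz_ez a : mul (e a) (z a) = z a;
  zz_ze a : mul (z a) (e a) = z a;
  zz_xx a b c : adj a b -> adj b c -> mul (x a b) (x b c) = if a == c then z a else 0;
  zz_zx a b : adj a b -> mul (z a) (x a b) = 0;
  zz_xz a b : adj a b -> mul (x a b) (z b) = 0;
  zz_zz a : mul (z a) (z a) = 0
}.

(** [zp_univ] says that the relations among the generators are the defining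
    ones, tested on matrix algebras only. *)
Record zigzag_presentation (A : algType F) (e : Gamma -> A) (x : Gamma -> Gamma -> A)
    (z : Gamma -> A) : Prop := ZigzagPresentation {
  zp_family : zigzag_family *%R 1 e x z;
  zp_gen (P : A -> Prop) :
    (forall a, P (e a)) -> (forall a b, adj a b -> P (x a b)) -> (forall a, P (z a)) ->
    (forall c u v, P u -> P v -> P (c *: u + v)) -> (forall u v, P u -> P v -> P (u * v)) ->
    forall u, P u;
  zp_univ n (E : Gamma -> 'M[F]_n) X Z : zigzag_family mulmx 1%:M E X Z ->
    exists rho : A -> 'M[F]_n,
      [/\ linear rho, rho 1 = 1%:M, forall u v, rho (u * v) = rho u *m rho v &
        [/\ forall a, rho (e a) = E a, forall a b, adj a b -> rho (x a b) = X a b &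
            forall a, rho (z a) = Z a]]
}.

End PresentationDef.

Section Presentation.
Variables (F : fieldType) (Gamma : sgraph).
Implicit Types a b : Gamma.
Variables (A : algType F) (e : Gamma -> A) (x : Gamma -> Gamma -> A) (z : Gamma -> A).
Hypothesis zz : zigzag_presentation e x z.
Implicit Types r s t : mrep A.

Definition rE r a := mact r (e a).
Definition rX r a b := mact r (x a b).
Definition rZ r a := mact r (z a).

Section Relations.
Variable r : mrep A.
Let zf := zp_family zz.

Lemma sum_rE : \sum_a rE r a = 1%:M.
Proof. by rewrite -mact_sum (zz_sum zf) mact1. Qed.

Lemma rEE a b : rE r a *m rE r b = if a == b then rE r a else 0.
Proof. by rewrite -mactM (zz_ee zf); case: ifP => // _; rewrite mact0. Qed.

Lemma rEX (c a b : Gamma) : adj a b ->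
  rE r c *m rX r a b = if c == a then rX r a b else 0.
Proof.
move=> ab; have xE : rX r a b = rE r a *m rX r a b by rewrite -mactM (zz_ex zf ab).
by rewrite {1}xE mulmxA rEE; case: eqP => [->|_]; rewrite -?xE ?mul0mx.
Qed.

Lemma rXE (c a b : Gamma) : adj a b ->
  rX r a b *m rE r c = if c == b then rX r a b else 0.
Proof.
move=> ab; have xE : rX r a b = rX r a b *m rE r b by rewrite -mactM (zz_xe zf ab).
by rewrite {1}xE -mulmxA rEE eq_sym; case: eqP => _; rewrite -?xE ?mulmx0.
Qed.

Lemma rEZ c a : rE r c *m rZ r a = if c == a then rZ r a else 0.
Proof.
have zE : rZ r a = rE r a *m rZ r a by rewrite -mactM (zz_ez zf).
by rewrite {1}zE mulmxA rEE; case: eqP => [->|_]; rewrite -?zE ?mul0mx.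
Qed.

Lemma rZE c a : rZ r a *m rE r c = if c == a then rZ r a else 0.
Proof.
have zE : rZ r a = rZ r a *m rE r a by rewrite -mactM (zz_ze zf).
by rewrite {1}zE -mulmxA rEE eq_sym; case: eqP => _; rewrite -?zE ?mulmx0.
Qed.

Lemma rXX (a b c d : Gamma) : adj a b -> adj c d ->
  rX r a b *m rX r c d = if (b == c) && (a == d) then rZ r a else 0.
Proof.
move=> ab; case: (eqVneq b c) => [<-{c}|bc] cd /=.
  by rewrite -mactM (zz_xx zf ab cd); case: ifP => // _; rewrite mact0.
have -> : rX r a b = rX r a b *m rE r b by rewrite rXE ?eqxx.
by rewrite -mulmxA rEX // (negbTE bc) mulmx0.
Qed.

Lemma rZX c a b : adj a b -> rZ r c *m rX r a b = 0.
Proof.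
move=> ab; have [->|ca] := eqVneq c a; first by rewrite -mactM (zz_zx zf ab) mact0.
have -> : rZ r c = rZ r c *m rE r c by rewrite rZE eqxx.
by rewrite -mulmxA rEX // (negbTE ca) mulmx0.
Qed.

Lemma rXZ c a b : adj a b -> rX r a b *m rZ r c = 0.
Proof.
move=> ab; have [->|ca] := eqVneq c b; first by rewrite -mactM (zz_xz zf ab) mact0.
have -> : rZ r c = rE r c *m rZ r c by rewrite rEZ eqxx.
by rewrite mulmxA rXE // (negbTE ca) mul0mx.
Qed.

Lemma rZZ a b : rZ r a *m rZ r b = 0.
Proof.
have [->|ab] := eqVneq a b; first by rewrite -mactM (zz_zz zf) mact0.
have -> : rZ r b = rE r b *m rZ r b by rewrite rEZ eqxx.
by rewrite mulmxA rZE eq_sym (negbTE ab) mul0mx.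
Qed.

End Relations.

Lemma mhomP r s (f : 'M_(mdim r, mdim s)) :
  (forall a, rE r a *m f = f *m rE s a) ->
  (forall a b, adj a b -> rX r a b *m f = f *m rX s a b) ->
  (forall a, rZ r a *m f = f *m rZ s a) -> @mhom _ _ r s f.
Proof.
move=> fE fX fZ; apply: (zp_gen zz (P := fun u => mact r u *m f = f *m mact s u)) => // [c u v hu hv|u v hu hv].
  by rewrite !mactD !mactZ mulmxDl mulmxDr -scalemxAl -scalemxAr hu hv.
by rewrite !mactM -mulmxA hv !mulmxA hu.
Qed.

(** * Modules on which some loop acts nontrivially *)

(** The projective module at [a] has basis the idempotent, the arrows at [a] and
    the loop. It is also injective, so a row [v] gives a map out of it and a
    column [w] a map into it; the terms of their composite are indexed by the
    basis and its dual basis. *)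
Definition proj_hom r s a (w : 'cV[F]_(mdim r)) (v : 'rV[F]_(mdim s)) : 'M_(mdim r, mdim s) :=
  rZ r a *m w *m v + w *m v *m rZ s a +
  \sum_(b | adj a b) rX r b a *m w *m v *m rX s a b.

Lemma proj_homP r s a w v : rE r a *m w = w -> v *m rE s a = v ->
  @mhom _ _ r s (@proj_hom r s a w v).
Proof.
move=> Ew vE; have adjC b : adj a b -> adj b a by rewrite adj_sym.
have Aw n (M : 'M_(n, mdim r)) : M *m w = M *m rE r a *m w by rewrite -mulmxA Ew.
have vA n (M : 'M_(mdim s, n)) : v *m M = v *m (rE s a *m M) by rewrite mulmxA vE.
apply: mhomP => [c|c d cd|c]; rewrite /proj_hom !mulmxDr !mulmxDl mulmx_sumr mulmx_suml.
- congr (_ + _ + _).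
  + rewrite !mulmxA rEZ -[RHS]mulmxA vA rEE eq_sym.
    by case: eqP => _; rewrite ?vE ?mul0mx ?mulmx0.
  + rewrite !mulmxA Aw rEE -[RHS]mulmxA rZE.
    by case: eqP => [->|_]; rewrite ?Ew ?mul0mx ?mulmx0.
  + apply: eq_bigr => b ab; rewrite !mulmxA rEX ?adjC // -[RHS]mulmxA rXE //.
    by case: eqP => _; rewrite ?mul0mx ?mulmx0.
- have da_w : d != a -> rX r c d *m w = 0.
    by move=> da; rewrite Aw rXE // eq_sym (negbTE da) mul0mx.
  have ca_v : c != a -> v *m rX s c d = 0.
    by move=> ca; rewrite vA rEX // eq_sym (negbTE ca) mulmx0.
  have L : rX r c d *m (w *m v *m rZ s a) =
      \sum_(b | adj a b) rX r b a *m w *m v *m rX s a b *m rX s c d.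
    have [da|da] := eqVneq d a; last first.
      rewrite big1 => [|b ab]; first by rewrite !mulmxA da_w // !mul0mx.
      by rewrite -mulmxA rXX // eq_sym [a == d]eq_sym (negbTE da) andbF mulmx0.
    rewrite (bigD1 c) /=; last by rewrite -da adj_sym.
    rewrite big1 => [|b /andP[ab bc]]; last by rewrite -mulmxA rXX // (negbTE bc) mulmx0.
    rewrite addr0 -[RHS]mulmxA rXX //; last by rewrite -da adj_sym.
    by rewrite da !eqxx !mulmxA.
  have R : \sum_(b | adj a b) rX r c d *m (rX r b a *m w *m v *m rX s a b) =
      rZ r a *m w *m v *m rX s c d.
    have [ca|ca] := eqVneq c a; last first.
      rewrite -[RHS]mulmxA ca_v // mulmx0 big1 // => b ab.
      by rewrite !mulmxA rXX ?adjC // (negbTE ca) andbF !mul0mx.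
    rewrite (bigD1 d) /=; last by rewrite -ca.
    rewrite big1 => [|b /andP[ab bd]]; last first.
      by rewrite !mulmxA rXX ?adjC // eq_sym (negbTE bd) !mul0mx.
    by rewrite addr0 !mulmxA rXX ?adjC // -?ca // !eqxx.
  rewrite L R !mulmxA rXZ // !mul0mx add0r -[w *m v *m _ *m _]mulmxA rZX // mulmx0 addr0.
  by rewrite addrC.
- rewrite !mulmxA rZZ !mul0mx add0r -[w *m v *m _ *m _]mulmxA rZZ mulmx0 addr0.
  rewrite !big1 => [|b ab|b ab]; last 2 first.
  + by rewrite -!mulmxA rXZ // !mulmx0.
  + by rewrite !mulmxA rZX ?adjC // !mul0mx.
  rewrite !addr0 Aw rZE -[RHS]mulmxA vA rEZ.
  by case: eqP => [->|_]; rewrite ?mul0mx ?mulmx0 ?mulmxA.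
Qed.

(** For such a pair [proj_hom] is idempotent, and its image is the projective
    module at [a]. *)
Definition dual_pair r a (w : 'cV[F]_(mdim r)) (v : 'rV[F]_(mdim r)) : Prop :=
  [/\ rE r a *m w = w, v *m rE r a = v, v *m w = 0 & v *m rZ r a *m w = 1%:M].

(** Any [v] and [w] with v z w = 1 become a dual pair after a multiple of z w is
    subtracted from [w], to achieve v w = 0. *)
Lemma dual_pair_exists r a : rZ r a != 0 -> exists w v, @dual_pair r a w v.
Proof.
move=> /nonzero_mx_pairing[c [v0]]; rewrite mulmxA.
have {1}-> : rZ r a = rE r a *m rZ r a *m rE r a by rewrite rEZ eqxx rZE eqxx.
rewrite !mulmxA; set v := v0 *m rE r a; rewrite -(mulmxA _ _ c); set w := rE r a *m c => vZw.
have vE : v *m rE r a = v by rewrite -mulmxA rEE eqxx.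
have Ew : rE r a *m w = w by rewrite mulmxA rEE eqxx.
clearbody v w; exists (w - rZ r a *m w *m (v *m w)), v; split=> //.
- by rewrite mulmxBr Ew !mulmxA rEZ eqxx.
- by rewrite mulmxBr !mulmxA vZw mul1mx subrr.
- by rewrite mulmxBr !mulmxA -(mulmxA v (rZ r a) (rZ r a)) rZZ mulmx0 !mul0mx subr0.
Qed.

Lemma proj_hom_comp r s t a w v w' v' : rE s a *m w' = w' -> v *m rE s a = v ->
  v *m w' = 0 -> v *m rZ s a *m w' = 1%:M ->
  @proj_hom r s a w v *m @proj_hom s t a w' v' = @proj_hom r t a w v'.
Proof.
move=> Ew vE vw vZw; have adjC b : adj a b -> adj b a by rewrite adj_sym.
have Xw b : adj a b -> rX s a b *m w' = 0.
  move=> ab; rewrite -Ew mulmxA rXE //; case: eqP => [ba|_]; last by rewrite mul0mx.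
  by move: ab; rewrite ba adj_irr.
have vX b : adj a b -> v *m rX s b a = 0.
  move=> ab; rewrite -vE -mulmxA rEX ?adjC //; case: eqP => [ba|_]; last by rewrite mulmx0.
  by move: ab; rewrite ba adj_irr.
have vH : v *m @proj_hom s t a w' v' = v'.
  rewrite /proj_hom !mulmxDr mulmx_sumr big1 => [|b ab]; last by rewrite !mulmxA vX // !mul0mx.
  by rewrite !mulmxA vZw vw !mul0mx mul1mx !addr0.
have vZH : v *m rZ s a *m @proj_hom s t a w' v' = v' *m rZ t a.
  rewrite /proj_hom !mulmxDr mulmx_sumr big1 => [|b ab]; last first.
    by rewrite -!mulmxA (mulmxA (rZ s a)) rZX ?adjC // mul0mx mulmx0.
  by rewrite !mulmxA vZw mul1mx -(mulmxA v) rZZ mulmx0 !mul0mx add0r addr0.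
have vXH b : adj a b -> v *m rX s a b *m @proj_hom s t a w' v' = v' *m rX t a b.
  move=> ab; rewrite /proj_hom !mulmxDr mulmx_sumr (bigD1 b) //= big1 => [|c /andP[ac cb]].
    rewrite !mulmxA -(mulmxA v (rX s a b) (rZ s a)) rXZ // -(mulmxA v (rX s a b) w') Xw //.
    rewrite -(mulmxA v (rX s a b) (rX s b a)) rXX ?adjC // !eqxx vZw mul1mx.
    by rewrite !mulmx0 !mul0mx !add0r addr0.
  rewrite !mulmxA -(mulmxA v (rX s a b) (rX s c a)) rXX ?adjC //.
  by rewrite [b == c]eq_sym (negbTE cb) mulmx0 !mul0mx.
rewrite {1}/proj_hom !mulmxDl mulmx_suml -(mulmxA _ v) vH -(mulmxA w) -(mulmxA w) vZH !mulmxA.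
congr (_ + _); apply: eq_bigr => b ab.
by rewrite -!mulmxA (mulmxA v) vXH.
Qed.

Lemma proj_hom_mulr r s t a w v f : @mhom _ _ s t f ->
  @proj_hom r s a w v *m f = @proj_hom r t a w (v *m f).
Proof.
move=> hf; rewrite /proj_hom !mulmxDl mulmx_suml !mulmxA; congr (_ + _ + _).
  by rewrite -(mulmxA _ (rZ s a)) hf !mulmxA.
by apply: eq_bigr => b _; rewrite -(mulmxA _ (rX s a b)) hf !mulmxA.
Qed.

Lemma proj_hom_mull q r s a w v f : @mhom _ _ q r f ->
  f *m @proj_hom r s a w v = @proj_hom q s a (f *m w) v.
Proof.
move=> hf; rewrite /proj_hom !mulmxDr mulmx_sumr !mulmxA -hf; congr (_ + _).
by apply: eq_bigr => b _; rewrite !mulmxA -hf.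
Qed.

Lemma proj_hom_row r s a w v (u : 'rV_(mdim r)) : u *m rE r a = u ->
  u *m @proj_hom r s a w v = u *m rZ r a *m w *m v + u *m w *m v *m rZ s a.
Proof.
move=> uE; rewrite /proj_hom !mulmxDr mulmx_sumr !mulmxA big1 ?addr0 // => b ab.
rewrite !mulmxA -{1}uE -(mulmxA u) rEX 1?adj_sym //.
case: eqP => [ba|_]; last by rewrite mulmx0 !mul0mx.
by move: ab; rewrite ba adj_irr.
Qed.

Lemma dual_pair_row r a w v : @dual_pair r a w v -> v *m @proj_hom r r a w v = v.
Proof.
by case=> _ vE vw vZw; rewrite proj_hom_row // vZw vw !mul0mx mul1mx addr0.
Qed.

Lemma dual_pair_neq0 r a w v : @dual_pair r a w v -> v != 0.
Proof.
case=> _ _ _ vZw; apply: contra_eq_neq vZw => ->; rewrite !mul0mx eq_sym.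
by apply/eqP => /matrixP/(_ 0 0)/eqP; rewrite !mxE oner_eq0.
Qed.

Lemma mindec_proj_id r a : mindec r -> rZ r a != 0 ->
  exists w v, @dual_pair r a w v /\ @proj_hom r r a w v = 1%:M.
Proof.
move=> [_ idem] /dual_pair_exists[w [v dp]]; exists w, v; split=> //.
have [Ew vE vw vZw] := dp.
case: (idem (@proj_hom r r a w v)) => // [||e0].
- exact: proj_homP.
- exact: proj_hom_comp.
- have := dual_pair_row dp; rewrite e0 mulmx0 => v0.
  by have := dual_pair_neq0 dp; rewrite -v0 eqxx.
Qed.

(** An endomorphism [f] is determined by v f = s v + t v z, and it is idempotent
    only if s^2 = s and 2 s t = t. *)
Lemma proj_id_mindec r a w v : @dual_pair r a w v -> @proj_hom r r a w v = 1%:M -> mindec r.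
Proof.
move=> dp id1; have [Ew vE vw vZw] := dp; split=> [|f hf ff].
  rewrite lt0n; apply/eqP => r0; case/eqP: (dual_pair_neq0 dp).
  by apply/matrixP => i j; have := ltn_ord j; rewrite {2}r0.
have vfE : v *m f *m rE r a = v *m f by rewrite -mulmxA -[rE r a]/(mact r _) -hf mulmxA vE.
have := proj_hom_row w v vfE; rewrite id1 mulmx1.
rewrite [v *m f *m _ *m w]mx11_scalar [v *m f *m w]mx11_scalar !mul_scalar_mx -scalemxAl.
move: ((v *m f *m rZ r a *m w) 0 0) ((v *m f *m w) 0 0) => s t vfE2.
have vff : v *m f *m f = v *m f by rewrite -mulmxA ff.
have fE : f = @proj_hom r r a w (v *m f) by rewrite -proj_hom_mulr // id1 mul1mx.
have vZf : v *m rZ r a *m f = s *: (v *m rZ r a).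
  rewrite -mulmxA -[rZ r a]/(mact r _) hf mulmxA vfE2 mulmxDl -!scalemxAl.
  by rewrite -[mact r _]/(rZ r a) -mulmxA rZZ mulmx0 scaler0 addr0.
have uniq p q p' q' : p *: v + q *: (v *m rZ r a) = p' *: v + q' *: (v *m rZ r a) ->
    p = p' /\ q = q'.
  move=> E; split.
    have /matrixP/(_ 0 0) := congr1 (fun u => u *m rZ r a *m w) E.
    rewrite !mulmxDl -!scalemxAl vZw -(mulmxA v (rZ r a) (rZ r a)) rZZ mulmx0 mul0mx.
    by rewrite !scaler0 !addr0 !mxE !mulr1.
  have /matrixP/(_ 0 0) := congr1 (fun u => u *m w) E.
  by rewrite !mulmxDl -!scalemxAl vZw vw !scaler0 !add0r !mxE !mulr1.
have [sE tE] : s * s = s /\ s * t + t * s = t.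
  apply: uniq; rewrite -vfE2 -[RHS]vff vfE2 mulmxDl -!scalemxAl vZf vfE2.
  by rewrite scalerDr !scalerA scalerDl addrA.
have [s0|s1] : s = 0 \/ s = 1.
  by move/eqP: sE; rewrite -{3}[s]mulr1 -subr_eq0 -mulrBr mulf_eq0 subr_eq0 => /orP[] /eqP;
    [left | right].
- left; have t0 : t = 0 by rewrite -tE s0 mul0r mulr0 addr0.
  by rewrite fE vfE2 s0 t0 !scale0r addr0 /proj_hom !mulmx0 mul0mx !add0r big1 // => b _;
    rewrite mulmx0 mul0mx.
- right; have t0 : t = 0.
    by apply: (addrI t); rewrite addr0 -{3}tE s1 mul1r mulr1.
  by rewrite fE vfE2 s1 t0 scale1r scale0r addr0.
Qed.

Lemma proj_uniq r s a : mindec r -> mindec s -> rZ r a != 0 -> rZ s a != 0 -> miso r s.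
Proof.
move=> ir is' /(mindec_proj_id ir)[w [v [[Ew vE vw vZw] id1]]].
move=> /(mindec_proj_id is')[w' [v' [[Ew' vE' vw' vZw'] id1']]].
exists (@proj_hom r s a w v'), (@proj_hom s r a w' v); split; try exact: proj_homP.
  by rewrite proj_hom_comp.
by rewrite proj_hom_comp.
Qed.

Lemma proj_loop_uniq r a b : mindec r -> rZ r a != 0 -> rZ r b != 0 -> a = b.
Proof.
move=> ir /(mindec_proj_id ir)[w [v [[Ew vE vw vZw] id1]]] Zb.
apply/eqP; apply: contraNT Zb => ab; rewrite -[rZ r b]mulmx1 -id1 /proj_hom !mulmxDr mulmx_sumr.
rewrite big1 => [|c ac]; last by rewrite !mulmxA rZX 1?adj_sym // !mul0mx.
by rewrite !mulmxA rZZ -Ew !mulmxA rZE (negbTE ab) !mul0mx !addr0.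
Qed.

Lemma miso_loop r s a : miso r s -> rZ r a != 0 -> rZ s a != 0.
Proof.
case=> f [g [hf hg fg gf]]; apply: contra_neq => Z0.
by rewrite -[rZ r a]mulmx1 -fg mulmxA [_ *m f]hf -[mact s _]/(rZ s a) Z0 mulmx0 mul0mx.
Qed.

(** Matrix units on a basis made of the two ends [inl true], [inl false] of the
    loop and of the vertices: an arrow from [a] leads from the first end to a
    vertex and an arrow to [a] leads from a vertex to the second end. *)
Lemma loop_rep_exists a : exists r, rZ r a != 0.
Proof.
pose J := (bool + Gamma)%type; pose N := #|{: J}|.
pose U (j k : J) : 'M[F]_N := delta_mx (enum_rank j) (enum_rank k).
have UU i j k l : U i j *m U k l = if j == k then U i l else 0.
  by rewrite mul_delta_mx_cond (inj_eq enum_rank_inj); case: eqP.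
pose t : J := inl true; pose f : J := inl false.
pose E c := U (inr c) (inr c) + if c == a then U t t + U f f else 0.
pose X b c := if b == a then U t (inr c) else if c == a then U (inr b) f else 0.
pose Z c := if c == a then U t f else 0.
have inrE (b c : Gamma) : (inr b == inr c :> J) = (b == c) by [].
have zzf : zigzag_family mulmx 1%:M E X Z.
  split.
  - rewrite big_split -big_mkcond big_pred1_eq /= mx1_sum_delta.
    rewrite (reindex (@enum_rank J)) /=; last by apply: onW_bij; exact: enum_rank_bij.
    by rewrite big_sumType /= addrC big_bool.
  - move=> b c; rewrite /E mulmxDl !mulmxDr UU inrE.
    have [->|bc] := eqVneq b c.
      case: eqP => _; rewrite ?mulmx0 ?mul0mx ?addr0 // !mulmxDl !mulmxDr !UU /=.
      by rewrite !addr0 !add0r.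
    have [ba|ba] := eqVneq b a; have [ca|ca] := eqVneq c a;
      rewrite ?mulmx0 ?mul0mx ?addr0 // ?mulmxDl ?mulmxDr ?UU /= ?addr0 //.
    by move: bc; rewrite ba ca eqxx.
  - move=> b c bc; rewrite /E /X; have [ba|ba] := eqVneq b a.
      by rewrite !mulmxDl !UU /= !add0r addr0.
    by rewrite addr0; case: eqP => _; rewrite ?mulmx0 // UU eqxx.
  - move=> b c bc; rewrite /E /X; have [ba|ba] := eqVneq b a.
      have ca : c != a by apply: contraTneq bc => ->; rewrite ba adj_irr.
      by rewrite (negbTE ca) addr0 UU eqxx.
    by have [ca|ca] := eqVneq c a; rewrite ?mul0mx // !mulmxDr !UU /= !add0r.
  - move=> c; rewrite /E /Z; case: eqP => _; rewrite ?mulmx0 //.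
    by rewrite !mulmxDl !UU /= add0r addr0.
  - move=> c; rewrite /E /Z; case: eqP => _; rewrite ?mul0mx //.
    by rewrite !mulmxDr !UU /= !add0r.
  - move=> b c d bc cd; rewrite /X /Z; have [ba|ba] := eqVneq b a.
      have ca : c != a by apply: contraTneq bc => ->; rewrite ba adj_irr.
      rewrite (negbTE ca) ba eq_sym; case: eqP => _; last by rewrite mulmx0.
      by rewrite UU eqxx.
    rewrite if_same; have [ca|ca] := eqVneq c a; last by rewrite mul0mx.
    by rewrite UU.
  - move=> b c bc; rewrite /X /Z; case: eqP => _; rewrite ?mul0mx // ?UU //.
  - move=> b c bc; rewrite /X /Z; have [ca|ca] := eqVneq c a; last by rewrite mulmx0.
    by case: eqP => _; rewrite UU.
  - by move=> c; rewrite /Z; case: eqP => _; rewrite ?mul0mx ?UU.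
have [rho [rl r1 rM [_ _ rZE]]] := zp_univ zz zzf.
exists (MRep rl r1 rM); rewrite /rZ /= rZE /Z eqxx.
apply/eqP => /matrixP/(_ (enum_rank t) (enum_rank f))/eqP.
by rewrite !mxE !eqxx oner_eq0.
Qed.

(** The image of the idempotent [proj_hom]. *)
Lemma proj_exists a : exists2 r, mindec r & rZ r a != 0.
Proof.
have [q /dual_pair_exists[w [v dp]]] := loop_rep_exists a.
have [Ew vE vw vZw] := dp.
have he := proj_homP Ew vE.
have ee : @proj_hom q q a w v *m @proj_hom q q a w v = @proj_hom q q a w v.
  exact: proj_hom_comp.
have [r [C [R [hC hR CR RC]]]] := mrep_image he ee.
have row := dual_pair_row dp.
have dp' : @dual_pair r a (R *m w) (v *m C).
  split.
  - by rewrite mulmxA hR -mulmxA Ew.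
  - by rewrite -mulmxA -hC mulmxA vE.
  - by rewrite mulmxA -(mulmxA v) CR row.
  - by rewrite -(mulmxA v) -hC !mulmxA -(mulmxA _ C) CR -(mulmxA v) he mulmxA row.
exists r.
  apply: (proj_id_mindec dp'); rewrite -proj_hom_mull // -proj_hom_mulr //.
  by rewrite -CR !mulmxA RC mul1mx RC.
apply/eqP => Z0; have [_ _ _] := dp'; rewrite Z0 mulmx0 mul0mx => /matrixP/(_ 0 0)/eqP.
by rewrite !mxE eq_sym oner_eq0.
Qed.

(** * Modules on which all loops vanish *)

(** The module with top X and radical Y on which the arrows act as in
    [V] = (X, Y). Inclusions and projections record the decomposition, so that
    any coordinates are allowed on the module. *)
Record is_total r (V : brep F Gamma)
    (it : forall a, 'M[F]_(dtop V a, mdim r)) (pt : forall a, 'M[F]_(mdim r, dtop V a))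
    (ir : forall a, 'M[F]_(drad V a, mdim r)) (pr : forall a, 'M[F]_(mdim r, drad V a)) : Prop := IsTotal {
  tot_tt a : it a *m pt a = 1%:M;
  tot_rr a : ir a *m pr a = 1%:M;
  tot_tr a : it a *m pr a = 0;
  tot_rt a : ir a *m pt a = 0;
  tot_E a : rE r a = pt a *m it a + pr a *m ir a;
  tot_X a b : adj a b -> rX r a b = pt a *m barr V a b *m ir b;
  tot_Z a : rZ r a = 0
}.

Section TotalRelations.
Variables (r : mrep A) (V : brep F Gamma).
Variables (it : forall a, 'M[F]_(dtop V a, mdim r)) (pt : forall a, 'M[F]_(mdim r, dtop V a)).
Variables (ir : forall a, 'M[F]_(drad V a, mdim r)) (pr : forall a, 'M[F]_(mdim r, drad V a)).
Hypothesis tV : is_total it pt ir pr.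

Lemma tot_itE a b : it a *m rE r b = if b == a then it a else 0.
Proof.
have h : it a = it a *m rE r a.
  by rewrite (tot_E tV) mulmxDr !mulmxA (tot_tt tV) (tot_tr tV) mul0mx mul1mx addr0.
by rewrite {1}h -mulmxA rEE eq_sym; case: eqP; rewrite -?h ?mulmx0.
Qed.

Lemma tot_irE a b : ir a *m rE r b = if b == a then ir a else 0.
Proof.
have h : ir a = ir a *m rE r a.
  by rewrite (tot_E tV) mulmxDr !mulmxA (tot_rr tV) (tot_rt tV) mul0mx mul1mx add0r.
by rewrite {1}h -mulmxA rEE eq_sym; case: eqP; rewrite -?h ?mulmx0.
Qed.

Lemma tot_Ept a b : rE r b *m pt a = if b == a then pt a else 0.
Proof.
have h : pt a = rE r a *m pt a.
  by rewrite (tot_E tV) mulmxDl -!mulmxA (tot_tt tV) (tot_rt tV) mulmx0 mulmx1 addr0.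
by rewrite {1}h mulmxA rEE; case: eqP => [->|]; rewrite -?h ?mul0mx.
Qed.

Lemma tot_Epr a b : rE r b *m pr a = if b == a then pr a else 0.
Proof.
have h : pr a = rE r a *m pr a.
  by rewrite (tot_E tV) mulmxDl -!mulmxA (tot_tr tV) (tot_rr tV) mulmx0 mulmx1 add0r.
by rewrite {1}h mulmxA rEE; case: eqP => [->|]; rewrite -?h ?mul0mx.
Qed.

End TotalRelations.

Definition total_map r s (V W : brep F Gamma)
    (it' : forall a, 'M[F]_(dtop W a, mdim s)) 
    (ir' : forall a, 'M[F]_(drad W a, mdim s))
    (pt : forall a, 'M[F]_(mdim r, dtop V a)) (pr : forall a, 'M[F]_(mdim r, drad V a))
    (f : forall a, 'M[F]_(dtop V a, dtop W a)) (g : forall a, 'M[F]_(drad V a, drad W a)) :=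
  \sum_a (pt a *m f a *m it' a + pr a *m g a *m ir' a).

Section TotalMap.
Variables (r s : mrep A) (V W : brep F Gamma).
Variables (it : forall a, 'M[F]_(dtop V a, mdim r)) (pt : forall a, 'M[F]_(mdim r, dtop V a)).
Variables (ir : forall a, 'M[F]_(drad V a, mdim r)) (pr : forall a, 'M[F]_(mdim r, drad V a)).
Variables (it' : forall a, 'M[F]_(dtop W a, mdim s)) (pt' : forall a, 'M[F]_(mdim s, dtop W a)).
Variables (ir' : forall a, 'M[F]_(drad W a, mdim s)) (pr' : forall a, 'M[F]_(mdim s, drad W a)).
Hypotheses (tV : is_total it pt ir pr) (tW : is_total it' pt' ir' pr').
Variables (f : forall a, 'M[F]_(dtop V a, dtop W a)) (g : forall a, 'M[F]_(drad V a, drad W a)).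
Let H := total_map it' ir' pt pr f g.

Lemma tot_it_map a : it a *m H = f a *m it' a.
Proof.
rewrite mulmx_sumr (bigD1 a) //= big1 => [|b ba].
  by rewrite addr0 mulmxDr !mulmxA (tot_tt tV) (tot_tr tV) !mul0mx mul1mx addr0.
have h : it a = it a *m rE r a by rewrite (tot_itE tV) eqxx.
rewrite h mulmxDr !mulmxA -!(mulmxA (it a)) (tot_Ept tV) (tot_Epr tV) eq_sym (negbTE ba).
by rewrite !mul0mx !mulmx0 addr0.
Qed.

Lemma tot_ir_map a : ir a *m H = g a *m ir' a.
Proof.
rewrite mulmx_sumr (bigD1 a) //= big1 => [|b ba].
  by rewrite addr0 mulmxDr !mulmxA (tot_rr tV) (tot_rt tV) !mul0mx mul1mx add0r.
have h : ir a = ir a *m rE r a by rewrite (tot_irE tV) eqxx.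
rewrite h mulmxDr !mulmxA -!(mulmxA (ir a)) (tot_Ept tV) (tot_Epr tV) eq_sym (negbTE ba).
by rewrite !mul0mx !mulmx0 addr0.
Qed.

Lemma tot_map_pt a : H *m pt' a = pt a *m f a.
Proof.
rewrite mulmx_suml (bigD1 a) //= big1 => [|b ba].
  by rewrite addr0 mulmxDl -!mulmxA (tot_tt tW) (tot_rt tW) !mulmx0 mulmx1 addr0.
have h : pt' a = rE s a *m pt' a by rewrite (tot_Ept tW) eqxx.
rewrite h mulmxDl -!mulmxA !(mulmxA _ (rE s a)) (tot_itE tW) (tot_irE tW) eq_sym (negbTE ba).
by rewrite !mul0mx !mulmx0 addr0.
Qed.

Lemma tot_map_pr a : H *m pr' a = pr a *m g a.
Proof.
rewrite mulmx_suml (bigD1 a) //= big1 => [|b ba].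
  by rewrite addr0 mulmxDl -!mulmxA (tot_tr tW) (tot_rr tW) !mulmx0 mulmx1 add0r.
have h : pr' a = rE s a *m pr' a by rewrite (tot_Epr tW) eqxx.
rewrite h mulmxDl -!mulmxA !(mulmxA _ (rE s a)) (tot_itE tW) (tot_irE tW) eq_sym (negbTE ba).
by rewrite !mul0mx !mulmx0 addr0.
Qed.

Lemma total_mapP : bhom f g -> @mhom _ _ r s H.
Proof.
move=> fg; apply: mhomP => [a|a b ab|a].
- rewrite (tot_E tV) (tot_E tW) mulmxDl mulmxDr -!mulmxA tot_it_map tot_ir_map.
  by rewrite !mulmxA tot_map_pt tot_map_pr.
- rewrite (tot_X tV) // (tot_X tW) // -!mulmxA tot_ir_map !mulmxA tot_map_pt.
  by rewrite -!mulmxA (mulmxA (barr V a b)) fg // -!mulmxA.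
- by rewrite (tot_Z tV) (tot_Z tW) mul0mx mulmx0.
Qed.

Variable h : 'M[F]_(mdim r, mdim s).
Hypothesis hh : @mhom _ _ r s h.

Lemma total_restr_hom : @bhom F Gamma V W (fun a => it a *m h *m pt' a) (fun a => ir a *m h *m pr' a).
Proof.
move=> a b ab; have X1 : barr V a b *m ir b = it a *m rX r a b.
  by rewrite (tot_X tV) // !mulmxA (tot_tt tV) mul1mx.
have X2 : pt' a *m barr W a b = rX s a b *m pr' b.
  by rewrite (tot_X tW) // -!mulmxA (tot_rr tW) mulmx1.
by rewrite -[RHS]mulmxA X2 !mulmxA X1 -(mulmxA (it a)) hh !mulmxA.
Qed.

(** A homomorphism maps the radical into the radical. *)
Lemma total_hom_rt : bsurj V -> forall a, ir a *m h *m pt' a = 0.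
Proof.
move=> surj a; apply: surj => b ba.
have X1 : barr V b a *m ir a = it b *m rX r b a.
  by rewrite (tot_X tV) // !mulmxA (tot_tt tV) mul1mx.
rewrite !mulmxA X1 -(mulmxA (it b)) hh -!mulmxA -[mact s _]/(rX s b a) (tot_X tW) //.
by rewrite -!mulmxA (tot_rt tW) !mulmx0.
Qed.

End TotalMap.

Arguments tot_it_map {r s V W it pt ir pr it' ir'} tV f g a.
Arguments tot_ir_map {r s V W it pt ir pr it' ir'} tV f g a.
Arguments tot_map_pt {r s V W pt pr it' pt' ir' pr'} tW f g a.
Arguments tot_map_pr {r s V W pt pr it' pt' ir' pr'} tW f g a.

Lemma sum_total_E r V it pt ir pr : @is_total r V it pt ir pr ->
  \sum_a (pt a *m it a + pr a *m ir a) = 1%:M.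
Proof. by move=> tV; rewrite -(sum_rE r); apply: eq_bigr => a _; rewrite (tot_E tV). Qed.

Section TotalIndec.
Variables (r : mrep A) (V : brep F Gamma).
Variables (it : forall a, 'M[F]_(dtop V a, mdim r)) (pt : forall a, 'M[F]_(mdim r, dtop V a)).
Variables (ir : forall a, 'M[F]_(drad V a, mdim r)) (pr : forall a, 'M[F]_(mdim r, drad V a)).
Hypothesis tV : is_total it pt ir pr.

Lemma total_map_inj f g f' g' : total_map it ir pt pr f g = total_map it ir pt pr f' g' ->
  (forall a, f a = f' a) /\ (forall a, g a = g' a).
Proof.
move=> E; split=> a.
  have := congr1 (fun H => it a *m H *m pt a) E.
  by rewrite !(tot_it_map tV) -!mulmxA (tot_tt tV) !mulmx1.
have := congr1 (fun H => ir a *m H *m pr a) E.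
by rewrite !(tot_ir_map tV) -!mulmxA (tot_rr tV) !mulmx1.
Qed.

Lemma total_map1 : total_map it ir pt pr (fun=> 1%:M) (fun=> 1%:M) = 1%:M.
Proof. by rewrite -(sum_total_E tV); apply: eq_bigr => a _; rewrite !mulmx1. Qed.

Lemma total_map0 : total_map it ir pt pr (fun=> 0) (fun=> 0) = 0.
Proof. by rewrite /total_map big1 // => a _; rewrite !mulmx0 !mul0mx addr0. Qed.

Lemma mindec_total_bindec : mindec r -> bindec V.
Proof.
case=> r0 idem; split.
  apply: contrapT => h; have tr0 a : dtop V a = 0%N /\ drad V a = 0%N.
    case E : (dtop V a + drad V a)%N => [|n]; last by case: h; exists a; rewrite E.
    by move/eqP: E; rewrite addn_eq0 => /andP[/eqP -> /eqP ->].
  have : (1%:M : 'M[F]_(mdim r)) = 0.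
    rewrite -(sum_total_E tV) big1 // => a _; have [t0 s0] := tr0 a.
    by rewrite (mx_row0_eq (it a) 0 t0) (mx_row0_eq (ir a) 0 s0) !mulmx0 addr0.
  by move/mx1_eq0_dim => E; move: r0; rewrite E.
move=> f g fg ff gg; case: (idem (total_map it ir pt pr f g)).
- exact: (total_mapP tV tV fg).
- rewrite {1}/total_map mulmx_suml; apply: eq_bigr => a _.
  rewrite mulmxDl -!(mulmxA _ _ (total_map _ _ _ _ _ _)) (tot_it_map tV) (tot_ir_map tV).
  by rewrite -!mulmxA (mulmxA (f a)) (mulmxA (g a)) ff gg !mulmxA.
- by rewrite -total_map0 => /total_map_inj; left.
- by rewrite -total_map1 => /total_map_inj; right.
Qed.

(** Taking diagonal blocks is multiplicative on endomorphisms, because the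
    blocks from radical to top vanish, and an idempotent whose diagonal blocks
    vanish has square zero, so it vanishes. *)
Lemma bindec_total_mindec : bsurj V -> bindec V -> mindec r.
Proof.
move=> surj [[a a0] idem]; split.
  rewrite lt0n; apply/eqP => r0; have nul n m (B : 'M[F]_(n, mdim r)) (C : 'M[F]_(mdim r, m)) : B *m C = 0.
    by apply/matrixP => i j; rewrite !mxE big1 // => k; have := ltn_ord k; rewrite {2}r0.
  have := mx1_eq0_dim (etrans (esym (tot_tt tV a)) (nul _ _ _ _)).
  have := mx1_eq0_dim (etrans (esym (tot_rr tV a)) (nul _ _ _ _)).
  by move: a0 => /[swap] -> /[swap] ->.
have key h : @mhom _ _ r r h -> h *m h = h ->
    (forall a, it a *m h *m pt a = 0) -> (forall a, ir a *m h *m pr a = 0) -> h = 0.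
  move=> hh h2 t0 s0; have rt0 := total_hom_rt tV tV hh surj.
  have tr0 b : it b *m h *m pr b = 0.
    have h' : it b *m h = it b *m h *m rE r b.
      by rewrite -mulmxA -[rE r b]/(mact r _) -hh mulmxA -[mact r _]/(rE r b) (tot_itE tV) eqxx.
    rewrite -h2 mulmxA h' (tot_E tV) !mulmxDr mulmxDl !mulmxA t0 !mul0mx add0r.
    by rewrite -!mulmxA !(mulmxA (ir b)) s0 !mulmx0.
  rewrite -[h]mul1mx -(sum_rE r) mulmx_suml big1 // => b _.
  have EE : rE r b = rE r b *m rE r b by rewrite rEE eqxx.
  rewrite EE -mulmxA [rE r b *m h]hh -[mact r _]/(rE r b) !(tot_E tV).
  have -> : (pt b *m it b + pr b *m ir b) *m (h *m (pt b *m it b + pr b *m ir b)) =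
      pt b *m (it b *m h *m pt b) *m it b + pt b *m (it b *m h *m pr b) *m ir b +
      pr b *m (ir b *m h *m pt b) *m it b + pr b *m (ir b *m h *m pr b) *m ir b.
    by rewrite mulmxA !mulmxDl !mulmxDr !mulmxA !addrA.
  by rewrite t0 s0 rt0 tr0 !mulmx0 !mul0mx !addr0.
move=> h hh h2; have rt0 := total_hom_rt tV tV hh surj.
have mid n n' (B : 'M_(n, mdim r)) (C : 'M_(mdim r, n')) b : B *m rE r b = B ->
    B *m h *m h *m C = B *m h *m pt b *m (it b *m h *m C) + B *m h *m pr b *m (ir b *m h *m C).
  move=> BE; have h' : B *m h = B *m h *m rE r b.
    by rewrite -mulmxA -[rE r b]/(mact r _) -hh mulmxA -[mact r _]/(rE r b) BE.
  by rewrite {1}h' (tot_E tV) !mulmxDr !mulmxDl !mulmxA.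
have itE b : it b *m rE r b = it b by rewrite (tot_itE tV) eqxx.
have irE b : ir b *m rE r b = ir b by rewrite (tot_irE tV) eqxx.
have h2' n (B : 'M_(n, mdim r)) : B *m h *m h = B *m h by rewrite -mulmxA h2.
case: (idem _ _ (total_restr_hom tV tV hh)) => [b|b|[f0 g0]|[f1 g1]].
- by have := mid _ _ (it b) (pt b) b (itE b); rewrite h2' rt0 mulmx0 addr0 => <-.
- by have := mid _ _ (ir b) (pr b) b (irE b); rewrite h2' rt0 mul0mx add0r => <-.
- by left; apply: key.
- right; apply/eqP; rewrite eq_sym -subr_eq0; apply/eqP; apply: key.
  + by move=> u; rewrite mulmxBl mulmxBr mulmx1 mul1mx hh.
  + by rewrite mulmxBl mul1mx mulmxBr mulmx1 h2 subrr subr0.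
  + by move=> b; rewrite mulmxBr mulmx1 mulmxBl (tot_tt tV) f1 subrr.
  + by move=> b; rewrite mulmxBr mulmx1 mulmxBl (tot_rr tV) g1 subrr.
Qed.

End TotalIndec.

Lemma biso_total r s V W it pt ir pr it' pt' ir' pr' :
  @is_total r V it pt ir pr -> @is_total s W it' pt' ir' pr' -> biso V W -> miso r s.
Proof.
move=> tV tW [f [g [f' [g' [fg fg' ff gg]]]]].
exists (total_map it' ir' pt pr f g), (total_map it ir pt' pr' f' g').
split; [exact: (total_mapP tV tW fg)|exact: (total_mapP tW tV fg')|..].
  rewrite -(sum_total_E tV) {1}/total_map mulmx_suml; apply: eq_bigr => a _.
  rewrite mulmxDl -!(mulmxA _ _ (total_map _ _ _ _ _ _)) (tot_it_map tW) (tot_ir_map tW).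
  have [ffa _] := ff a; have [gga _] := gg a.
  by rewrite -!mulmxA (mulmxA (f a)) (mulmxA (g a)) ffa gga !mul1mx.
rewrite -(sum_total_E tW) {1}/total_map mulmx_suml; apply: eq_bigr => a _.
rewrite mulmxDl -!(mulmxA _ _ (total_map _ _ _ _ _ _)) (tot_it_map tV) (tot_ir_map tV).
have [_ ffa] := ff a; have [_ gga] := gg a.
by rewrite -!mulmxA (mulmxA (f' a)) (mulmxA (g' a)) ffa gga !mul1mx.
Qed.

Lemma total_biso r s V W it pt ir pr it' pt' ir' pr' :
  @is_total r V it pt ir pr -> @is_total s W it' pt' ir' pr' -> bsurj V -> bsurj W ->
  miso r s -> biso V W.
Proof.
move=> tV tW sV sW [h [h' [hh hh' hh1 hh2]]].
exists (fun a => it a *m h *m pt' a), (fun a => ir a *m h *m pr' a).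
exists (fun a => it' a *m h' *m pt a), (fun a => ir' a *m h' *m pr a).
have comp r1 s1 V1 W1 it1 pt1 ir1 pr1 it2 pt2 ir2 pr2 k k' :
    @is_total r1 V1 it1 pt1 ir1 pr1 -> @is_total s1 W1 it2 pt2 ir2 pr2 ->
    bsurj V1 -> bsurj W1 -> @mhom _ _ r1 s1 k -> @mhom _ _ s1 r1 k' -> k *m k' = 1%:M ->
    forall a, it1 a *m k *m pt2 a *m (it2 a *m k' *m pt1 a) = 1%:M /\
      ir1 a *m k *m pr2 a *m (ir2 a *m k' *m pr1 a) = 1%:M.
  move=> t1 t2 s1' s2' hk hk' kk a.
  have rt := total_hom_rt t1 t2 hk s1'; have rt' := total_hom_rt t2 t1 hk' s2'.
  have itk : it1 a *m k = it1 a *m k *m rE s1 a.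
    by rewrite -mulmxA -[rE s1 a]/(mact s1 _) -hk mulmxA -[mact r1 _]/(rE r1 a) (tot_itE t1) eqxx.
  have irk : ir1 a *m k = ir1 a *m k *m rE s1 a.
    by rewrite -mulmxA -[rE s1 a]/(mact s1 _) -hk mulmxA -[mact r1 _]/(rE r1 a) (tot_irE t1) eqxx.
  have e1 : it1 a *m k *m k' *m pt1 a = 1%:M by rewrite -(mulmxA (it1 a)) kk mulmx1 (tot_tt t1).
  have e2 : ir1 a *m k *m k' *m pr1 a = 1%:M by rewrite -(mulmxA (ir1 a)) kk mulmx1 (tot_rr t1).
  split.
    rewrite -e1 [in RHS]itk (tot_E t2) [in RHS]mulmxDr ![in RHS]mulmxDl -!mulmxA.
    by rewrite (mulmxA (ir2 a)) rt' !mulmx0 addr0.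
  rewrite -e2 [in RHS]irk (tot_E t2) [in RHS]mulmxDr ![in RHS]mulmxDl !mulmxA.
  by rewrite rt !mul0mx add0r.
have c1 := comp _ _ _ _ _ _ _ _ _ _ _ _ _ _ tV tW sV sW hh hh' hh1.
have c2 := comp _ _ _ _ _ _ _ _ _ _ _ _ _ _ tW tV sW sV hh' hh hh2.
split; [exact: (total_restr_hom tV tW hh)|exact: (total_restr_hom tW tV hh')|..] => a.
  by split; [case: (c1 a) | case: (c2 a)].
by split; [case: (c1 a) | case: (c2 a)].
Qed.

Lemma total_exists V : exists r it pt ir pr, @is_total r V it pt ir pr.
Proof.
pose dim (j : Gamma + Gamma) := match j with inl a => dtop V a | inr a => drad V a end.
have [N [i [p [_ ip1 ip0 pi1]]]] := biproduct_exists F xpredT dim.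
pose it a : 'M[F]_(dtop V a, N) := i (inl a). pose ir a : 'M[F]_(drad V a, N) := i (inr a).
pose pt a : 'M[F]_(N, dtop V a) := p (inl a). pose pr a : 'M[F]_(N, drad V a) := p (inr a).
have tt a : it a *m pt a = 1%:M by exact: (ip1 (inl a)).
have rr a : ir a *m pr a = 1%:M by exact: (ip1 (inr a)).
have tr a b : it a *m pr b = 0 by exact: (ip0 (inl a) (inr b)).
have rt a b : ir a *m pt b = 0 by exact: (ip0 (inr a) (inl b)).
have tt0 a b : a != b -> it a *m pt b = 0 by move=> ab; exact: (ip0 (inl a) (inl b)).
have rr0 a b : a != b -> ir a *m pr b = 0 by move=> ab; exact: (ip0 (inr a) (inr b)).
pose E a := pt a *m it a + pr a *m ir a.
pose X a b := pt a *m barr V a b *m ir b.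
have itE a b : it a *m E b = if a == b then it a else 0.
  rewrite mulmxDr !mulmxA tr mul0mx addr0; have [->|ab] := eqVneq a b.
    by rewrite tt mul1mx.
  by rewrite tt0 ?mul0mx.
have irE a b : ir a *m E b = if a == b then ir a else 0.
  rewrite mulmxDr !mulmxA rt mul0mx add0r; have [->|ab] := eqVneq a b.
    by rewrite rr mul1mx.
  by rewrite rr0 ?mul0mx.
have Ept a : E a *m pt a = pt a by rewrite mulmxDl -!mulmxA tt rt mulmx1 mulmx0 addr0.
have zzf : zigzag_family mulmx 1%:M E X (fun=> 0).
  split=> [|a b|a b _|a b _|a|a|a b c _ _|a b _|a b _|a]; rewrite ?mulmx0 ?mul0mx //.
  - by rewrite big_split /= -pi1 big_sumType.
  - rewrite {1}/E mulmxDl -!mulmxA itE irE.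
    by case: eqP => [->|]; rewrite ?mulmx0 ?addr0.
  - by rewrite /X !mulmxA Ept.
  - by rewrite /X -!mulmxA irE eqxx.
  - by rewrite if_same /X !mulmxA -(mulmxA _ (ir b)) rt mulmx0 !mul0mx.
have [rho [rl r1 rM [rhoE rhoX rhoZ]]] := zp_univ zz zzf.
exists (MRep rl r1 rM), it, pt, ir, pr; split; [exact: tt | exact: rr |
  move=> a; exact: tr | move=> a; exact: rt | exact: rhoE | exact: rhoX | exact: rhoZ].
Qed.

(** The radical at [a] is the sum of the images of the arrows into [a], and the
    top is any complement of it in the image of the idempotent. The products of
    two arrows vanish, so arrows factor through the projections to the tops. *)
Lemma total_decomp r : (forall a, rZ r a = 0) ->
  exists V it pt ir pr, @is_total r V it pt ir pr /\ bsurj V.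
Proof.
move=> Z0; pose N := mdim r.
pose Q a : 'M[F]_N := (\sum_(b | adj b a) <<rX r b a>>)%MS.
have XQ a b : adj b a -> (rX r b a <= Q a)%MS.
  by move=> ba; apply: (sumsmx_sup b) => //; rewrite genmxE.
have QP a n (C : 'M_(N, n)) : (forall b, adj b a -> rX r b a *m C = 0) -> Q a *m C = 0.
  move=> h; apply/sub_kermxP/sumsmx_subP => b ba; rewrite genmxE; apply/sub_kermxP; exact: h.
have QE a : (Q a <= rE r a)%MS.
  apply/sumsmx_subP => b ba; rewrite genmxE.
  by rewrite -[rX r b a](_ : rX r b a *m rE r a = _) ?submxMl // rXE // eqxx.
have Eid n a (B : 'M_(n, N)) : (B <= rE r a)%MS -> B *m rE r a = B.
  by case/submxP=> D ->; rewrite -mulmxA rEE eqxx.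
pose T a : 'M[F]_N := (rE r a :\: Q a)%MS.
pose it a := row_base (T a); pose ir a := row_base (Q a).
pose S a := col_mx (it a) (ir a).
have ETQ a : (rE r a <= T a + Q a)%MS.
  by rewrite -(addsmx_diff_cap_eq (rE r a) (Q a)) addsmxS ?capmxSr.
have SE a : (S a <= rE r a)%MS by rewrite col_mx_sub !eq_row_base diffmxSl QE.
have ES a : (rE r a <= S a)%MS.
  by apply: submx_trans (ETQ a) _; rewrite -addsmxE addsmxS ?eq_row_base.
have Sfree a : row_free (S a).
  rewrite /row_free -addsmxE (adds_eqmx (eq_row_base _) (eq_row_base _)).
  by rewrite mxrank_disjoint_sum ?capmx_diff.
pose P a := rE r a *m pinvmx (S a).
pose pt a := lsubmx (P a); pose pr a := rsubmx (P a).
have PE a : P a = row_mx (pt a) (pr a) by rewrite hsubmxK.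
have : forall a, S a *m P a = 1%:M by move=> a; rewrite mulmxA Eid // mulmxVp.
have : forall a, P a *m S a = rE r a by move=> a; rewrite mulmxKpV.
move=> PS SP.
have blocks a : [/\ it a *m pt a = 1%:M, it a *m pr a = 0, ir a *m pt a = 0 & ir a *m pr a = 1%:M].
  by apply: eq_block_mx; rewrite -mul_col_row -PE -scalar_mx_block SP.
have tE a : rE r a = pt a *m it a + pr a *m ir a by rewrite -mul_row_col -PE PS.
have irQ a : (ir a <= Q a)%MS by rewrite eq_row_base.
have Qir a : (Q a <= ir a)%MS by rewrite eq_row_base.
clearbody pt pr; clear P PE PS SP S SE ES Sfree; clearbody it ir.
have irX a b : adj a b -> ir a *m rX r a b = 0.
  move=> ab; have /submxP[D ->] := irQ a.
  rewrite -mulmxA QP ?mulmx0 // => c ca.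
  by rewrite rXX // Z0 if_same.
have Xpt a b : adj a b -> rX r a b *m pt b = 0.
  move=> ab; have /submxP[D ->] : (rX r a b <= ir b)%MS.
    by apply: submx_trans (XQ _ _ ab) (Qir b).
  by rewrite -mulmxA; case: (blocks b) => _ _ -> _; rewrite mulmx0.
pose V := @BRep F Gamma (fun a => \rank (T a)) (fun a => \rank (Q a))
  (fun a b => it a *m rX r a b *m pr b).
have XE a b : adj a b -> rX r a b = pt a *m barr V a b *m ir b.
  move=> ab; have {1}-> : rX r a b = rE r a *m rX r a b *m rE r b.
    by rewrite rEX // eqxx rXE // eqxx.
  rewrite !tE mulmxDl -(mulmxA (pr a)) irX // mulmx0 addr0 mulmxDr !mulmxA.
  by rewrite -(mulmxA (pt a *m it a) (rX r a b) (pt b)) Xpt // mulmx0 mul0mx add0r.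
exists V, it, pt, ir, pr; split.
  by split=> // a; case: (blocks a).
have irpr b : ir b *m pr b = 1%:M by case: (blocks b).
move=> b n u u0; rewrite -[u]mul1mx -irpr.
have /submxP[D ->] := irQ b.
rewrite -!mulmxA QP ?mulmx0 // => a ab.
by rewrite mulmxA XE // -(mulmxA _ (ir b)) irpr mulmx1 -mulmxA u0 ?mulmx0.
Qed.

Implicit Types V W : brep F Gamma.

(** * The correspondence with roots *)

Lemma biso_dims V W : biso V W -> dtop V =1 dtop W /\ drad V =1 drad W.
Proof.
have sq n m (B : 'M[F]_(n, m)) C : B *m C = 1%:M -> (n <= m)%N.
  move=> /(congr1 (@mxrank _ _ _)); rewrite mxrank1 => <-.
  exact: leq_trans (mxrankM_maxl _ _) (rank_leq_col _).
case=> f [g [f' [g' [_ _ ff gg]]]]; split=> a.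
  by have [/sq h /sq h'] := ff a; apply/eqP; rewrite eqn_leq h h'.
by have [/sq h /sq h'] := gg a; apply/eqP; rewrite eqn_leq h h'.
Qed.

Variables (w : Gamma -> int) (eps : Gamma -> bool).
Hypotheses (w_gt0 : forall a, (0 < w a)%R) (w_nbr : forall a, (nbr_sum w a < 2 * w a)%R).
Hypothesis eps_adj : forall a b : Gamma, adj a b -> eps a != eps b.

Definition root_pos (v : Gamma -> int) := [forall a, (0 <= v a)%R].

(** A positive root is read off from its values on the two colour classes, the
    first one giving the top and the second one the radical; for a negative
    root the roles of the two classes are exchanged. *)
Definition top_dim (v : Gamma -> int) a : nat := if eps a == root_pos v then absz (v a) else 0.
Definition rad_dim (v : Gamma -> int) a : nat := if eps a == root_pos v then 0 else absz (v a).

Definition signed (v : Gamma -> int) := root_pos v \/ forall a, (v a <= 0)%R.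

Lemma tits_root_dims v : signed v ->
  tits (natz_vec (top_dim v)) (natz_vec (rad_dim v)) = root_form eps v.
Proof.
move=> sv; have [pv|nv] := boolP (root_pos v).
  apply: eq_tits => a; rewrite /natz_vec /top_dim /rad_dim /color_part pv;
    have := forallP pv a; case: (eps a) => //=; lia.
have {sv} neg a : (v a <= 0)%R by case: sv nv => [->|].
rewrite /root_form titsC -[RHS]titsN; apply: eq_tits => a;
  rewrite /natz_vec /top_dim /rad_dim /color_part (negbTE nv);
  have := neg a; case: (eps a) => //=; lia.
Qed.

Lemma root_signed (v : root_lattice Gamma) : is_root v -> signed v.
Proof.
move=> /(is_root_form eps_adj)/(root_sign w_gt0 w_nbr)[p|n]; [left | by right].
exact/forallP.
Qed.

Lemma root_dims_inj (u v : root_lattice Gamma) : is_root u -> is_root v ->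
  top_dim u =1 top_dim v -> rad_dim u =1 rad_dim v -> u = v.
Proof.
move=> ru rv tE rE'; have su := root_signed ru; have sv := root_signed rv.
have absE a : absz (u a) = absz (v a).
  have := tE a; have := rE' a; rewrite /top_dim /rad_dim.
  by case: (eps a); case: (root_pos u); case: (root_pos v) => /=; lia.
have [puv|puv] := eqVneq (root_pos u) (root_pos v).
  apply/ffunP => a; have := absE a; case: su => [pu|nu].
    have := forallP pu a; move: pu; rewrite puv => /forallP/(_ a); lia.
  case: sv => [pv|nv]; last by have := nu a; have := nv a; lia.
  have := forallP pv a; move: pv; rewrite -puv => /forallP/(_ a); lia.
have u0 a : u a = 0.
  have := tE a; have := rE' a; have := absE a; rewrite /top_dim /rad_dim; move: puv.
  by case: (eps a); case: (root_pos u); case: (root_pos v) => //= _; lia.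
have := is_root_form eps_adj ru.
rewrite -(tits_root_dims su) (@eq_tits _ _ (fun=> 0) _ (fun=> 0)) ?tits0 // => a;
  by rewrite /natz_vec /top_dim /rad_dim u0 if_same.
Qed.

(** The root whose dimensions are those of the simple bipartite representation
    with zero top at [a]; these are the roots left for the projectives. *)
Lemma bsimple_root a : exists v : root_lattice Gamma,
  [/\ is_root v, top_dim v =1 (fun=> 0%N) & rad_dim v =1 (fun b => (b == a) : nat)].
Proof.
case ea: (eps a).
  exists (- simple_root a); have np : root_pos (- simple_root a) = false.
    by apply/negbTE/forallPn; exists a; rewrite !ffunE eqxx.
  split; first by apply: is_rootN; exact: is_root_simple.
    by move=> b; rewrite /top_dim np !ffunE; have [->|] := eqVneq b a; rewrite ?ea ?if_same.
  by move=> b; rewrite /rad_dim np !ffunE; have [->|] := eqVneq b a; rewrite ?ea ?if_same.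
exists (simple_root a); have np : root_pos (simple_root a).
  by apply/forallP => b; rewrite ffunE; case: eqP.
split; first exact: is_root_simple.
  by move=> b; rewrite /top_dim np !ffunE; have [->|] := eqVneq b a; rewrite ?ea ?if_same.
by move=> b; rewrite /rad_dim np !ffunE; have [->|] := eqVneq b a; rewrite ?ea ?if_same.
Qed.

(** Edges change colour, so the tops of one colour together with the radicals of
    the other colour form a direct summand of [V]; hence [V] lives on one of
    the two components of the double cover. *)
Lemma bindec_root V : bindec V -> exists v : root_lattice Gamma,
  [/\ is_root v, top_dim v =1 dtop V & rad_dim v =1 drad V].
Proof.
move=> iV; have [nz idem] := iV.
have := bindec_tits w_gt0 w_nbr iV.
have fin (v : root_lattice Gamma) : signed v -> top_dim v =1 dtop V -> rad_dim v =1 drad V ->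
    tits (natz_vec (dtop V)) (natz_vec (drad V)) = 1 -> exists v : root_lattice Gamma,
    [/\ is_root v, top_dim v =1 dtop V & rad_dim v =1 drad V].
  move=> sv tE rE' E1; exists v; split=> //; apply: (form_is_root w_gt0 w_nbr eps_adj).
  rewrite -(tits_root_dims sv) -E1; apply: eq_tits => a; rewrite /natz_vec ?tE ?rE' //.
have [|a|b|[f0 g0]|[f1 g1]] := idem (fun a => (eps a)%:R%:M) (fun b => (~~ eps b)%:R%:M).
- move=> a b /eps_adj ab; rewrite mul_mx_scalar mul_scalar_mx.
  by move: ab; case: (eps a); case: (eps b).
- by rewrite -scalar_mxM -natrM mulnb andbb.
- by rewrite -scalar_mxM -natrM mulnb andbb.
- have t0 a : eps a -> dtop V a = 0%N.
    by move=> ea; have := f0 a; rewrite ea => /mx1_eq0_dim.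
  have s0 a : ~~ eps a -> drad V a = 0%N.
    by move=> ea; have := g0 a; rewrite ea => /mx1_eq0_dim.
  pose v : root_lattice Gamma := [ffun a => - (dtop V a + drad V a)%N%:Z].
  have np : root_pos v = false.
    by apply/negbTE/forallPn; have [a a0] := nz; exists a; rewrite ffunE; lia.
  apply: (fin v).
  + by right=> a; rewrite ffunE; lia.
  + move=> a; rewrite /top_dim np ffunE.
    by have := t0 a; have := s0 a; case: (eps a) => /= h h'; [rewrite h' | rewrite h]; lia.
  + move=> a; rewrite /rad_dim np ffunE.
    by have := t0 a; have := s0 a; case: (eps a) => /= h h'; [rewrite h' | rewrite h]; lia.
- have t0 a : ~~ eps a -> dtop V a = 0%N.
    move=> ea; have := f1 a; rewrite (negbTE ea) raddf0 => /esym; exact: mx1_eq0_dim.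
  have s0 a : eps a -> drad V a = 0%N.
    move=> ea; have := g1 a; rewrite ea raddf0 => /esym; exact: mx1_eq0_dim.
  pose v : root_lattice Gamma := [ffun a => (dtop V a + drad V a)%N%:Z].
  have np : root_pos v by apply/forallP => a; rewrite ffunE.
  apply: (fin v).
  + by left.
  + move=> a; rewrite /top_dim np ffunE.
    by have := t0 a; have := s0 a; case: (eps a) => /= h h'; [rewrite h | rewrite h']; lia.
  + move=> a; rewrite /rad_dim np ffunE.
    by have := t0 a; have := s0 a; case: (eps a) => /= h h'; [rewrite h | rewrite h']; lia.
Qed.

(** A root with the dimensions of [bsimple a] asks for a nonzero radical under a
    zero top. It is given the projective module at [a] instead, and every other
    root the module of a bipartite representation. *)
Definition root_module (v : root_lattice Gamma) r : Prop := mindec r /\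
  ((exists a, [/\ top_dim v =1 (fun=> 0%N), rad_dim v =1 (fun b => (b == a) : nat) & rZ r a != 0])
   \/ exists V it pt ir pr, [/\ @is_total r V it pt ir pr, bsurj V, bindec V,
        dtop V =1 top_dim v & drad V =1 rad_dim v]).

Lemma bsurj_not_simple V a : bsurj V -> dtop V =1 (fun=> 0%N) -> drad V a = 1%N -> False.
Proof.
move=> surj t0 ra; have := surj a _ 1%:M => /(_ _) h.
have /mx1_eq0_dim : (1%:M : 'M[F]_(drad V a)) = 0.
  by apply: h => b _; apply: mx_row0_eq.
by rewrite ra.
Qed.

Lemma root_module_exists v : is_root v -> exists r, root_module v r.
Proof.
move=> rv; have E1 : tits (natz_vec (top_dim v)) (natz_vec (rad_dim v)) = 1.
  by rewrite tits_root_dims ?(is_root_form eps_adj) //; exact: root_signed.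
have [phi iV] := bindec_exists F w_gt0 w_nbr E1.
have [surj|[a [t0 r1]]] := bindec_surj iV; last first.
  by have [r ir Z] := proj_exists a; exists r; split=> //; left; exists a.
have [r [it [pt [ir [pr tV]]]]] := total_exists (BRep phi).
exists r; split; first exact: (bindec_total_mindec tV).
by right; exists (BRep phi), it, pt, ir, pr.
Qed.

Lemma root_module_inj u v r s : is_root u -> is_root v ->
  root_module u r -> root_module v s -> miso r s -> u = v.
Proof.
move=> ru rv [ir Pu] [is' Pv] rs; apply: root_dims_inj => //.
- case: Pu Pv => [[a [t0 r1 Z]]|[V [it [pt [i [pr [tV sV iV tE rE']]]]]]].
    case=> [[b [t0' r1' Z']]|[W [it' [pt' [i' [pr' [tW sW iW tE' rE'']]]]]]].
      by move=> c; rewrite t0 t0'.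
    by have := miso_loop rs Z; rewrite (tot_Z tW) eqxx.
  case=> [[b [t0' r1' Z']]|[W [it' [pt' [i' [pr' [tW sW iW tE' rE'']]]]]]].
    by have := miso_loop (miso_sym rs) Z'; rewrite (tot_Z tV) eqxx.
  have [dt dr] := biso_dims (total_biso tV tW sV sW rs).
  by move=> c; rewrite -tE dt tE'.
- case: Pu Pv => [[a [t0 r1 Z]]|[V [it [pt [i [pr [tV sV iV tE rE']]]]]]].
    case=> [[b [t0' r1' Z']]|[W [it' [pt' [i' [pr' [tW sW iW tE' rE'']]]]]]].
      by move=> c; rewrite r1 r1' (proj_loop_uniq is' (miso_loop rs Z) Z').
    by have := miso_loop rs Z; rewrite (tot_Z tW) eqxx.
  case=> [[b [t0' r1' Z']]|[W [it' [pt' [i' [pr' [tW sW iW tE' rE'']]]]]]].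
    by have := miso_loop (miso_sym rs) Z'; rewrite (tot_Z tV) eqxx.
  have [dt dr] := biso_dims (total_biso tV tW sV sW rs).
  by move=> c; rewrite -rE' dr rE''.
Qed.

Lemma root_module_surj r : mindec r ->
  exists2 v, is_root v & forall s, root_module v s -> miso r s.
Proof.
move=> ir; have [[a Za]|Z0] := pselect (exists a, rZ r a != 0).
  have [v [rv t0 r1]] := bsimple_root a; exists v => // s [is'].
  case=> [[b [_ r1' Zb]]|[V [it [pt [i [pr [tV sV iV tE rE']]]]]]].
    have := r1 a; rewrite eqxx r1'; case: eqP => // ab _; rewrite -ab in Zb.
    exact: proj_uniq ir is' Za Zb.
  case: (@bsurj_not_simple V a) => // [b|]; first by rewrite tE t0.
  by rewrite rE' r1 eqxx.
have {}Z0 a : rZ r a = 0 by apply/eqP/negPn/negP => ?; apply: Z0; exists a.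
have [V [it [pt [i [pr [tV sV]]]]]] := total_decomp Z0.
have iV := mindec_total_bindec tV ir.
have [v [rv tE rE']] := bindec_root iV; exists v => // s [is'].
case=> [[b [t0' r1' Zb]]|[W [it' [pt' [i' [pr' [tW sW iW tE' rE'']]]]]]].
  case: (@bsurj_not_simple V b) => // [c|]; first by rewrite -tE t0'.
  by rewrite -rE' r1' eqxx.
apply: (biso_total tV tW); apply: (bindec_uniq w_gt0 w_nbr iV iW) => c.
  by rewrite -tE tE'.
by rewrite -rE' rE''.
Qed.

Theorem presented_roots_modules : exists M : root_lattice Gamma -> lmodType A,
  [/\ forall v, is_root v -> fin_dim (M v) /\ indecomposable (M v),
      forall u v, is_root u -> is_root v -> rep_iso (M u) (M v) -> u = v
    & forall V : lmodType A, fin_dim V -> indecomposable V ->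
        exists2 v, is_root v & rep_iso V (M v)].
Proof.
have /choice[m mP] v : exists r, is_root v -> root_module v r.
  have [/root_module_exists[r]|nr] := pselect (is_root v); first by exists r.
  by have [r _] := total_exists (bsimple F (base_vertex Gamma)); exists r.
exists (fun v => mrep_mod (m v)); split.
- move=> v /mP[iv _]; split; first exact: fin_dim_mrep.
  by apply/indecomposable_mindec.
- by move=> u v ru rv /miso_rep_iso; apply: root_module_inj; [| |exact: mP|exact: mP].
- move=> V /fin_dim_rep_iso[r Vr] iV.
  have /indecomposable_mindec ir := indecomposable_iso Vr iV.
  have [v rv vP] := root_module_surj ir; exists v => //.
  apply: rep_iso_trans Vr _; apply/miso_rep_iso; apply: vP; exact: mP.
Qed.

End Presentation.

(** * The zigzag algebra has the expected presentation *)

Section ZigzagPresentation.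
Variables (F : fieldType) (Gamma : sgraph).
Implicit Types a b : Gamma.

Section OneVertex.
Hypothesis one : #|Gamma| = 1%N.
Local Notation Q := ({poly %/ ('X^2 : {poly F})}).

Lemma one_vertex_eq a b : a = b.
Proof.
have /fintype_le1P h : (#|Gamma| <= 1)%N by rewrite one.
exact: h b a.
Qed.

Lemma one_vertex_nadj a b : adj a b = false.
Proof. by rewrite (one_vertex_eq a b) adj_irr. Qed.

Lemma one_vertex_sum (B : nmodType) (f : Gamma -> B) a : \sum_b f b = f a.
Proof. by rewrite (bigD1 a) //= big1 ?addr0 // => b; rewrite (one_vertex_eq b a) eqxx. Qed.

Local Notation iq := (in_qpoly ('X^2 : {poly F})).

Lemma dual_number_expand (u : Q) : u = ((u : {poly F})`_0)%:A + (u : {poly F})`_1 *: iq 'X.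
Proof.
have <- : iq 1 = 1 by exact: in_qpoly1.
rewrite -!in_qpolyZ -in_qpolyD; apply: val_inj => /=.
have su : (size (u : {poly F}) <= 2)%N.
  by rewrite -ltnS; apply: leq_trans (size_mk_monic u) _; rewrite mk_monic_Xn size_polyXn.
have uE : (u : {poly F}) = (u : {poly F})`_0 *: 1 + (u : {poly F})`_1 *: 'X.
  apply/polyP => i; rewrite coefD !coefZ coefC coefX.
  case: i => [|[|i]]; rewrite ?mulr1 ?mulr0 ?addr0 ?add0r //.
  by rewrite nth_default // (leq_trans su).
by rewrite -uE; exact: esym (in_qpoly_small (size_mk_monic u)).
Qed.

Lemma dual_number_sqr0 : iq 'X * iq 'X = 0.
Proof.
rewrite -in_qpolyM -expr2; apply: val_inj; rewrite /= mk_monic_Xn.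
exact: Pdiv.RingMonic.rmodpp (monicXn _ 2).
Qed.

Lemma one_vertex_presentation : exists e x z, @zigzag_presentation F Gamma Q e x z.
Proof.
have nadj := one_vertex_nadj.
exists (fun=> 1), (fun _ _ => 0), (fun=> iq 'X); split.
- split=> [|a b|a b|a b|a|a|a b c|a b|a b|a]; rewrite ?nadj // ?mul1r ?mulr1 //.
  + exact: (one_vertex_sum _ (base_vertex Gamma)).
  + by rewrite (one_vertex_eq a b) eqxx.
  + exact: dual_number_sqr0.
- move=> P Pe _ Pz Plin Pmul u; rewrite (dual_number_expand u) addrC.
  pose a := base_vertex Gamma.
  have P0 : P 0 by rewrite -(addNr 1) -scaleN1r; exact: Plin (Pe a) (Pe a).
  apply: (Plin _ _ _ (Pz a)); rewrite -[_%:A]addr0; exact: Plin (Pe a) P0.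
- move=> n E X Z zf; have := zz_sum zf; rewrite (one_vertex_sum _ (base_vertex Gamma)) => E1.
  pose z := Z (base_vertex Gamma).
  pose rho (u : Q) : 'M[F]_n := (u : {poly F})`_0 *: 1%:M + (u : {poly F})`_1 *: z.
  have rho_lin : linear rho.
    move=> c u v; rewrite /rho /= !coefD !coefZ !scalerDl !scalerDr !scalerA.
    by rewrite addrACA.
  have rhoD u v : rho (u + v) = rho u + rho v by have := rho_lin 1 u v; rewrite !scale1r.
  have rho0 : rho 0 = 0 by apply: (addrI (rho 0)); rewrite -rhoD !addr0.
  have rhoZ c u : rho (c *: u) = c *: rho u.
    by have := rho_lin c u 0; rewrite rho0 !addr0.
  have rho1 : rho 1 = 1%:M.
    by rewrite /rho /= coefC /= scale1r coefC /= scale0r addr0.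
  have rhoX : rho (iq 'X) = z.
    have -> : rho (iq 'X) = (('X : {poly F})`_0) *: 1%:M + (('X : {poly F})`_1) *: z.
      by rewrite /rho in_qpoly_small // mk_monic_Xn size_polyXn size_polyX.
    by rewrite !coefX scale0r scale1r add0r.
  exists rho; split=> //.
  + move=> u v; have zz0 : z *m z = 0 by exact: zz_zz zf _.
    have rhoE c d : rho (c%:A + d *: iq 'X) = c *: 1%:M + d *: z.
      by rewrite rhoD !rhoZ rho1 rhoX.
    rewrite (dual_number_expand u) (dual_number_expand v).
    move: ((u : {poly F})`_0) ((u : {poly F})`_1) ((v : {poly F})`_0) ((v : {poly F})`_1).
    move=> u0 u1 v0 v1; rewrite !rhoE.
    rewrite mulrDl !mulrDr -!scalerAl -!scalerAr mul1r mulr1 dual_number_sqr0 !scaler0 addr0.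
    rewrite !rhoD !rhoZ mul1r rho1 rhoX.
    by rewrite mulmxDl !mulmxDr -!scalemxAl -!scalemxAr mul1mx !mulmx1 mul1mx zz0 !scaler0 addr0.
  + split=> [a|a b|a]; rewrite ?nadj //.
      by rewrite (one_vertex_eq a (base_vertex Gamma)) E1.
    by rewrite (one_vertex_eq a (base_vertex Gamma)).
Qed.

End OneVertex.

Section PathQuotient.
Local Notation P := (path_algebra F Gamma).
Hypothesis has_nbr : forall a, exists b, adj a b.
Hypothesis has_nbr2 : #|Gamma| != 2 -> forall a b, adj a b ->
  (exists2 c, adj a c & c != b) \/ (exists2 c, adj b c & c != a).

Let proper := @zigzag_ideal_proper F Gamma.
Local Notation Q := (quot_alg proper).
Let pi : P -> Q := @quot_pi F _ _ proper.

Lemma pi_lin : linear pi.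
Proof. by move=> c f g; rewrite /pi quot_piD -quot_piZ. Qed.

Lemma pi1 : pi 1 = 1. Proof. by []. Qed.

Lemma piM f g : pi (f * g) = pi f * pi g.
Proof. exact: esym (quot_piM _ _ _). Qed.

Lemma pi_ideal f : zigzag_ideal_rel f -> pi f = 0.
Proof.
by move=> fI; rewrite -(quot_pi0 proper); apply/quot_piP; rewrite subr0; exact: ideal_gen.
Qed.

HB.instance Definition _ := GRing.isLinear.Build F P Q *:%R pi pi_lin.

Definition step_path a b (ab : adj a b) : dpath Gamma :=
  @DPath Gamma (a, [:: b]) (introT andP (conj ab isT)).

Definition arrow a b : P := if @idP (adj a b) is ReflectT ab then pathv F (step_path ab) else 0.

Lemma arrowE a b (ab : adj a b) : arrow a b = pathv F (step_path ab).
Proof.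
rewrite /arrow; case: {-}_ / idP => [ab'|//]; congr pathv; exact: val_inj.
Qed.

Lemma pathvM_cat (p q r : dpath Gamma) : path_tgt p = path_src q ->
  path_val r = (path_src p, path_steps p ++ path_steps q) ->
  pathv F p * pathv F q = pathv F r.
Proof.
move=> pq rE; rewrite pathvM /path_prod; have [r' -> r'E] := path_catP pq.
by congr pathv; apply: val_inj; rewrite /= rE r'E.
Qed.

Lemma arrowM a b c (ab : adj a b) (bc : adj b c) : arrow a b * arrow b c = pathv F (path2 ab bc).
Proof. by rewrite !arrowE; apply: pathvM_cat. Qed.

Definition vtx a : P := pathv F (triv_path a).

Lemma vtx_arrow a b : adj a b -> vtx a * arrow a b = arrow a b.
Proof. by move=> ab; rewrite arrowE pathvM path_prod_trivl eqxx. Qed.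

Lemma arrow_vtx a b : adj a b -> arrow a b * vtx b = arrow a b.
Proof. by move=> ab; rewrite arrowE pathvM path_prod_trivr eqxx. Qed.

Lemma vtxM a b : vtx a * vtx b = if a == b then vtx a else 0.
Proof. by rewrite pathvM path_prod_trivl; case: eqP => [->|]. Qed.

Section Walks.
Variables (n : nat) (E : Gamma -> 'M[F]_n) (X : Gamma -> Gamma -> 'M[F]_n) (Z : Gamma -> 'M[F]_n).
Hypothesis zf : zigzag_family mulmx 1%:M E X Z.

(** The base case is the idempotent of the last vertex, so that walks multiply
    like paths. *)
Fixpoint walk a (s : seq Gamma) : 'M[F]_n :=
  if s is b :: s' then X a b *m walk b s' else E a.

Lemma walk_src a s : path (@adj Gamma) a s -> E a *m walk a s = walk a s.
Proof.
case: s => [|b s] /=; first by rewrite (zz_ee zf) eqxx.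
by case/andP=> ab _; rewrite mulmxA (zz_ex zf).
Qed.

Lemma walk_tgt a s : walk a s *m E (last a s) = walk a s.
Proof.
elim: s a => [|b s IH] a /=; first by rewrite (zz_ee zf) eqxx.
by rewrite -mulmxA IH.
Qed.

Lemma walk_cat a s t : path (@adj Gamma) a (s ++ t) ->
  walk a (s ++ t) = walk a s *m walk (last a s) t.
Proof.
elim: s a => [|b s IH] a /=; first by move=> ?; rewrite walk_src.
by case/andP=> ab /IH ->; rewrite mulmxA.
Qed.

Definition path_mx (p : dpath Gamma) := walk (path_src p) (path_steps p).
Definition pa_rho : P -> 'M[F]_n := linext path_mx.
HB.instance Definition _ := GRing.Linear.on pa_rho.

Lemma pa_rho_pathv p : pa_rho (pathv F p) = path_mx p.
Proof. exact: linext_pathv. Qed.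

Lemma pa_rho_prod p q : pa_rho (path_prod F p q) = path_mx p *m path_mx q.
Proof.
rewrite /path_prod; case: path_catE => [r pq rE|pq] /=; last first.
  rewrite linear0 /path_mx -walk_tgt -(walk_src (path_valP q)) mulmxA -[_ *m _ *m E _]mulmxA.
  by rewrite (zz_ee zf) -/(path_tgt p) -/(path_src q); move/eqP/negbTE: pq => ->; rewrite mulmx0 mul0mx.
rewrite pa_rho_pathv /path_mx /path_src /path_steps rE /= walk_cat.
  by rewrite -[last _ _]/(path_tgt p) pq.
by have := path_valP r; rewrite rE.
Qed.

Lemma pa_rhoM f g : pa_rho (f * g) = pa_rho f *m pa_rho g.
Proof.
have L (u : P -> 'M[F]_n) (ul : linear u) : {v : {linear P -> 'M[F]_n} | v =1 u}.
  by exists (HB.pack u (GRing.isLinear.Build F P 'M[F]_n *:%R u ul) : {linear P -> 'M[F]_n}).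
have [u1 u1E] : {u : {linear P -> 'M[F]_n} | u =1 fun f => pa_rho (f * g)}.
  by apply: L => c x y; rewrite mulrDl -scalerAl linearP.
have [v1 v1E] : {u : {linear P -> 'M[F]_n} | u =1 fun f => pa_rho f *m pa_rho g}.
  by apply: L => c x y; rewrite linearP mulmxDl -scalemxAl.
rewrite -[LHS]u1E -[RHS]v1E; apply: pathv_ext => p; rewrite u1E v1E.
have [u2 u2E] : {u : {linear P -> 'M[F]_n} | u =1 fun g => pa_rho (pathv F p * g)}.
  by apply: L => c x y; rewrite mulrDr -scalerAr linearP.
have [v2 v2E] : {u : {linear P -> 'M[F]_n} | u =1 fun g => pa_rho (pathv F p) *m pa_rho g}.
  by apply: L => c x y; rewrite linearP mulmxDr -scalemxAr.
rewrite -[LHS]u2E -[RHS]v2E; apply: pathv_ext => q; rewrite u2E v2E.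
by rewrite pathvM pa_rho_prod !pa_rho_pathv.
Qed.

Lemma pa_rho1 : pa_rho 1 = 1%:M.
Proof.
rewrite -(zz_sum zf) linear_sum; apply: eq_bigr => a _.
exact: pa_rho_pathv.
Qed.

Lemma pa_rho_ideal f : two_sided_ideal (@zigzag_ideal_rel F Gamma) f -> pa_rho f = 0.
Proof.
elim=> {f} [f||f g _ f0 _ g0|f g _ g0|f g _ g0]; last 4 first.
- exact: linear0.
- by rewrite linearD /= f0 g0 addr0.
- by rewrite pa_rhoM g0 mulmx0.
- by rewrite pa_rhoM g0 mul0mx.
rewrite /zigzag_ideal_rel; case: ifP => _ [].
- move=> p; rewrite pa_rho_pathv /path_mx /path_length /path_src /path_steps.
  have := path_valP p; case: (path_val p) => a [|b [|c [|d s]]] //= /and4P[ab bc cd _] _.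
  rewrite !mulmxA (zz_xx zf ab bc); case: eqP => [ac|_]; last by rewrite !mul0mx.
  by rewrite ac (zz_zx zf cd) mul0mx.
- move=> a b c ab bc ac; rewrite pa_rho_pathv /path_mx /= mulmxA (zz_xx zf ab bc).
  by rewrite (negbTE ac) mul0mx.
- move=> a b c ab ac; rewrite linearB /= !pa_rho_pathv /path_mx /= !mulmxA.
  by rewrite !(zz_xx zf) ?eqxx ?subrr // adj_sym.
Qed.

End Walks.

Let e a : Q := pi (vtx a).
Let x a b : Q := pi (arrow a b).
Let z a : Q := if [pick b | adj a b] is Some b then x a b * x b a else 0.

Lemma adjC a b : adj a b -> adj b a. Proof. by rewrite adj_sym. Qed.

Lemma card_neq2 a b c : a != b -> b != c -> a != c -> #|Gamma| != 2.
Proof.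
move=> ab bc ac; have : (#|[:: a; b; c]| <= #|Gamma|)%N by exact: max_card.
rewrite (card_uniqP _) /=; last by rewrite !inE negb_or ab ac bc.
by move=> h; rewrite gtn_eqF.
Qed.

Lemma zigzag_xx0 a b c : adj a b -> adj b c -> a != c -> x a b * x b c = 0.
Proof.
move=> ab bc ac; rewrite -piM arrowM; apply: pi_ideal.
rewrite /zigzag_ideal_rel ifN; first exact: zigzag_rel_straight.
apply: (@card_neq2 a b c _ _ ac); [apply: contraTneq ab => -> | apply: contraTneq bc => ->];
  by rewrite adj_irr.
Qed.

Lemma zigzag_loop a b : adj a b -> x a b * x b a = z a.
Proof.
move=> ab; rewrite /z; case: pickP => [c ac|/(_ b)]; last by rewrite ab.
have [->//|bc] := eqVneq b c.
apply/eqP; rewrite -subr_eq0 -!piM -raddfB /=.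
rewrite (arrowM ab (adj_symm ab)) (arrowM ac (adj_symm ac)); apply/eqP/pi_ideal.
rewrite /zigzag_ideal_rel ifN; first exact: zigzag_rel_back.
apply: (@card_neq2 a b c _ bc); [apply: contraTneq ab => -> | apply: contraTneq ac => ->];
  by rewrite adj_irr.
Qed.

(** Paths with three arrows vanish: turning back inside such a path can be
    moved to another edge, after which the path goes straight somewhere. *)
Lemma zigzag_xxx a b : adj a b -> x a b * x b a * x a b = 0.
Proof.
move=> ab; have ba := adjC ab; have [c2|/has_nbr2] := eqVneq #|Gamma| 2.
  have -> : x a b * x b a * x a b = pi (arrow a b * arrow b a * arrow a b) by rewrite !piM.
  rewrite (arrowM ab ba) (arrowE ab).
  pose p := @DPath Gamma (a, [:: b; a; b]) (introT and4P (And4 ab ba ab isT)).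
  rewrite (pathvM_cat (r := p)) //; apply: pi_ideal.
  by rewrite /zigzag_ideal_rel c2 eqxx; apply: long_path_relP.
case/(_ _ _ ab) => [[c ac cb]|[c bc ca]].
  by rewrite zigzag_loop // -(zigzag_loop ac) -mulrA zigzag_xx0 ?mulr0 // adjC.
rewrite -mulrA zigzag_loop // -(zigzag_loop bc) mulrA zigzag_xx0 ?mul0r //.
by rewrite eq_sym.
Qed.

Lemma quotient_family : zigzag_family *%R 1 e x z.
Proof.
have zE a b (ab : adj a b) := esym (zigzag_loop ab).
have ex a b : adj a b -> e a * x a b = x a b by move=> ab; rewrite -piM vtx_arrow.
have xe a b : adj a b -> x a b * e b = x a b by move=> ab; rewrite -piM arrow_vtx.
split=> [|a b|a b ab|a b ab|a|a|a b c ab bc|a b ab|a b ab|a].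
- by rewrite -pi1 /e -raddf_sum.
- by rewrite -piM vtxM; case: eqP => // _; rewrite raddf0.
- exact: ex.
- exact: xe.
- by have [b ab] := has_nbr a; rewrite (zE _ _ ab) mulrA ex.
- by have [b ab] := has_nbr a; rewrite (zE _ _ ab) -mulrA xe // adjC.
- have [<-|ac] := eqVneq a c; first exact: zigzag_loop.
  exact: zigzag_xx0.
- by rewrite (zE _ _ ab) zigzag_xxx.
- by rewrite (zE _ _ (adjC ab)) mulrA zigzag_xxx.
- by have [b ab] := has_nbr a; rewrite (zE _ _ ab) mulrA zigzag_xxx ?mul0r.
Qed.

Lemma quotient_gen (S : Q -> Prop) :
  (forall a, S (e a)) -> (forall a b, adj a b -> S (x a b)) ->
  (forall c u v, S u -> S v -> S (c *: u + v)) -> (forall u v, S u -> S v -> S (u * v)) ->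
  forall u, S u.
Proof.
move=> Se Sx Slin Smul u; rewrite -[u]quot_reprK -/(pi _); move: (quot_repr u) => f.
have S0 : S 0 by rewrite -(addNr (e (base_vertex Gamma))) -scaleN1r; exact: Slin.
have Spath p : S (pi (pathv F p)).
  case: p => -[a s] /=; elim: s a => [|b s IH] a ps.
    by rewrite (_ : @DPath Gamma (a, [::]) ps = triv_path a); [exact: Se | exact: val_inj].
  have /andP[ab bs] := ps.
  rewrite -(@pathvM_cat (step_path ab) (@DPath Gamma (b, s) bs)) // piM -arrowE.
  by apply: Smul; [exact: Sx | exact: IH].
have fE : f = linext (@pathv F Gamma) f.
  by apply: (pathv_ext (u := idfun) (v := linext (@pathv F Gamma))) => p; rewrite /= linext_pathv.
rewrite fE /linext linear_sum; elim/big_rec: _ => //= p g _ Sg.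
by rewrite linearZ; apply: Slin.
Qed.

Lemma path_quotient_presentation : @zigzag_presentation F Gamma Q e x z.
Proof.
split; first exact: quotient_family.
- by move=> S Se Sx _ Slin Smul u; apply: quotient_gen.
- move=> n E X Z zf; pose rho (u : Q) := pa_rho E X (quot_repr u).
  have rho_pi f : rho (pi f) = pa_rho E X f.
    apply/eqP; rewrite eq_sym -subr_eq0 -linearB /=; apply/eqP.
    by apply: (pa_rho_ideal zf); exact: quot_reprP.
  have piK u : pi (quot_repr u) = u by exact: quot_reprK.
  have arrowX a b : adj a b -> pa_rho E X (arrow a b) = X a b.
    by move=> ab; rewrite arrowE pa_rho_pathv /path_mx /= (zz_xe zf).
  exists rho; split; [| | |split].
  + by move=> c u v; rewrite -[u]piK -[v]piK -linearP !rho_pi linearP.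
  + by rewrite -pi1 rho_pi (pa_rho1 zf).
  + by move=> u v; rewrite -[u]piK -[v]piK -piM !rho_pi (pa_rhoM zf).
  + by move=> a; rewrite rho_pi pa_rho_pathv.
  + by move=> a b ab; rewrite rho_pi arrowX.
  + move=> a; have [b ab] := has_nbr a; rewrite -(zigzag_loop ab) -piM rho_pi (pa_rhoM zf).
    by rewrite (arrowX a b ab) (arrowX b a (adjC ab)) (zz_xx zf ab (adjC ab)) eqxx.
Qed.

End PathQuotient.

(** A neighbour of each vertex turns the loops into classes of paths, and a third
    vertex next to each edge makes the paths with three arrows vanish. *)
Theorem zigzag_algebra_presentation :
  (#|Gamma| != 1 -> forall a, exists b, adj a b) ->
  (#|Gamma| != 2 -> forall a b, adj a b ->
    (exists2 c, adj a c & c != b) \/ (exists2 c, adj b c & c != a)) ->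
  exists e x z, @zigzag_presentation F Gamma (zigzag_algebra F Gamma) e x z.
Proof.
move=> nbr nbr2; rewrite /zigzag_algebra; case: ifP => [/eqP|/negbT n1].
  exact: one_vertex_presentation.
have := path_quotient_presentation (nbr n1) nbr2.
by move=> h; do 3 eexists; exact: h.
Qed.

End ZigzagPresentation.

(** * Dynkin graphs *)

Section DynkinGraphs.
Local Open Scope nat_scope.

Ltac split_ifs :=
  repeat match goal with |- context [if ?b then _ else _] => case: (boolP b) => ? end.

Lemma sum_ord_sumn n (P : pred nat) (W : nat -> nat) :
  (\sum_(j < n | P j) W j)%N = sumn [seq W j | j <- iota 0 n & P j].
Proof.
by rewrite -(big_mkord P W) /index_iota subn0 -big_filter sumnE big_map.
Qed.

Lemma leq_sum_seq n (P : pred nat) (W : nat -> nat) (L : seq nat) :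
  (forall j, j < n -> P j -> j \in L)%N ->
  (\sum_(j < n | P j) W j <= \sum_(k <- L | k < n) W k)%N.
Proof.
elim: L P => [|k L IH] P PL.
  rewrite [leqLHS]big_pred0 // => j; apply/negP => /(PL _ (ltn_ord j)).
  by rewrite in_nil.
rewrite (bigID (fun j : 'I_n => j == k :> nat)) big_cons /=.
have le1 : (\sum_(j < n | P j && (j == k :> nat)) W j <= if (k < n)%N then W k else 0)%N.
  rewrite -(@big_ord1_eq _ 0%N addn W k n) [leqRHS](bigID (fun j : 'I_n => P j)) /=.
  by rewrite (eq_bigl (fun j : 'I_n => (j == k :> nat) && P j)) ?leq_addr // => j; rewrite andbC.
have le2 : (\sum_(j < n | P j && (j != k :> nat)) W j <= \sum_(k <- L | k < n) W k)%N.
  apply: (IH (fun j => P j && (j != k))) => j jn /andP[Pj jk].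
  by have := PL _ jn Pj; rewrite inE (negbTE jk).
by case: ifP le1 => _ le1; [|rewrite -[leqRHS]add0n]; apply: leq_add.
Qed.

(** The coefficients of the sum of the positive roots on the simple roots (twice
    that sum in type D, and the sum itself in the others); a simple root pairs
    positively with it. *)
Definition dynkin_weight (t : dynkin_type) (i : nat) : nat :=
  match t with
  | DynA n => i.+1 * (n - i)
  | DynD n => if (i < n - 2)%N then 2 * (i.+1 * (2 * n - i.+2)) else n * n.-1
  | DynE 6 => nth 0 [:: 16; 30; 42; 30; 16; 22] i
  | DynE 7 => nth 0 [:: 34; 66; 96; 75; 52; 27; 49] i
  | DynE _ => nth 0 [:: 92; 182; 270; 220; 168; 114; 58; 136] i
  end.

Definition dynkin_color (t : dynkin_type) (i : nat) : bool :=
  match t with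
  | DynA n => odd i
  | DynD n => if i == n.-1 then ~~ odd (n - 3) else odd i
  | DynE n => if i == n.-1 then true else odd i
  end.

Lemma dynkin_weight_gt0 t i : dynkin_wf t -> (i < dynkin_rank t)%N -> (0 < dynkin_weight t i)%N.
Proof.
case: t => [n|n|n] /=; first by nia.
  by move=> n4 i_n; case: ifP => h; nia.
case/andP=> n6 n8; have : n \in [:: 6; 7; 8] by rewrite !inE; lia.
by rewrite !inE => /or3P[] /eqP ->; do 8![case: i => [|i] //].
Qed.

Lemma dynkin_weight_nbr t i : dynkin_wf t -> (i < dynkin_rank t)%N ->
  (\sum_(j < dynkin_rank t | dynkin_adj t i j) dynkin_weight t j < 2 * dynkin_weight t i)%N.
Proof.
case: t => [n|n|n]; rewrite /dynkin_wf /dynkin_rank => wf i_n.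
- case: i i_n => [|i] i_n.
    apply: leq_ltn_trans (leq_sum_seq (L := [:: 1]) _ _) _.
      by move=> j jn; rewrite /dynkin_adj /= inE; lia.
    by rewrite big_cons big_nil /dynkin_weight; split_ifs; nia.
  apply: leq_ltn_trans (leq_sum_seq (L := [:: i; i.+2]) _ _) _.
    by move=> j jn; rewrite /dynkin_adj /= !inE; lia.
  by rewrite !big_cons big_nil /dynkin_weight; split_ifs; nia.
- have [m nE] : exists m, n = m.+4 by exists (n - 4); lia.
  subst n => {wf}.
  have [lt|ge] := ltnP i m.+1.
    case: i i_n lt => [|i] i_n lt.
      apply: leq_ltn_trans (leq_sum_seq (L := [:: 1]) _ _) _.
        by move=> j jn; rewrite /dynkin_adj /= inE; lia.
      by rewrite big_cons big_nil /dynkin_weight; split_ifs; nia.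
    apply: leq_ltn_trans (leq_sum_seq (L := [:: i; i.+2]) _ _) _.
      by move=> j jn; rewrite /dynkin_adj /= !inE; lia.
    by rewrite !big_cons big_nil /dynkin_weight; split_ifs; nia.
  have [->|ne] := eqVneq i m.+1.
    apply: leq_ltn_trans (leq_sum_seq (L := [:: m; m.+2; m.+3]) _ _) _.
      by move=> j jn; rewrite /dynkin_adj /= !inE; lia.
    by rewrite !big_cons big_nil /dynkin_weight; split_ifs; nia.
  apply: leq_ltn_trans (leq_sum_seq (L := [:: m.+1]) _ _) _.
    by move=> j jn; rewrite /dynkin_adj /= !inE; lia.
  by rewrite !big_cons big_nil /dynkin_weight; split_ifs; nia.
- rewrite (sum_ord_sumn n (dynkin_adj (DynE n) i) (dynkin_weight (DynE n))).
  have : n \in [:: 6; 7; 8] by rewrite !inE; lia.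
  by rewrite !inE => /or3P[] /eqP nE; move: i_n; rewrite nE {wf nE}; do 8![case: i => [|i] //].
Qed.

Lemma dynkin_color_adj t i j : dynkin_wf t -> (i < dynkin_rank t)%N -> (j < dynkin_rank t)%N ->
  dynkin_adj t i j -> dynkin_color t i != dynkin_color t j.
Proof.
case: t => [n|n|n] /= wf i_n jn; rewrite /dynkin_adj /=.
- by case/orP => /eqP -> /=; case: (odd _).
- have [m nE] : exists m, n = m.+4 by exists (n - 4); lia.
  subst n; rewrite !subSS subn0 /=.
  case/orP=> /orP[/andP[/eqP -> h]|/andP[/eqP -> /eqP ->]]; split_ifs => /=; try lia.
- case/orP=> /orP[/andP[/eqP -> h]|/andP[/eqP -> /eqP ->]]; split_ifs => /=; try lia.
Qed.

Lemma dynkin_nbr t i : dynkin_wf t -> (i < dynkin_rank t)%N -> dynkin_rank t != 1%N ->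
  exists2 j, (j < dynkin_rank t)%N & dynkin_adj t i j.
Proof.
case: t => [n|n|n] /= wf i_n n1.
- have [h|h] := ltnP i.+1 n; first by exists i.+1; rewrite // /dynkin_adj /= eqxx.
  by exists i.-1; rewrite /dynkin_adj /=; lia.
- have [h|h] := ltnP i (n - 2); first by exists i.+1; rewrite /dynkin_adj /=; lia.
  by exists (n - 3); rewrite /dynkin_adj /=; lia.
- have [h|h] := ltnP i (n - 2); first by exists i.+1; rewrite /dynkin_adj /=; lia.
  have [h'|h'] := eqVneq i (n - 2); first by exists (n - 3); rewrite /dynkin_adj /=; lia.
  by exists 2; rewrite /dynkin_adj /=; lia.
Qed.

Lemma dynkin_nbr2 t i j : dynkin_wf t -> (i < dynkin_rank t)%N -> (j < dynkin_rank t)%N ->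
  dynkin_rank t != 2 -> dynkin_adj t i j ->
  exists2 k, (k < dynkin_rank t)%N & dynkin_adj t i k && (k != j) || dynkin_adj t j k && (k != i).
Proof.
move=> wf i_n jn n2 ij; wlog arr : i j i_n jn {ij} / dynkin_arrow t i j.
  move=> H; case/orP: ij => [|ji]; first exact: H.
  by have [k kn kP] := H _ _ jn i_n ji; exists k; rewrite // orbC.
case: t wf i_n jn n2 arr => [n|n|n] /= wf i_n jn n2 arr.
- by have [i0|i0] := posnP i; [exists 2 | exists i.-1]; rewrite /dynkin_adj /=; lia.
- have [i0|i0] := posnP i; last by exists i.-1; rewrite /dynkin_adj /=; lia.
  by exists 2; rewrite /dynkin_adj /=; lia.
- have [i0|i0] := posnP i; last by exists i.-1; rewrite /dynkin_adj /=; lia.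
  by exists 2; rewrite /dynkin_adj /=; lia.
Qed.

Variable Gamma : sgraph.
Hypothesis dyn : dynkin Gamma.

Lemma dynkin_graph_weight : exists2 w : Gamma -> int,
  (forall a, (0 < w a)%R) & (forall a, (nbr_sum w a < 2 * w a)%R).
Proof.
have [t wf [f [g fg gf] adjE]] := dyn.
exists (fun a => (dynkin_weight t (f a))%:Z) => a.
  by have := dynkin_weight_gt0 wf (ltn_ord (f a)).
rewrite /nbr_sum -(big_morph Posz PoszD (erefl _)) (reindex g) /=; last by exists f => ? _.
under eq_big => [j|j _] do [rewrite adjE gf|rewrite gf].
by rewrite -[2%R]/(Posz 2) -PoszM ltz_nat; exact: dynkin_weight_nbr.
Qed.

Lemma dynkin_graph_color : exists eps : Gamma -> bool, forall a b, adj a b -> eps a != eps b.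
Proof.
have [t wf [f _ adjE]] := dyn; exists (fun a => dynkin_color t (f a)) => a b.
by rewrite adjE; exact: dynkin_color_adj.
Qed.

Lemma dynkin_card t (f : Gamma -> 'I_(dynkin_rank t)) : bijective f -> #|Gamma| = dynkin_rank t.
Proof. by move/bij_eq_card; rewrite card_ord. Qed.

Lemma dynkin_graph_nbr : #|Gamma| != 1%N -> forall a : Gamma, exists b, adj a b.
Proof.
have [t wf [f fb adjE]] := dyn; rewrite (dynkin_card fb); have [g fg gf] := fb => n1 a.
have [j jn aj] := dynkin_nbr wf (ltn_ord (f a)) n1.
by exists (g (Ordinal jn)); rewrite adjE gf.
Qed.

Lemma dynkin_graph_nbr2 : #|Gamma| != 2%N -> forall a b : Gamma, adj a b ->
  (exists2 c, adj a c & c != b) \/ (exists2 c, adj b c & c != a).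
Proof.
have [t wf [f fb adjE]] := dyn; rewrite (dynkin_card fb); have [g fg gf] := fb => n2 a b.
rewrite adjE => ab; have [k kn] := dynkin_nbr2 wf (ltn_ord (f a)) (ltn_ord (f b)) n2 ab.
have ne c : k != f c :> nat -> g (Ordinal kn) != c.
  by apply: contra_neq => <-; rewrite gf.
case/orP=> /andP[ak kb]; [left | right]; exists (g (Ordinal kn)); rewrite ?adjE ?gf //;
  exact: ne.
Qed.

End DynkinGraphs.

Theorem corollary1 (R : realType) (Gamma : sgraph) (hGamma : dynkin Gamma) :
  exists M : root_lattice Gamma -> lmodType (zigzag_algebra R[i] Gamma),
  [/\ forall x, is_root x -> fin_dim (M x) /\ indecomposable (M x),
      forall x y, is_root x -> is_root y -> rep_iso (M x) (M y) -> x = y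
    & forall V : lmodType (zigzag_algebra R[i] Gamma),
        fin_dim V -> indecomposable V -> exists2 x, is_root x & rep_iso V (M x)].
Proof.
have [w w_gt0 w_nbr] := dynkin_graph_weight hGamma.
have [eps eps_adj] := dynkin_graph_color hGamma.
have [e [x [z zz]]] := zigzag_algebra_presentation R[i]
  (dynkin_graph_nbr hGamma) (dynkin_graph_nbr2 hGamma).
exact (presented_roots_modules zz w_gt0 w_nbr eps_adj).
Qed.
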